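(* Let $\mathbb{K}$ be $\mathbb{R}$ or $\mathbb{C}$, and let $(M,e)$ be a pointed manifold of dimension $m$. 1. The $\mathbb{K}$-vector space $\mathcal{E}'_e(M)$ equipped with the linear maps $\Delta_e$, $\epsilon_e$ and the element $\mathbf{1}_e$ is a $C^5$-coalgebra, which is (non canonically) isomorphic to the standard symmetric coalgebra $(\mathsf{S}(\mathbb{R}^m),\epsilon,\Delta,\mathbf{1})$ (with scalars extended to $\mathbb{K}$). 2. The strong symmetric monoidal functor $F:(M,e)\mapsto\mathcal{E}'_e(M)$, $\phi\mapsto\phi_*$, extends to a functor, also denoted $F$, from the category $\mathcal{M}f*$ of pointed manifolds to the symmetric monoidal category of $C^5$-coalgebras over $\mathbb{K}$. 3. The subspace of all primitive elements of the coaugmented coalgebra $\mathcal{E}'_e(M)$ is naturally isomorphic to the tangent space $T_eM$ (with scalars extended to $\mathbb{K}$). Moreover, for each smooth map $\phi:(M,e)\to(M',e')$ of pointed manifolds, the coalgebra morphism $\phi_*:\mathcal{E}'_e(M)\to\mathcal{E}'_{e'}(M')$ induces (on primitive elements, under these isomorphisms) the tangent map $T_e\phi:T_eM\to T_{e'}M'$.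
   Context: Manifolds are smooth, Hausdorff and second countable. $\mathcal{M}f*$ has as objects pairs $(M,e)$ of a non-empty manifold and a point $e\in M$, and as morphisms smooth point-preserving maps; it is symmetric monoidal with the cartesian product. $\mathcal{E}'_e(M)$ is the $\mathbb{K}$-vector space of continuous linear maps $T:\mathcal{C}^\infty(M,\mathbb{K})\to\mathbb{K}$ (distributions) supported in $\{e\}$. For a smooth pointed map $\phi:(M,e)\to(M',e')$, $(\phi_*T)(f')=T(f'\circ\phi)$. Put $\epsilon_e(T)=T(1)$ and $\mathbf{1}_e=\delta_e:f\mapsto f(e)$. The natural linear isomorphism $F_{2~M,N}:\mathcal{E}'_{e_1}(M)\otimes\mathcal{E}'_{e_2}(N)\to\mathcal{E}'_{(e_1,e_2)}(M\times N)$ is $F_{2~M,N}(S\otimes T)(f)=S\big(x\mapsto T(f(x,\cdot))\big)$; together with $F_0=\epsilon_{\mathrm{pt}}:\mathcal{E}'_{\mathrm{pt}}(\{\mathrm{pt}\})\cong\mathbb{K}$ it makes $F$ a strong symmetric monoidal functor to $\mathbb{K}$-vector spaces. With $\mathrm{diag}_M(x)=(x,x)$, set $\Delta_e=F_{2~M,M}^{-1}\circ(\mathrm{diag}_M)_*$. A $C^3$-coalgebra is a coassociative counital coalgebra with an element $\mathbf{1}$ satisfying $\Delta(\mathbf{1})=\mathbf{1}\otimes\mathbf{1}$, $\epsilon(\mathbf{1})=1$; morphisms preserve $\Delta,\epsilon,\mathbf{1}$. It is connected if it is the union of the $C_{(k)}$, where $C_{(0)}=\mathbb{K}\mathbf{1}$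 and $C_{(k+1)}=\{x:\Delta(x)-x\otimes\mathbf{1}-\mathbf{1}\otimes x\in C_{(k)}\otimes C_{(k)}\}$. A $C^5$-coalgebra is a connected cocommutative $C^3$-coalgebra. Primitive elements are $x$ with $\Delta(x)=x\otimes\mathbf{1}+\mathbf{1}\otimes x$. The standard symmetric coalgebra $\mathsf{S}(V)$ is the symmetric algebra with the coalgebra structure for which $\Delta$ is an algebra morphism and elements of $V$ are primitive, $\epsilon$ being the projection to degree $0$. *)

(* Defs.v *)
From HB Require Import structures.
From mathcomp Require Import all_boot all_order all_algebra.
From mathcomp Require Import boolp classical_sets.
From mathcomp Require mpoly.
Set Implicit Arguments.
Unset Strict Implicit.
Unset Printing Implicit Defensive.
Import Order.TTheory GRing.Theory Num.Theory.
Local Open Scope ring_scope.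
Local Open Scope quotient_scope.

(* Some sections are wrapped in modules to keep apart the names that Hierarchy
   Builder generates for their instances. *)
Module TensorProduct.
(* The tensor product V (x) W over a commutative ring K: finite formal sums of
   pairs modulo the congruence generated by bilinearity. *)
Section Def.
Variables (K : comNzRingType) (V W : lmodType K).

Inductive tensor_eq : seq (V * W) -> seq (V * W) -> Prop :=
| TeqRefl s : tensor_eq s s
| TeqSym s t : tensor_eq s t -> tensor_eq t s
| TeqTrans s t u : tensor_eq s t -> tensor_eq t u -> tensor_eq s u
| TeqCat s1 s2 t1 t2 :
    tensor_eq s1 s2 -> tensor_eq t1 t2 -> tensor_eq (s1 ++ t1) (s2 ++ t2)
| TeqSwap p q : tensor_eq [:: p; q] [:: q; p]
| TeqZero w : tensor_eq [:: (0, w)] [::]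
| TeqAddl v v' w : tensor_eq [:: (v + v', w)] [:: (v, w); (v', w)]
| TeqAddr v w w' : tensor_eq [:: (v, w + w')] [:: (v, w); (v, w')]
| TeqScale c v w : tensor_eq [:: (c *: v, w)] [:: (v, c *: w)].

Definition tensor_eqb : rel (seq (V * W)) := fun s t => `[< tensor_eq s t >].

Fact tensor_eqb_refl : reflexive tensor_eqb.
Proof. by move=> s; apply/asboolP; exact: TeqRefl. Qed.

Fact tensor_eqb_sym : symmetric tensor_eqb.
Proof. by move=> s t; apply/asboolP/asboolP => /TeqSym. Qed.

Fact tensor_eqb_trans : transitive tensor_eqb.
Proof.
by move=> t s u /asboolP st /asboolP tu; apply/asboolP; exact: TeqTrans tu.
Qed.

Canonical tensor_equiv :=
  EquivRel tensor_eqb tensor_eqb_refl tensor_eqb_sym tensor_eqb_trans.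

Definition tensor := {eq_quot tensor_equiv}.

HB.instance Definition _ := Choice.on tensor.
HB.instance Definition _ := EqQuotient.on tensor.

Lemma tensor_piP (s t : seq (V * W)) :
  reflect (tensor_eq s t) (\pi_tensor s == \pi_tensor t).
Proof. by rewrite eqmodE; exact: asboolP. Qed.

Lemma tensor_pi (s t : seq (V * W)) :
  tensor_eq s t -> \pi_tensor s = \pi_tensor t.
Proof. by move=> /tensor_piP/eqP. Qed.

Lemma tensor_repr (s : seq (V * W)) : tensor_eq (repr (\pi_tensor s)) s.
Proof. by apply/tensor_piP; rewrite reprK. Qed.

Definition tens (v : V) (w : W) : tensor := \pi_tensor [:: (v, w)].

Definition scale_pairs (c : K) (s : seq (V * W)) := [seq (c *: p.1, p.2) | p <- s].

Lemma scale_pairs_eq c s t :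
  tensor_eq s t -> tensor_eq (scale_pairs c s) (scale_pairs c t).
Proof.
elim=> {s t} [s|s t _|s t u _ + _|s1 s2 t1 t2 _ + _|p q|w|v v' w|v w w'|d v w] /=.
- exact: TeqRefl.
- exact: TeqSym.
- exact: TeqTrans.
- by rewrite /scale_pairs !map_cat; exact: TeqCat.
- exact: TeqSwap.
- by rewrite /scale_pairs /= scaler0; exact: TeqZero.
- by rewrite /scale_pairs /= scalerDr; exact: TeqAddl.
- exact: TeqAddr.
- by rewrite /scale_pairs /= scalerA mulrC -scalerA; exact: TeqScale.
Qed.

Lemma tensor_eq_catC s t : tensor_eq (s ++ t) (t ++ s).
Proof.
suff sw p u : tensor_eq (p :: u) (u ++ [:: p]).
  elim: s t => [|p s IHs] t; first by rewrite cats0; exact: TeqRefl.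
  rewrite cat_cons; apply: TeqTrans (sw p (s ++ t)) _.
  rewrite -catA; apply: TeqTrans (IHs _) _; rewrite -catA /=.
  by apply: TeqCat; exact: TeqRefl.
elim: u => [|q u IHu] /=; first exact: TeqRefl.
apply: TeqTrans (_ : tensor_eq _ (q :: p :: u)) _.
  by apply: (@TeqCat [:: p; q] [:: q; p]); [exact: TeqSwap|exact: TeqRefl].
by apply: (@TeqCat [:: q] [:: q]) => //; exact: TeqRefl.
Qed.

Definition tensor_zero : tensor := \pi_tensor [::].
Definition tensor_add (s t : tensor) : tensor := \pi_tensor (repr s ++ repr t).
Definition tensor_scale (c : K) (s : tensor) : tensor :=
  \pi_tensor (scale_pairs c (repr s)).

Lemma tensor_add_pi s t :
  tensor_add (\pi_tensor s) (\pi_tensor t) = \pi_tensor (s ++ t).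
Proof. by apply: tensor_pi; apply: TeqCat; exact: tensor_repr. Qed.

Lemma tensor_scale_pi c s :
  tensor_scale c (\pi_tensor s) = \pi_tensor (scale_pairs c s).
Proof. by apply: tensor_pi; apply: scale_pairs_eq; exact: tensor_repr. Qed.

Fact tensor_addA : associative tensor_add.
Proof.
elim/quotW => s; elim/quotW => t; elim/quotW => u.
by rewrite (tensor_add_pi t u) (tensor_add_pi s t) 2!tensor_add_pi catA.
Qed.

Fact tensor_addC : commutative tensor_add.
Proof. by move=> s t; apply: tensor_pi; exact: tensor_eq_catC. Qed.

Fact tensor_add0 : left_id tensor_zero tensor_add.
Proof. by move=> s; rewrite -[s]reprK tensor_add_pi. Qed.

Lemma scale_pairs1 s : scale_pairs 1 s = s.
Proof. by rewrite -[RHS]map_id; apply: eq_map => -[v w]; rewrite /= scale1r. Qed.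

Lemma scale_pairs0 s : tensor_eq (scale_pairs 0 s) [::].
Proof.
elim: s => [|[v w] s IHs] /=; first exact: TeqRefl.
rewrite scale0r; exact: (TeqCat (TeqZero w) IHs).
Qed.

Lemma scale_pairsD a b s :
  tensor_eq (scale_pairs (a + b) s) (scale_pairs a s ++ scale_pairs b s).
Proof.
elim: s => [|[v w] s IHs] /=; first exact: TeqRefl.
rewrite scalerDl.
apply: (TeqTrans (TeqCat (TeqAddl _ _ _) IHs)).
apply: (@TeqCat [:: _] [:: _]); first exact: TeqRefl.
rewrite -[X in tensor_eq _ (_ ++ X)]cat1s catA.
rewrite -[X in tensor_eq X _]/([:: _] ++ _) catA.
by apply: TeqCat; [exact: tensor_eq_catC|exact: TeqRefl].
Qed.

Fact tensor_addN : left_inverse tensor_zero (tensor_scale (-1)) tensor_add.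
Proof.
elim/quotW => s; rewrite tensor_scale_pi tensor_add_pi; apply: tensor_pi.
rewrite -[X in _ ++ X]scale_pairs1.
apply: (TeqTrans (TeqSym (scale_pairsD _ _ _))).
by rewrite addNr; exact: scale_pairs0.
Qed.

HB.instance Definition _ := GRing.isZmodule.Build tensor
  tensor_addA tensor_addC tensor_add0 tensor_addN.

Fact tensor_scaleA a b s :
  tensor_scale a (tensor_scale b s) = tensor_scale (a * b) s.
Proof.
elim/quotW: s => s; rewrite (tensor_scale_pi b s) 2!tensor_scale_pi.
rewrite /scale_pairs -map_comp; congr (\pi_tensor _).
by apply: eq_map => p /=; rewrite scalerA.
Qed.

Fact tensor_scale1 : left_id 1 tensor_scale.
Proof. by elim/quotW => s; rewrite tensor_scale_pi scale_pairs1. Qed.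

Fact tensor_scaleDr : right_distributive tensor_scale +%R.
Proof.
move=> c; elim/quotW => s; elim/quotW => t.
rewrite [_ + _]tensor_add_pi 3!tensor_scale_pi [RHS]tensor_add_pi.
by rewrite /scale_pairs map_cat.
Qed.

Fact tensor_scaleDl s : {morph tensor_scale^~ s : a b / a + b}.
Proof.
move=> a b; elim/quotW: s => s.
rewrite 3!tensor_scale_pi [RHS]tensor_add_pi; apply: tensor_pi.
exact: scale_pairsD.
Qed.

HB.instance Definition _ := GRing.Zmodule_isLmodule.Build K tensor
  tensor_scaleA tensor_scale1 tensor_scaleDr tensor_scaleDl.

End Def.
End TensorProduct.
Export TensorProduct.

Notation "v \ox w" := (tens v w) (at level 40, left associativity) : ring_scope.

Section TensorLift.
Variables (K : comNzRingType) (V W : lmodType K).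

Definition bilinear_map (X : lmodType K) (b : V -> W -> X) :=
  (forall w, linear (b^~ w)) /\ (forall v, linear (b v)).

(* The map on V (x) W induced by b; meaningful when b is bilinear, see
   [tensor_lift_tens]. *)
Definition tensor_lift (X : nmodType) (b : V -> W -> X) (t : tensor V W) : X :=
  \sum_(p <- repr t) b p.1 p.2.

Lemma tensor_eq_sum (X : lmodType K) (b : V -> W -> X) s t :
  bilinear_map b -> tensor_eq s t ->
  \sum_(p <- s) b p.1 p.2 = \sum_(p <- t) b p.1 p.2.
Proof.
move=> [bl br].
have bZl a v w : b (a *: v) w = a *: b v w.
  have b0 : b 0 w = 0.
    by have /(congr1 (fun x => x - b 0 w)) := bl w 1 0 0;
       rewrite !scale1r addr0 addrK subrr.
  by have := bl w a v 0; rewrite b0 !addr0.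
have bZr a v w : b v (a *: w) = a *: b v w.
  have b0 : b v 0 = 0.
    by have /(congr1 (fun x => x - b v 0)) := br v 1 0 0;
       rewrite !scale1r addr0 addrK subrr.
  by have := br v a w 0; rewrite b0 !addr0.
elim=> {s t} [s|s t _ //|s t u _ -> _ //|s1 s2 t1 t2 _ IHs _ IHt|p q|w|v v' w
  |v w w'|c v w]; rewrite ?(big_cat, big_cons, big_nil) /= ?addr0 //.
- by rewrite IHs IHt.
- by rewrite addrC.
- by rewrite -[0 in LHS](scale0r (0 : V)) bZl scale0r.
- by have := bl w 1 v v'; rewrite !scale1r.
- by have := br v 1 w w'; rewrite !scale1r.
- by rewrite bZl bZr.
Qed.

Lemma tensor_lift_pi (X : lmodType K) (b : V -> W -> X) s : bilinear_map b ->
  tensor_lift b (\pi_(tensor V W) s) = \sum_(p <- s) b p.1 p.2.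
Proof. by move=> bb; apply: tensor_eq_sum => //; exact: tensor_repr. Qed.

Lemma tensor_lift_tens (X : lmodType K) (b : V -> W -> X) v w :
  bilinear_map b -> tensor_lift b (v \ox w) = b v w.
Proof. by move=> bb; rewrite tensor_lift_pi // big_seq1. Qed.

Lemma tensor_lift_linear (X : lmodType K) (b : V -> W -> X) :
  bilinear_map b -> linear (tensor_lift b).
Proof.
move=> bb a; elim/quotW => s; elim/quotW => t.
rewrite [a *: _]tensor_scale_pi [_ + _]tensor_add_pi !tensor_lift_pi //.
rewrite big_cat big_map /= scaler_sumr; congr (_ + _).
apply: eq_bigr => -[v w] _ /=.
have b0 : b 0 w = 0.
  by have /(congr1 (fun x => x - b 0 w)) := bb.1 w 1 0 0;
     rewrite !scale1r addr0 addrK subrr.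
by have := bb.1 w a v 0; rewrite b0 !addr0.
Qed.

Lemma tens_bilinear : bilinear_map (@tens K V W).
Proof.
split=> [w a v v'|v a w w'].
  rewrite [_ *: (_ \ox _)]tensor_scale_pi [RHS]tensor_add_pi.
  by apply: tensor_pi; exact: TeqAddl.
rewrite [_ *: (_ \ox _)]tensor_scale_pi [RHS]tensor_add_pi; apply: tensor_pi.
apply: (TeqTrans (TeqAddr _ _ _)).
apply: (@TeqCat _ _ _ [:: _] [:: _]); last exact: TeqRefl.
exact/TeqSym/TeqScale.
Qed.

Lemma tensor_span (t : tensor V W) : t = \sum_(p <- repr t) p.1 \ox p.2.
Proof.
rewrite -[LHS]reprK; elim: (repr t) => [|[v w] s IHs]; first by rewrite big_nil.
by rewrite big_cons /= -IHs [RHS]tensor_add_pi.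
Qed.

End TensorLift.

Section TensorMaps.
Variable K : comNzRingType.

Definition tensor_map (V V' W W' : lmodType K) (f : V -> V') (g : W -> W') :
    tensor V W -> tensor V' W' :=
  tensor_lift (fun v w => f v \ox g w).

Definition tensor_assoc (U V W : lmodType K) :
    tensor (tensor U V) W -> tensor U (tensor V W) :=
  tensor_lift (fun t w => tensor_lift (fun u v => u \ox (v \ox w)) t).

Definition tensor_swap (V W : lmodType K) : tensor V W -> tensor W V :=
  tensor_lift (fun v w => w \ox v).

Definition tensor_mul (A B : algType K) (s t : tensor A B) : tensor A B :=
  tensor_lift (fun a b => tensor_lift (fun c d => (a * c) \ox (b * d)) t) s.

End TensorMaps.

Section Coalgebras.
Variable K : fieldType.

(* The bare data of a coaugmented coalgebra; the axioms are in [is_C3] below. *)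
Record coalgebra := Coalgebra {
  coalg_space :> lmodType K;
  comul : coalg_space -> tensor coalg_space coalg_space;
  counit : coalg_space -> K;
  coaug : coalg_space }.

Record is_C3 (C : coalgebra) : Prop := IsC3 {
  comul_linear : linear (@comul C);
  counit_linear : scalar (@counit C);
  comulA : forall x : C, tensor_assoc (tensor_map (@comul C) id (comul x)) =
                         tensor_map id (@comul C) (comul x);
  counitl : forall x : C, tensor_lift (fun a b => counit a *: b) (comul x) = x;
  counitr : forall x : C, tensor_lift (fun a b => counit b *: a) (comul x) = x;
  comul_coaug : comul (coaug C) = coaug C \ox coaug C;
  counit_coaug : counit (coaug C) = 1 }.

(* A (x) B as a subspace of C (x) C, for subspaces A and B of C *)
Definition tensor_sub (C : lmodType K) (A B : set C) : set (tensor C C) :=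
  [set t | exists2 s : seq (C * C),
     forall p, p \in s -> A p.1 /\ B p.2 & t = \sum_(p <- s) p.1 \ox p.2].

Fixpoint coalg_filtration (C : coalgebra) (k : nat) : set C :=
  if k is j.+1 then
    [set x | tensor_sub (coalg_filtration j) (coalg_filtration j)
               (comul x - x \ox coaug C - coaug C \ox x)]
  else [set x | exists a : K, x = a *: coaug C].

Definition coalg_connected (C : coalgebra) :=
  forall x : C, exists k, coalg_filtration k x.

Definition cocommutative (C : coalgebra) :=
  forall x : C, tensor_swap (comul x) = comul x.

Definition is_C5 (C : coalgebra) :=
  [/\ is_C3 C, coalg_connected C & cocommutative C].

Record coalg_morphism (C D : coalgebra) (f : C -> D) : Prop := CoalgMorphism {
  coalg_morphism_linear : linear f;
  coalg_morphism_comul : forall x, tensor_map f f (comul x) = comul (f x);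
  coalg_morphism_counit : forall x, counit (f x) = counit x;
  coalg_morphism_coaug : f (coaug C) = coaug D }.

Definition coalg_iso (C D : coalgebra) (f : C -> D) :=
  coalg_morphism f /\ bijective f.

Definition primitive_elements (C : coalgebra) : set C :=
  [set x | comul x = x \ox coaug C + coaug C \ox x].

Definition coalg_unit : coalgebra :=
  @Coalgebra K^o (fun a => a *: ((1 : K^o) \ox (1 : K^o))) id (1 : K).

Definition coalg_tensor (C D : coalgebra) : coalgebra :=
  @Coalgebra (tensor C D)
    (tensor_lift (fun c d =>
       tensor_lift (fun c1 c2 =>
         tensor_lift (fun d1 d2 => (c1 \ox d1) \ox (c2 \ox d2)) (comul d))
       (comul c)))
    (tensor_lift (fun c d => counit c * counit d))
    (coaug C \ox coaug D).

End Coalgebras.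

(* mpoly is imported inside this module only, as its notations are not
   compatible with those of mathcomp-analysis. *)
Module SymmetricCoalgebra.
Import mpoly.

Section Def.
Variables (K : fieldType) (m : nat).

(* S(K^m), the symmetric algebra of K^m, is the polynomial algebra on the
   canonical basis of K^m. *)
Definition sym_alg : algType K := {mpoly K[m]}.

Definition sym_gen (i : 'I_m) : sym_alg := 'X_i.

Definition sym_unit : tensor sym_alg sym_alg := 1 \ox 1.

(* The algebra morphism for which each 'X_i is primitive: the monomial of
   exponent a is sent to the product of the ('X_i (x) 1 + 1 (x) 'X_i) ^ a_i. *)
Definition sym_comul (p : sym_alg) : tensor sym_alg sym_alg :=
  \sum_(a <- msupp (p : {mpoly K[m]})) mcoeff a p *:
    \big[(@tensor_mul K sym_alg sym_alg)/sym_unit]_(i < m)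
      iter (a i) (tensor_mul (sym_gen i \ox 1 + 1 \ox sym_gen i)) sym_unit.

Definition sym_coalg : coalgebra K :=
  @Coalgebra K sym_alg sym_comul (mcoeff 0%MM : {mpoly K[m]} -> K) 1.

End Def.
End SymmetricCoalgebra.

From mathcomp Require Import all_classical all_reals all_analysis.
From mathcomp Require Import complex.
Import numFieldNormedType.Exports.
Local Open Scope classical_set_scope.

Section Smooth.
Variable R : realType.

(* f is C^k on the open set U: its partial derivatives up to order k exist and
   are continuous on U. *)
Fixpoint Ck (k m : nat) (U : set 'rV[R]_m) (f : 'rV[R]_m -> R) : Prop :=
  (forall x, U x -> {for x, continuous f}) /\
  if k is j.+1 then
    forall i : 'I_m, (forall x, U x -> derivable f x (delta_mx 0 i)) /\
                     Ck j U ('D_(delta_mx 0 i) f)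
  else True.

Definition smooth_on m (U : set 'rV[R]_m) (f : 'rV[R]_m -> R) :=
  forall k, Ck k U f.

Definition smooth_map_on m n (U : set 'rV[R]_m) (f : 'rV[R]_m -> 'rV[R]_n) :=
  forall j : 'I_n, smooth_on U (fun x => f x 0 j).

(* The iterated partial derivative of f along the list of directions s *)
Definition partials m (s : seq 'I_m) (f : 'rV[R]_m -> R) : 'rV[R]_m -> R :=
  foldr (fun i g => 'D_(delta_mx 0 i) g) f s.

Lemma Ck_continuous k m (U : set 'rV[R]_m) f x :
  Ck k U f -> U x -> {for x, continuous f}.
Proof. by case: k => [|k] [cf _] /cf. Qed.

Lemma Ck_eq k m (U : set 'rV[R]_m) (f g : 'rV[R]_m -> R) : open U ->
  (forall x, U x -> f x = g x) -> Ck k U f -> Ck k U g.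
Proof.
move=> oU.
have nfg (f' g' : 'rV[R]_m -> R) x : (forall x, U x -> f' x = g' x) -> U x ->
    {near x, f' =1 g'}.
  by move=> fg Ux; near=> y; apply: fg; near: y; exact: open_nbhs_nbhs.
have cfg (f' g' : 'rV[R]_m -> R) : (forall x, U x -> f' x = g' x) ->
    (forall x, U x -> {for x, continuous f'}) ->
    forall x, U x -> {for x, continuous g'}.
  move=> fg cf x Ux; rewrite /prop_for /continuous_at -fg //.
  exact: cvg_trans (near_eq_cvg (nfg _ _ _ fg Ux)) (cf x Ux).
elim: k f g => [|k IHk] f g fg [cf Hf]; split; do ?exact: cfg cf.
  by [].
move=> i; have [df Ckf] := Hf i; split.
  by move=> x Ux; apply: near_eq_derivable (df x Ux); exact: nfg.
apply: IHk Ckf => x Ux; apply: near_eq_derive; exact: nfg.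
Unshelve. all: by end_near. Qed.

Lemma Ck_cst k m (U : set 'rV[R]_m) (a : R) : Ck k U (cst a).
Proof.
elim: k a => [|k IHk] a; split=> //; do ?by move=> x _; exact: cst_continuous.
move=> i; split=> [x _|]; first exact: derivable_cst.
rewrite (_ : 'D_(delta_mx 0 i) (cst a) = cst 0); first exact: IHk.
by apply/funext => x; rewrite derive_cst.
Qed.

Lemma Ck_lin k m (U : set 'rV[R]_m) (a : R) (f g : 'rV[R]_m -> R) : open U ->
  Ck k U f -> Ck k U g -> Ck k U (fun x => a * f x + g x).
Proof.
move=> oU; elim: k f g => [|k IHk] f g [cf Hf] [cg Hg]; split=> //;
  do ?by move=> x Ux; apply: (cvgD (cvgM (cvg_cst a) (cf x Ux)) (cg x Ux)).
move=> i; have [df Ckf] := Hf i; have [dg Ckg] := Hg i.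
have dag x : U x -> derivable (a \*: f) x (delta_mx 0 i).
  by move=> /df; exact: derivableZ.
split=> [x Ux|]; first by apply: (derivableD (dag x Ux)); exact: dg.
apply: Ck_eq (IHk _ _ Ckf Ckg) => // x Ux.
rewrite -[LHS]/(a *: 'D_(delta_mx 0 i) f x + 'D_(delta_mx 0 i) g x).
rewrite -deriveZ; last exact: df.
by rewrite -deriveD; [|exact: dag|exact: dg].
Qed.

(* Precomposition with a linear projection onto some of the coordinates *)
Lemma Ck_proj k m n (L : {linear 'rV[R]_n -> 'rV[R]_m}) (U : set 'rV[R]_m)
    (V : set 'rV[R]_n) (f : 'rV[R]_m -> R) :
  continuous L -> (forall i, L (delta_mx 0 i) = 0 \/
                     exists j, L (delta_mx 0 i) = delta_mx 0 j) ->
  (forall x, V x -> U (L x)) -> Ck k U f -> Ck k V (f \o L).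
Proof.
move=> cL HL VU.
have DL (h : 'rV[R]_m -> R) x v :
    (fun t : R => t^-1 *: (((h \o L) \o shift x) (t *: v) - (h \o L) x)) =
    (fun t : R => t^-1 *: ((h \o shift (L x)) (t *: L v) - h (L x))).
  by apply/funext => t /=; rewrite linearP.
elim: k f => [|k IHk] f [cf Hf]; split=> //;
  do ?by move=> x Vx; apply: continuous_comp; [exact: cL|exact/cf/VU].
move=> i; have DE : 'D_(delta_mx 0 i) (f \o L) = 'D_(L (delta_mx 0 i)) f \o L.
  by apply/funext => x; rewrite /derive DL.
have dE x : derivable (f \o L) x (delta_mx 0 i) =
    derivable f (L x) (L (delta_mx 0 i)).
  by rewrite /derivable DL.
have [L0|[j Lj]] := HL i.
  split=> [x Vx|]; first by rewrite dE L0; exact: derivable0.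
  rewrite DE L0 (_ : _ \o _ = cst 0); first exact: Ck_cst.
  by apply/funext => x /=; rewrite derive0.
have [df Ckf] := Hf j; split=> [x Vx|]; first by rewrite dE Lj; exact/df/VU.
by rewrite DE Lj; exact: IHk.
Qed.

End Smooth.

Section Manifolds.
Variable R : realType.

(* A chart is a homeomorphism from an open subset of M to an open subset of R^m;
   both directions are total functions, relevant only on these subsets. *)
Record chart (m : nat) (M : topologicalType) := Chart {
  cdom : set M;
  cimg : set 'rV[R]_m;
  cfun : M -> 'rV[R]_m;
  cinv : 'rV[R]_m -> M;
  cdom_open : open cdom;
  cimg_open : open cimg;
  cfun_img : forall x, cdom x -> cimg (cfun x);
  cinv_dom : forall y, cimg y -> cdom (cinv y);
  cfunK : forall x, cdom x -> cinv (cfun x) = x;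
  cinvK : forall y, cimg y -> cfun (cinv y) = y;
  cfun_continuous : forall x, cdom x -> {for x, continuous cfun};
  cinv_continuous : forall y, cimg y -> {for y, continuous cinv} }.

Definition chart_compat m M (c d : chart m M) :=
  smooth_map_on (cimg c `&` cinv c @^-1` cdom d) (cfun d \o cinv c).

Record manifold := Manifold {
  mdim : nat;
  mspace :> topologicalType;
  atlas : set (chart mdim mspace);
  mhausdorff : hausdorff_space mspace;
  msecond_countable : @second_countable mspace;
  atlas_cover : forall x, exists2 c, atlas c & cdom c x;
  atlas_compat : forall c d, atlas c -> atlas d -> chart_compat c d }.

Definition smooth_map (M N : manifold) (phi : M -> N) :=
  continuous phi /\
  forall c d, atlas c -> atlas d ->
    smooth_map_on (cimg c `&` (phi \o cinv c) @^-1` cdom d)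
                  (cfun d \o phi \o cinv c).

Section ChartProduct.
Variables (m n : nat) (M N : topologicalType) (c : chart m M) (d : chart n N).

Fact lsubmx_continuous : continuous (lsubmx : 'rV[R]_(m + n) -> 'rV[R]_m).
Proof.
move=> z A [P zP PA].
exists (fun i j => if fintype.split j is inl k then P i k else setT).
  move=> i j; case: fintype.splitP => k jk; last exact: filterT.
  have := zP i k; rewrite mxE; congr (nbhs (z _ _) _).
  by apply: val_inj.
move=> y Py; apply: PA => i j; have := Py i (lshift n j).
by rewrite (unsplitK (inl j)) mxE.
Qed.

Fact rsubmx_continuous : continuous (rsubmx : 'rV[R]_(m + n) -> 'rV[R]_n).
Proof.
move=> z A [P zP PA].
exists (fun i j => if fintype.split j is inr k then P i k else setT).
  move=> i j; case: fintype.splitP => k jk; first exact: filterT.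
  have := zP i k; rewrite mxE; congr (nbhs (z _ _) _).
  by apply: val_inj.
move=> y Py; apply: PA => i j; have := Py i (rshift m j).
by rewrite (unsplitK (inr j)) mxE.
Qed.

Fact row_mx_cvg (T : Type) (F : set_system T) {FF : Filter F}
    (f : T -> 'rV[R]_m) (g : T -> 'rV[R]_n) (a : 'rV[R]_m) (b : 'rV[R]_n) :
  f @ F --> a -> g @ F --> b ->
  (fun x => row_mx (f x) (g x)) @ F --> row_mx a b.
Proof.
move=> fa gb A [P zP PA].
have Fl : F [set x | forall i j, P i (lshift n j) (f x i j)].
  apply: (fa [set y | forall i j, P i (lshift n j) (y i j)]).
  exists (fun i j => P i (lshift n j)) => // i j.
  by have := zP i (lshift n j); rewrite row_mxEl.
have Fr : F [set x | forall i j, P i (rshift m j) (g x i j)].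
  apply: (gb [set y | forall i j, P i (rshift m j) (y i j)]).
  exists (fun i j => P i (rshift m j)) => // i j.
  by have := zP i (rshift m j); rewrite row_mxEr.
rewrite /nbhs /=; apply: filterS (filterI Fl Fr) => x [Pl Pr] /=.
apply: PA => i j.
rewrite -[j]fintype.splitK; case: (fintype.split j) => k.
  by rewrite [unsplit _]/(lshift n k) row_mxEl; exact: Pl.
by rewrite [unsplit _]/(rshift m k) row_mxEr; exact: Pr.
Qed.

Fact prod_nbhs_open (A : set M) (B : set N) : open A -> open B ->
  open (A `*` B).
Proof.
move=> oA oB; rewrite openE => -[x y] [Ax By].
by exists (A, B) => //; split; exact: open_nbhs_nbhs.
Qed.

Definition prod_chart : chart (m + n) (M * N)%type.
Proof.
refine (@Chart (m + n) (M * N)%type (cdom c `*` cdom d)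
  [set z | cimg c (lsubmx z) /\ cimg d (rsubmx z)]
  (fun p => row_mx (cfun c p.1) (cfun d p.2))
  (fun z => (cinv c (lsubmx z), cinv d (rsubmx z))) _ _ _ _ _ _ _ _).
- by apply: prod_nbhs_open; exact: cdom_open.
- apply: openI.
  + apply: (@open_comp _ _ (lsubmx : 'rV[R]_(m + n) -> 'rV[R]_m)).
      by move=> z _; exact: lsubmx_continuous.
    exact: cimg_open.
  + apply: (@open_comp _ _ (rsubmx : 'rV[R]_(m + n) -> 'rV[R]_n)).
      by move=> z _; exact: rsubmx_continuous.
    exact: cimg_open.
- move=> [x y] [/= cx dy]; rewrite row_mxKl row_mxKr.
  by split; exact: cfun_img.
- by move=> z [cz dz]; split; exact: cinv_dom.
- by move=> [x y] [/= cx dy]; rewrite row_mxKl row_mxKr !cfunK.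
- by move=> z [cz dz]; rewrite /= !cinvK // hsubmxK.
- move=> [x y] [/= cx dy]; apply: row_mx_cvg.
    apply: (@continuous_comp _ _ _ fst (cfun c)); first exact: cvg_fst.
    exact: cfun_continuous.
  apply: (@continuous_comp _ _ _ snd (cfun d)); first exact: cvg_snd.
  exact: cfun_continuous.
- move=> z [cz dz].
  have cl : {for z, continuous (cinv c \o lsubmx)}.
    by apply: continuous_comp; [exact: lsubmx_continuous|exact: cinv_continuous].
  have dr : {for z, continuous (cinv d \o rsubmx)}.
    by apply: continuous_comp; [exact: rsubmx_continuous|exact: cinv_continuous].
  exact: (cvg_pair cl dr).
Defined.

End ChartProduct.

Lemma prod_chart_compat m n (M N : topologicalType)
    (c c' : chart m M) (d d' : chart n N) :
  chart_compat c c' -> chart_compat d d' ->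
  chart_compat (prod_chart c d) (prod_chart c' d').
Proof.
move=> cc dd j k.
rewrite -[j]fintype.splitK; case: (fintype.split j) => i /=.
  under [X in Ck _ _ X]funext => x do rewrite row_mxEl.
  have := cc i k.
  apply: (@Ck_proj _ _ _ _ lsubmx).
  - exact: lsubmx_continuous.
  - move=> l; rewrite -[l]fintype.splitK; case: (fintype.split l) => q /=.
      right; exists q; apply/rowP => p; rewrite !mxE.
      by rewrite (inj_eq (@lshift_inj _ _)).
    by left; apply/rowP => p; rewrite !mxE eq_lrshift andbF.
  - by move=> x [[cx dx] [c'x d'x]].
under [X in Ck _ _ X]funext => x do rewrite row_mxEr.
have := dd i k.
apply: (@Ck_proj _ _ _ _ rsubmx).
- exact: rsubmx_continuous.
- move=> l; rewrite -[l]fintype.splitK; case: (fintype.split l) => q /=.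
    by left; apply/rowP => p; rewrite !mxE eq_rlshift andbF.
  right; exists q; apply/rowP => p; rewrite !mxE.
  by rewrite (inj_eq (@rshift_inj _ _)).
- by move=> x [[cx dx] [c'x d'x]].
Qed.

Fact prod_hausdorff (M N : topologicalType) :
  hausdorff_space M -> hausdorff_space N -> hausdorff_space (M * N)%type.
Proof.
move=> hM hN [x y] [x' y'] xy; congr (_, _).
  apply: hM => A B xA x'B.
  have nA : nbhs (x, y) (A `*` setT).
    by exists (A, setT) => //; split=> //; exact: filterT.
  have nB : nbhs (x', y') (B `*` setT).
    by exists (B, setT) => //; split=> //; exact: filterT.
  by have [[u v] [[/= Au _] [/= Bu _]]] := xy _ _ nA nB; exists u.
apply: hN => A B xA x'B.
have nA : nbhs (x, y) (setT `*` A).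
  by exists (setT, A) => //; split=> //; exact: filterT.
have nB : nbhs (x', y') (setT `*` B).
  by exists (setT, B) => //; split=> //; exact: filterT.
by have [[u v] [[/= _ Av] [/= _ Bv]]] := xy _ _ nA nB; exists v.
Qed.

Fact prod_second_countable (M N : topologicalType) :
  @second_countable M -> @second_countable N -> @second_countable (M * N)%type.
Proof.
move=> [A cA [oA bA]] [B cB [oB bB]].
exists [set p.1 `*` p.2 | p in A `*` B].
  by apply: sub_countable (countableX cA cB); exact: card_image_le.
split=> [_ [[a b] [/= Aa Bb] <-]|[x y] U [[V W] [/= xV yW] VWU]].
  by apply: prod_nbhs_open; [exact: oA|exact: oB].
have [V' [/= AV' V'x] V'V] := bA x V xV.
have [W' [/= BW' W'y] W'W] := bB y W yW.
exists (V' `*` W'); first by split; [exists (V', W')|].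
by move=> [u v] [/= V'u W'v]; apply: VWU; split; [exact: V'V|exact: W'W].
Qed.

Definition prod_manifold (M N : manifold) : manifold.
Proof.
refine (@Manifold (mdim M + mdim N) (M * N)%type
  [set e | exists c d, [/\ atlas c, atlas d & e = prod_chart c d]] _ _ _ _).
- exact: prod_hausdorff (@mhausdorff M) (@mhausdorff N).
- exact: prod_second_countable (@msecond_countable M) (@msecond_countable N).
- move=> [x y]; have [c Ac cx] := atlas_cover x.
  have [d Ad dy] := atlas_cover y.
  by exists (prod_chart c d) => //; exists c, d.
- move=> _ _ [c [d [Ac Ad ->]]] [c' [d' [Ac' Ad' ->]]].
  by apply: prod_chart_compat; exact: atlas_compat.
Defined.

(* The one-point manifold is R^0. *)
Definition point_chart : chart 0 'rV[R]_0.
Proof.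
refine (@Chart 0 'rV[R]_0 setT setT id id _ _ _ _ _ _ _ _) => //.
- exact: openT.
- exact: openT.
- by move=> x _; exact: cvg_id.
- by move=> x _; exact: cvg_id.
Defined.

Definition point_manifold : manifold.
Proof.
refine (@Manifold 0 'rV[R]_0 [set point_chart] _ _ _ _).
- exact: norm_hausdorff.
- exists [set setT]; first exact: countable1.
  split=> [_ ->|x U xU]; first exact: openT.
  exists setT => // y _; rewrite [y]thinmx0 -[0](thinmx0 x).
  exact: nbhs_singleton.
- by move=> x; exists point_chart.
- by move=> c d _ _ [].
Defined.

Record pmanifold := PManifold { pspace :> manifold; base : pspace }.

Definition prod_pmanifold (M N : pmanifold) : pmanifold :=
  @PManifold (prod_manifold M N) (base M, base N).

Definition point_pmanifold : pmanifold := @PManifold point_manifold (0 : 'rV_0).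

Definition pointed_map (M N : pmanifold) (phi : M -> N) :=
  smooth_map phi /\ phi (base M) = base N.

End Manifolds.

Variant scalar_kind := RealScalars | ComplexScalars.

Definition scalars (R : realType) (k : scalar_kind) : numFieldType :=
  match k with RealScalars => R | ComplexScalars => R[i] end.

Definition scalar_re (R : realType) (k : scalar_kind) : scalars R k -> R :=
  match k return scalars R k -> R with
  | RealScalars => id | ComplexScalars => @complex.Re R end.

Definition scalar_im (R : realType) (k : scalar_kind) : scalars R k -> R :=
  match k return scalars R k -> R with
  | RealScalars => fun=> 0 | ComplexScalars => @complex.Im R end.

Definition of_real (R : realType) (k : scalar_kind) : R -> scalars R k :=
  match k return R -> scalars R k with
  | RealScalars => id | ComplexScalars => fun x => (x%:C)%C end.

Section ScalarsTheory.
Variables (R : realType) (k : scalar_kind).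
Local Notation K := (scalars R k).

Fact of_realD : {morph @of_real R k : x y / x + y}.
Proof. by case: k => x y //=; rewrite rmorphD. Qed.

Fact of_realM : {morph @of_real R k : x y / x * y}.
Proof. by case: k => x y //=; rewrite rmorphM. Qed.

Fact of_real1 : of_real k (1 : R) = 1.
Proof. by case: k. Qed.

Lemma scalar_reD (x y : K) : scalar_re (x + y) = scalar_re x + scalar_re y.
Proof. by move: x y; rewrite /scalars /scalar_re; case: k => //= -[a b] [c d]. Qed.

Lemma scalar_imD (x y : K) : scalar_im (x + y) = scalar_im x + scalar_im y.
Proof.
move: x y; rewrite /scalars /scalar_im; case: k => //= [|[a b] [c d] //].
by rewrite addr0.
Qed.

Lemma scalar_reM (x y : K) :
  scalar_re (x * y) = scalar_re x * scalar_re y - scalar_im x * scalar_im y.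
Proof.
move: x y; rewrite /scalars /scalar_re /scalar_im.
by case: k => //= [|[a b] [c d] //] x y; rewrite mul0r subr0.
Qed.

Lemma scalar_imM (x y : K) :
  scalar_im (x * y) = scalar_re x * scalar_im y + scalar_im x * scalar_re y.
Proof.
move: x y; rewrite /scalars /scalar_re /scalar_im.
by case: k => //= [|[a b] [c d] //] x y; rewrite mul0r mulr0 addr0.
Qed.

End ScalarsTheory.

Module RealScalars.
Section Def.
Variables (R : realType) (k : scalar_kind).
Local Notation K := (scalars R k).

(* K as a vector space over R *)
Definition real_scalars : Type := K.
HB.instance Definition _ := GRing.Zmodule.on real_scalars.

Fact real_scalarsA a b (x : real_scalars) :
  of_real k a * (of_real k b * x : K) = of_real k (a * b) * x :> K.
Proof. by rewrite mulrA of_realM. Qed.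
Fact real_scalars1 (x : real_scalars) : of_real k 1 * x = x :> K.
Proof. by rewrite of_real1 mul1r. Qed.
Fact real_scalarsDr a (x y : real_scalars) :
  of_real k a * (x + y : K) = of_real k a * x + of_real k a * y :> K.
Proof. exact: mulrDr. Qed.
Fact real_scalarsDl (x : real_scalars) a b :
  of_real k (a + b) * x = of_real k a * x + of_real k b * x :> K.
Proof. by rewrite of_realD mulrDl. Qed.

HB.instance Definition _ := GRing.Zmodule_isLmodule.Build R real_scalars
  real_scalarsA real_scalars1 real_scalarsDr real_scalarsDl.

End Def.
End RealScalars.
Export RealScalars.


Section SmoothFunctions.
Variables (R : realType) (k : scalar_kind) (M : manifold R).
Local Notation K := (scalars R k).

Definition smooth_fun : {pred M -> K^o} := fun f =>
  `[< forall c, atlas c ->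
      smooth_on (cimg c) (@scalar_re R k \o f \o cinv c) /\
      smooth_on (cimg c) (@scalar_im R k \o f \o cinv c) >].

Fact smooth_fun_submod : submod_closed smooth_fun.
Proof.
have re0 : @scalar_re R k 0 = 0 by rewrite /scalar_re; case: k.
have im0 : @scalar_im R k 0 = 0 by rewrite /scalar_im; case: k.
have s0 (c : chart R (mdim M) M) : smooth_on (cimg c) (fun=> 0).
  by move=> l; exact: Ck_cst.
split.
  apply/asboolP => c _; split; under [X in smooth_on _ X]funext => x do
    rewrite /= ?re0 ?im0; exact: s0.
move=> a f g /asboolP sf /asboolP sg; apply/asboolP => c Ac.
have [rf jf] := sf c Ac; have [rg jg] := sg c Ac.
have oc : open (cimg c) by exact: cimg_open.
split=> l.
  have h : Ck l (cimg c) (fun x => - scalar_im a * scalar_im (f (cinv c x)) +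
      scalar_re (g (cinv c x))) by apply: Ck_lin; [|exact: jf|exact: rg].
  have := Ck_lin (scalar_re a) oc (rf l) h; apply: Ck_eq => // x _ /=.
  by rewrite scalar_reD scalar_reM mulNr addrA.
have h : Ck l (cimg c) (fun x => scalar_im a * scalar_re (f (cinv c x)) +
    scalar_im (g (cinv c x))) by apply: Ck_lin; [|exact: rf|exact: jg].
have := Ck_lin (scalar_re a) oc (jf l) h; apply: Ck_eq => // x _ /=.
by rewrite scalar_imD scalar_imM addrA.
Qed.

HB.instance Definition _ :=
  GRing.isSubmodClosed.Build K (M -> K^o) smooth_fun smooth_fun_submod.

(* C^oo(M, K) *)
Record Cinfty := MkCinfty {
  Cinfty_fun :> M -> K^o; Cinfty_smooth : Cinfty_fun \in smooth_fun }.

HB.instance Definition _ := [isSub for Cinfty_fun].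
HB.instance Definition _ := [Choice of Cinfty by <:].
HB.instance Definition _ := [SubChoice_isSubLmodule of Cinfty by <:].

(* The functions whose iterated partial derivative along s, in the chart c, is
   uniformly e-close on L to that of f *)
Definition Cinfty_nbhd (f : Cinfty) (c : chart R (mdim M) M)
    (L : set 'rV[R]_(mdim M)) (s : seq 'I_(mdim M)) (e : R) : set Cinfty :=
  [set g : Cinfty | forall x, L x ->
    `|partials s (@scalar_re R k \o (g - f : Cinfty) \o cinv c) x| < e /\
    `|partials s (@scalar_im R k \o (g - f : Cinfty) \o cinv c) x| < e].

(* The usual Frechet topology of C^oo(M, K): uniform convergence on compact sets
   of all the partial derivatives in the charts. *)
HB.instance Definition _ := @isSubBaseTopological.Build Cinfty (set Cinfty)
  [set U | exists f c L s e, [/\ atlas c, compact L, L `<=` cimg c, 0 < e &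
                               U = Cinfty_nbhd f c L s e]]
  id.

(* T vanishes on the open set U; supp T is contained in {e} when T vanishes on the
   complement of {e}. *)
Definition vanishes_on (T : Cinfty -> K) (U : set M) :=
  forall f : Cinfty, closure [set x | f x != 0] `<=` U -> T f = 0.

Variable e : M.

Definition point_distribution : {pred Cinfty -> K^o} := fun T =>
  `[< [/\ scalar T, continuous (T : Cinfty -> K) & vanishes_on T (~` [set e])] >].

Fact point_distribution_submod : submod_closed point_distribution.
Proof.
split.
  apply/asboolP; split=> [a f g|f|//]; first by rewrite mulr0 addr0.
  exact: cst_continuous.
move=> a S T /asboolP[lS cS vS] /asboolP[lT cT vT]; apply/asboolP; split.
- move=> b f g; rewrite -[LHS]/(a * S (b *: f + g) + T (b *: f + g)) lS lT.
  rewrite -[RHS]/(b * (a * S f + T f) + (a * S g + T g)).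
  by rewrite !mulrDr !mulrA [b * a]mulrC addrACA.
- move=> f; exact: (cvgD (cvgM (cvg_cst (a : K)) (cS f)) (cT f)).
- move=> f ef; rewrite -[LHS]/(a * S f + T f).
  by rewrite vS // vT // mulr0 addr0.
Qed.

HB.instance Definition _ := GRing.isSubmodClosed.Build K (Cinfty -> K^o)
  point_distribution point_distribution_submod.

(* E'_e(M) *)
Record distr_at := MkDistrAt {
  distr_fun :> Cinfty -> K^o;
  distr_atP : distr_fun \in point_distribution }.

HB.instance Definition _ := [isSub for distr_fun].
HB.instance Definition _ := [Choice of distr_at by <:].
HB.instance Definition _ := [SubChoice_isSubLmodule of distr_at by <:].

End SmoothFunctions.

Section DistributionFunctor.
Variables (R : realType) (k : scalar_kind).
Local Notation K := (scalars R k).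
Local Notation "'E'' M" := (distr_at k (base M)) (at level 10, M at level 9).

(* T(f), with the junk value T(0) = 0 if f is not smooth *)
Definition dapply (M : pmanifold R) (T : E' M) (f : M -> K) : K :=
  T (insubd (0 : Cinfty k M) f).

(* The functional T as an element of E'_e(M), with junk value 0 if it is not a
   distribution supported in {e} *)
Definition to_distribution (M : pmanifold R) (T : Cinfty k M -> K) : E' M :=
  insubd (0 : E' M) T.

Definition dist_push (M N : pmanifold R) (phi : M -> N) (T : E' M) : E' N :=
  to_distribution (fun f => dapply T (f \o phi)).

Definition dist_counit (M : pmanifold R) (T : E' M) : K := dapply T (fun=> 1).

Definition dirac_delta (M : pmanifold R) : E' M :=
  to_distribution (fun f => f (base M)).

Definition dist_prod (M N : pmanifold R) (S : E' M) (T : E' N) :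
    E' (prod_pmanifold M N) :=
  to_distribution (fun f : Cinfty k (prod_pmanifold M N) =>
    dapply S (fun x => dapply T (fun y => f (x, y)))).

Definition dist_F2 (M N : pmanifold R) :
    tensor (E' M) (E' N) -> E' (prod_pmanifold M N) :=
  tensor_lift (@dist_prod M N).

Definition diag_map (M : pmanifold R) (x : M) : prod_pmanifold M M := (x, x).

(* F_2^{-1} o diag_*; the inverse is taken by choice, F_2 being bijective. *)
Definition dist_comul (M : pmanifold R) (T : E' M) : tensor (E' M) (E' M) :=
  xget 0 [set t | dist_F2 t = dist_push (@diag_map M) T].

Definition dist_coalg (M : pmanifold R) : coalgebra K :=
  @Coalgebra K (E' M) (@dist_comul M) (@dist_counit M) (dirac_delta M).

Definition prod_map (M M' N N' : pmanifold R) (phi : M -> M') (psi : N -> N')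
    (p : prod_pmanifold M N) : prod_pmanifold M' N' := (phi p.1, psi p.2).

Definition assoc_map (M N P : pmanifold R)
    (p : prod_pmanifold (prod_pmanifold M N) P) :
    prod_pmanifold M (prod_pmanifold N P) := (p.1.1, (p.1.2, p.2)).

Definition swap_map (M N : pmanifold R) (p : prod_pmanifold M N) :
    prod_pmanifold N M := (p.2, p.1).

Definition lunit_map (M : pmanifold R)
  (p : prod_pmanifold (point_pmanifold R) M) : M := p.2.

Definition runit_map (M : pmanifold R)
  (p : prod_pmanifold M (point_pmanifold R)) : M := p.1.

End DistributionFunctor.

Section TangentSpace.
Variables (R : realType).

Section Def.
Variable M : pmanifold R.

Definition chart_at := {c : chart R (mdim M) M | atlas c /\ cdom c (base M)}.

(* A tangent vector at the base point e is given by its components v c in every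
   chart c at e, related by the differentials of the changes of charts. *)
Definition tangent_family : {pred chart_at -> 'rV[R]_(mdim M)} := fun v =>
  `[< forall c d : chart_at,
      v d = 'd (cfun (sval d) \o cinv (sval c)) (cfun (sval c) (base M)) (v c) >].

Fact tangent_family_submod : submod_closed tangent_family.
Proof.
split; first by apply/asboolP => c d; rewrite linear0.
move=> a v w /asboolP hv /asboolP hw; apply/asboolP => c d.
rewrite -[LHS]/(a *: v d + w d) (hv c d) (hw c d).
by rewrite -[X in _ = 'd _ _ X]/(a *: v c + w c) linearP.
Qed.

HB.instance Definition _ := GRing.isSubmodClosed.Build R
  (chart_at -> 'rV[R]_(mdim M)) tangent_family tangent_family_submod.

Record tangent_space := MkTangent {
  components :> chart_at -> 'rV[R]_(mdim M);
  tangentP : components \in tangent_family }.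

HB.instance Definition _ := [isSub for components].
HB.instance Definition _ := [Choice of tangent_space by <:].
HB.instance Definition _ := [SubChoice_isSubLmodule of tangent_space by <:].

Fact chart_at_inhabited : exists c : chart R (mdim M) M, atlas c /\ cdom c (base M).
Proof. by have [c Ac cM] := atlas_cover (base M); exists c. Qed.

Definition preferred_chart : chart_at := cid chart_at_inhabited.

End Def.

(* The components of the image under T_e phi of the vector with components u in
   the chart c *)
Definition tangent_image (M N : pmanifold R) (phi : M -> N) (c : chart_at M)
    (u : 'rV[R]_(mdim M)) (d : chart_at N) : 'rV[R]_(mdim N) :=
  'd (cfun (sval d) \o phi \o cinv (sval c)) (cfun (sval c) (base M)) u.

(* T_e phi, computed in the preferred chart at e *)
Definition tangent_map (M N : pmanifold R) (phi : M -> N) (v : tangent_space M) :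
    tangent_space N :=
  insubd (0 : tangent_space N)
    (tangent_image phi (preferred_chart M) (v (preferred_chart M))).

End TangentSpace.

Section ScalarExtension.
Variables (R : realType) (k : scalar_kind).
Local Notation K := (scalars R k).

(* K (x)_R V *)
Definition scalar_ext (V : lmodType R) := tensor (real_scalars R k) V.

Definition scalar_ext_scale (V : lmodType R) (a : K) (t : scalar_ext V) :
    scalar_ext V :=
  tensor_lift (fun (z : real_scalars R k) (v : V) =>
    tens (a * (z : K) : real_scalars R k) v) t.

Definition scalar_ext_map (V W : lmodType R) (f : V -> W) :
    scalar_ext V -> scalar_ext W :=
  tensor_map id f.

Definition scalar_ext_linear (V : lmodType R) (X : lmodType K)
    (f : scalar_ext V -> X) :=
  (forall s t, f (s + t) = f s + f t) /\
  (forall a t, f (scalar_ext_scale a t) = a *: f t).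

End ScalarExtension.

(* Main.v *)
From HB Require Import structures.
Require Import Defs.
From mathcomp Require Import all_boot all_order all_algebra.
From mathcomp Require Import boolp classical_sets.
From mathcomp Require mpoly.
Import Order.TTheory GRing.Theory Num.Theory SymmetricCoalgebra.
Set Implicit Arguments.
Unset Strict Implicit.
Unset Printing Implicit Defensive.
Local Open Scope ring_scope.

(** A distribution supported at e has finite order: if f vanishes at e together
    with enough partial derivatives, in one chart and hence in all of them, then
    T f = 0.  Indeed let chi_n be a cutoff equal to 1 near e whose support shrinks
    to e.  All the chi_n f have the same germ at e, hence the same value under T,
    while chi_n f tends to 0 in the topology of smooth functions; a multiple of f
    on which T would take the value 1 contradicts the continuity of T
    ([distr_finite_order]).  The convergence is the estimate
    [cutoff_estimate]: each derivative of chi_n costs a factor of order n^(1/2), and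
    each order of vanishing of f gains as much.

    By the Taylor formula [taylor_flat], T is therefore the finite combination of
    the divided derivatives D_a = (1/a!) d^a at e whose coefficients are the values
    of T on the monomials (x - e)^a, cut off to global functions.  So the D_a form a
    basis of E'_e(M), and evaluation on the monomials gives the coordinates
    ([dual_basis_distr]); conversely, every linear functional of finite order is a
    distribution supported at e ([finite_order_distribution]).  This last criterion
    is what shows that delta_e, the push-forwards and the products of distributions
    are distributions: each is visibly linear, and flatness is preserved by smooth
    pull-backs ([flat_pullback]) and by slices ([flat_partial_slice]).

    In product charts the monomials are the products of monomials of the factors, so
    F_2 carries the basis D_a (x) D_b to the basis of E'(M x N); it is bijective
    ([dist_F2_bijective]), and Delta is characterised by the duality
    (f (x) g)(Delta T) = T(f g) ([dist_comul_pairing]).  For monomials f and g this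
    says that the coordinate of Delta T at (a, b) is the coordinate of T at a + b:
    the D_a are a basis of divided powers ([divided_power_basis]).  A coalgebra with
    such a basis is coassociative because addition of exponents is associative,
    cocommutative because it is commutative, connected because an element of order k
    lies in the k-th step of the filtration ([divided_power_C5]); it is isomorphic to
    the symmetric coalgebra, where (1/a!) X^a is another such basis
    ([sym_coalg_iso]); and its primitive elements are the combinations of the D_a of
    order one ([divided_power_primitive]).  For distributions these are the first
    derivatives along the coordinate directions, that is, the tangent vectors.

    All identities between maps of distributions are checked on test functions.  On
    a product, products f(x) g(y) suffice ([product_separation]), and for these the
    claim reduces to elementary manipulations of pairings of tensors. *)

(** * Multi-indices and words in the coordinate directions *)

Notation multi_index m := {ffun 'I_m -> nat}.

Section MultiIndex.
Variable m : nat.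
Implicit Types a b : multi_index m.

Definition ideg a : nat := \sum_i a i.
Definition ifact a : nat := \prod_i (a i)`!.
Definition iunit (i : 'I_m) : multi_index m := [ffun j => (j == i) : nat].
Definition ipred (i : 'I_m) a : multi_index m := [ffun j => a j - (j == i)]%N.

Lemma multi_addI c : injective (fun a => a + c).
Proof. by move=> a b /ffunP ab; apply/ffunP => i; have := ab i; rewrite !ffunE => /addIn. Qed.

Lemma ideg0 : ideg 0 = 0%N.
Proof. by apply: big1 => i _; rewrite ffunE. Qed.

Lemma idegD a b : ideg (a + b) = (ideg a + ideg b)%N.
Proof. by rewrite /ideg -big_split; apply: eq_bigr => i _; rewrite ffunE. Qed.

Lemma ideg_eq0 a : (ideg a == 0%N) = (a == 0).
Proof.
apply/idP/eqP => [/eqP a0|->]; last by rewrite ideg0.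
apply/ffunP => i; rewrite ffunE; apply/eqP; rewrite -leqn0 -[X in (_ <= X)%N]a0.
by rewrite /ideg (bigD1 i) //= leq_addr.
Qed.

Lemma leq_ideg a i : (a i <= ideg a)%N.
Proof. by rewrite /ideg (bigD1 i) //= leq_addr. Qed.

Lemma ideg_unit i : ideg (iunit i) = 1%N.
Proof.
rewrite /ideg (bigD1 i) //= ffunE eqxx big1 // => j ji.
by rewrite ffunE (negbTE ji).
Qed.

Lemma ideg_eq1 a : ideg a = 1%N -> exists i, a = iunit i.
Proof.
move=> a1; have [i ai] : exists i, a i != 0%N.
  apply/existsP; apply: contraT; rewrite negb_exists => /forallP a0.
  suff : a == 0 by rewrite -ideg_eq0 a1.
  by apply/eqP/ffunP => i; rewrite ffunE; apply/eqP; have := a0 i; rewrite negbK.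
exists i; apply/ffunP => j; rewrite ffunE.
have := a1; rewrite /ideg (bigD1 i) //=.
have [->|ji] := eqVneq j i.
  by case: (a i) ai => // -[|k] _ //; rewrite !addSn.
rewrite (bigD1 j) //=; move: ai; rewrite -lt0n.
by case: (a i) => // k _; rewrite addSn => -[]/eqP; rewrite !addn_eq0 => /and3P[_ /eqP].
Qed.

Lemma iunit_inj : injective iunit.
Proof. by move=> i j /ffunP/(_ i); rewrite !ffunE eqxx; case: eqP. Qed.

Lemma ifact0 : ifact 0 = 1%N.
Proof. by apply: big1 => i _; rewrite ffunE. Qed.

Lemma ifact_gt0 a : (0 < ifact a)%N.
Proof. by apply: prodn_gt0 => i; exact: fact_gt0. Qed.

Lemma ipredK i a : (0 < a i)%N -> ipred i a + iunit i = a.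
Proof.
move=> ai; apply/ffunP => j; rewrite !ffunE; have [->|_] := eqVneq j i.
  by rewrite /= [LHS]subnK.
by rewrite subn0 [LHS]addn0.
Qed.

Lemma ifact_ipred i a : (0 < a i)%N -> ifact a = (a i * ifact (ipred i a))%N.
Proof.
move=> ai; rewrite /ifact (bigD1 i) // [in RHS](bigD1 i) //= ffunE eqxx.
case: (a i) ai => // k _; rewrite subn1 /= factS -mulnA; congr (_ * (_ * _))%N.
by apply: eq_bigr => j ji; rewrite ffunE (negbTE ji) subn0.
Qed.

Definition mult (s : seq 'I_m) : multi_index m := [ffun i => count_mem i s].
(** The order in which the directions are listed is a convention; it does not
    affect derivatives of smooth functions, by [partials_perm]. *)
Definition word a : seq 'I_m := flatten [seq nseq (a i) i | i <- enum 'I_m].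

Lemma word_mult a : mult (word a) = a.
Proof.
apply/ffunP => i; rewrite ffunE /word count_flatten -map_comp sumnE big_map.
rewrite big_enum (bigD1 i) //= count_nseq /= eqxx mul1n big1 ?addn0 // => j ji.
by rewrite count_nseq /= (negbTE ji) mul0n.
Qed.

Lemma perm_word s : perm_eq s (word (mult s)).
Proof.
apply/allP => i _ /=; have /ffunP/(_ i) := word_mult (mult s).
by rewrite !ffunE => ->.
Qed.

Lemma mult_cons s i : mult (i :: s) = mult s + iunit i.
Proof. by apply/ffunP => j; rewrite !ffunE /= addnC [i == j]eq_sym. Qed.

Lemma mult_rcons s i : mult (rcons s i) = mult s + iunit i.
Proof.
by apply/ffunP => j; rewrite !ffunE -cats1 count_cat /= addn0 [i == j]eq_sym.
Qed.

Lemma ideg_mult s : ideg (mult s) = size s.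
Proof.
elim: s => [|i s IHs]; last by rewrite mult_cons idegD ideg_unit IHs addn1.
by apply: big1 => i _; rewrite ffunE.
Qed.

(** A finite set of multi-indices containing all those of degree less than N. A
    cube is easier to enumerate than a simplex, and the extra terms that it adds
    to a Taylor polynomial do no harm. *)
Definition box (N : nat) : seq (multi_index m) :=
  [seq [ffun i => val (b i)] | b : {ffun 'I_m -> 'I_N}].

Lemma uniq_box N : uniq (box N).
Proof.
rewrite /box map_inj_uniq ?enum_uniq // => b c /ffunP bc.
by apply/ffunP => i; apply: val_inj; have := bc i; rewrite !ffunE.
Qed.

Lemma mem_box N a : (a \in box N) = [forall i, a i < N]%N.
Proof.
apply/mapP/forallP => [[b _ ->] i|aN]; first by rewrite ffunE ltn_ord.
exists [ffun i => Ordinal (aN i)]; first by rewrite mem_enum.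
by apply/ffunP => i; rewrite !ffunE.
Qed.

Lemma mem_box_ideg N a : (ideg a < N)%N -> a \in box N.
Proof. by move=> aN; rewrite mem_box; apply/forallP => i; apply: leq_ltn_trans aN; exact: leq_ideg. Qed.

End MultiIndex.

(** * Linear maps out of tensor products *)

Section LinearMaps.
Variables (K : comNzRingType) (V W : lmodType K).

Lemma linear_D (f : V -> W) : linear f -> {morph f : x y / x + y}.
Proof. by move=> lf x y; have := lf 1 x y; rewrite !scale1r. Qed.

Lemma linear_0 (f : V -> W) : linear f -> f 0 = 0.
Proof.
move=> lf; have := lf 1 0 0; rewrite !scale1r addr0.
by move/(congr1 (fun x => x - f 0)); rewrite subrr addrK.
Qed.

Lemma linear_Z (f : V -> W) a x : linear f -> f (a *: x) = a *: f x.
Proof. by move=> lf; have := lf a x 0; rewrite !addr0 (linear_0 lf) addr0. Qed.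

Lemma linear_B (f : V -> W) x y : linear f -> f (x - y) = f x - f y.
Proof. by move=> lf; rewrite (linear_D lf) -scaleN1r (linear_Z _ _ lf) scaleN1r. Qed.

Lemma linear_sums (f : V -> W) I (r : seq I) (P : pred I) F : linear f ->
  f (\sum_(i <- r | P i) F i) = \sum_(i <- r | P i) f (F i).
Proof.
by move=> lf; apply: (big_morph f (linear_D lf)); exact: linear_0.
Qed.

End LinearMaps.

Section TensorLinear.
Variables (K : comNzRingType) (V W X : lmodType K).

Lemma linear_compose (f : W -> X) (g : V -> W) : linear f -> linear g ->
  linear (fun x => f (g x)).
Proof. by move=> lf lg a x y; rewrite lg lf. Qed.

(** Additivity is enough because pure tensors span additively. This form also
    serves for maps that are linear over another ring than K. *)
Lemma additive_tensor_ext (Y : zmodType) (f g : tensor V W -> Y) :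
  {morph f : x y / x + y} -> {morph g : x y / x + y} ->
  (forall v w, f (v \ox w) = g (v \ox w)) -> f =1 g.
Proof.
move=> fD gD fg t.
have z (h : tensor V W -> Y) : {morph h : x y / x + y} -> h 0 = 0.
  move=> hD; have := hD 0 0; rewrite addr0.
  by move/(congr1 (fun x => x - h 0)); rewrite subrr addrK.
rewrite (tensor_span t) (big_morph f fD (z f fD)) (big_morph g gD (z g gD)).
by apply: eq_bigr => p _.
Qed.

Lemma linear_tensor_ext (f g : tensor V W -> X) : linear f -> linear g ->
  (forall v w, f (v \ox w) = g (v \ox w)) -> f =1 g.
Proof. by move=> lf lg; apply: additive_tensor_ext; exact: linear_D. Qed.

Lemma tensDl (v v' : V) (w : W) : (v + v') \ox w = v \ox w + v' \ox w.
Proof. exact: (linear_D ((tens_bilinear V W).1 w)). Qed.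
Lemma tensDr (v : V) (w w' : W) : v \ox (w + w') = v \ox w + v \ox w'.
Proof. exact: (linear_D ((tens_bilinear V W).2 v)). Qed.
Lemma tensZl a (v : V) (w : W) : (a *: v) \ox w = a *: (v \ox w).
Proof. exact: (linear_Z _ _ ((tens_bilinear V W).1 w)). Qed.
Lemma tensZr a (v : V) (w : W) : v \ox (a *: w) = a *: (v \ox w).
Proof. exact: (linear_Z _ _ ((tens_bilinear V W).2 v)). Qed.
Lemma tens_suml I (r : seq I) (F : I -> V) (w : W) :
  (\sum_(i <- r) F i) \ox w = \sum_(i <- r) F i \ox w.
Proof. exact: (linear_sums _ _ _ ((tens_bilinear V W).1 w)). Qed.
Lemma tens_sumr I (r : seq I) (v : V) (F : I -> W) :
  v \ox (\sum_(i <- r) F i) = \sum_(i <- r) v \ox F i.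
Proof. exact: (linear_sums _ _ _ ((tens_bilinear V W).2 v)). Qed.

End TensorLinear.

Section TensorOperations.
Variables (K : comNzRingType).
Implicit Types U V W X : lmodType K.

Lemma bilinear_tens V V' W W' (f : V -> V') (g : W -> W') :
  linear f -> linear g -> bilinear_map (fun v w => f v \ox g w).
Proof.
move=> lf lg; split=> [w|v].
  exact: (linear_compose ((tens_bilinear V' W').1 (g w)) lf).
exact: (linear_compose ((tens_bilinear V' W').2 (f v)) lg).
Qed.

Lemma tensor_mapE V V' W W' (f : V -> V') (g : W -> W') v w :
  linear f -> linear g -> tensor_map f g (v \ox w) = f v \ox g w.
Proof. by move=> lf lg; apply: tensor_lift_tens; exact: bilinear_tens. Qed.

Lemma tensor_map_linear V V' W W' (f : V -> V') (g : W -> W') :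
  linear f -> linear g -> linear (tensor_map f g).
Proof. by move=> lf lg; apply: tensor_lift_linear; exact: bilinear_tens. Qed.

Lemma linear_id V : linear (@idfun V). Proof. by []. Qed.

Lemma bilinear_swap V W : bilinear_map (fun (v : V) (w : W) => w \ox v).
Proof. by split=> [w|v]; [exact: (tens_bilinear W V).2|exact: (tens_bilinear W V).1]. Qed.

Lemma tensor_swapE V W (v : V) (w : W) : tensor_swap (v \ox w) = w \ox v.
Proof. by apply: tensor_lift_tens; exact: bilinear_swap. Qed.

Lemma tensor_swap_linear V W : linear (@tensor_swap K V W).
Proof. by apply: tensor_lift_linear; exact: bilinear_swap. Qed.

(** A trilinear map factors through the tensor product of its first two
    arguments; this provides the bilinearity needed to iterate [tensor_lift]. *)
Lemma tensor_lift_bilinear_l U V W X (b : U -> V -> W -> X) :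
  (forall w, bilinear_map (fun u v => b u v w)) -> (forall u v, linear (b u v)) ->
  bilinear_map (fun t w => tensor_lift (fun u v => b u v w) t).
Proof.
move=> b1 b2; split=> [w|t].
  by apply: tensor_lift_linear; exact: b1.
move=> a w w'; move: t.
apply: (@linear_tensor_ext K U V X).
- by apply: tensor_lift_linear; exact: b1.
- move=> c s t; rewrite !(tensor_lift_linear (b1 _)) !scalerDr !scalerA.
  by rewrite [a * c]mulrC addrACA.
by move=> u v; rewrite !(tensor_lift_tens _ _ (b1 _)); exact: b2.
Qed.

Lemma tensor_lift_bilinear_r U V W X (b : W -> U -> V -> X) :
  (forall w, bilinear_map (b w)) -> (forall u v, linear (fun w => b w u v)) ->
  bilinear_map (fun w t => tensor_lift (b w) t).
Proof.
move=> b1 b2; have [H1 H2] := tensor_lift_bilinear_l b1 b2.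
by split=> [w|v]; [exact: H2|exact: H1].
Qed.

Lemma bilinear_assoc U V W : bilinear_map (fun (t : tensor U V) (w : W) =>
  tensor_lift (fun u v => u \ox (v \ox w)) t).
Proof.
apply: (tensor_lift_bilinear_l (b := fun u v w => u \ox (v \ox w))) => [w|u v].
  split=> [v|u]; first exact: (tens_bilinear _ _).1.
  exact: (linear_compose ((tens_bilinear _ _).2 u) ((tens_bilinear _ _).1 w)).
exact: (linear_compose ((tens_bilinear _ _).2 u) ((tens_bilinear _ _).2 v)).
Qed.

Lemma tensor_assocE U V W (u : U) (v : V) (w : W) :
  tensor_assoc ((u \ox v) \ox w) = u \ox (v \ox w).
Proof.
rewrite /tensor_assoc (tensor_lift_tens _ _ (@bilinear_assoc U V W)).
apply: tensor_lift_tens; split=> [v'|u']; first exact: (tens_bilinear _ _).1.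
exact: (linear_compose ((tens_bilinear _ _).2 u') ((tens_bilinear _ _).1 w)).
Qed.

Lemma tensor_assoc_linear U V W : linear (@tensor_assoc K U V W).
Proof. by apply: tensor_lift_linear; exact: bilinear_assoc. Qed.

(** Families of such functionals f (x) g are used throughout to separate
    tensors, see [pairing_inj]. *)
Definition pairing V W (f : V -> K) (g : W -> K) (t : tensor V W) : K :=
  tensor_lift (X := K^o) (fun v w => f v * g w) t.

Lemma bilinear_pairing V W (f : V -> K) (g : W -> K) : scalar f -> scalar g ->
  @bilinear_map K V W K^o (fun v w => f v * g w).
Proof.
move=> lf lg; split=> [w a v v'|v a w w'] /=.
  by rewrite lf mulrDl -mulrA.
by rewrite lg mulrDr mulrCA.
Qed.

Lemma pairingE V W (f : V -> K) (g : W -> K) v w : scalar f -> scalar g ->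
  pairing f g (v \ox w) = f v * g w.
Proof. by move=> lf lg; apply: (tensor_lift_tens (X := K^o)); exact: bilinear_pairing. Qed.

Lemma pairing_linear V W (f : V -> K) (g : W -> K) : scalar f -> scalar g ->
  scalar (pairing f g).
Proof. by move=> lf lg; apply: (tensor_lift_linear (X := K^o)); exact: bilinear_pairing. Qed.

Lemma scalar_linear V (f : V -> K) : scalar f -> @linear_for K V K^o *:%R f.
Proof. by []. Qed.

Lemma scalar_compose V W (f : W -> K) (g : V -> W) : scalar f -> linear g ->
  scalar (fun x => f (g x)).
Proof. by move=> lf lg a x y; rewrite lg lf. Qed.

Lemma scalar_tensor_ext V W (f g : tensor V W -> K) : scalar f -> scalar g ->
  (forall v w, f (v \ox w) = g (v \ox w)) -> f =1 g.
Proof. exact: (@linear_tensor_ext K V W K^o). Qed.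

Lemma pairing_swap V W (f : V -> K) (g : W -> K) t : scalar f -> scalar g ->
  pairing g f (tensor_swap t) = pairing f g t.
Proof.
move=> lf lg; move: t; apply: scalar_tensor_ext; first last.
- by move=> v w; rewrite tensor_swapE !pairingE // mulrC.
- exact: pairing_linear.
exact: (scalar_compose (pairing_linear lg lf) (@tensor_swap_linear V W)).
Qed.

Lemma pairing_map V V' W W' (f : V' -> K) (g : W' -> K) (u : V -> V') (v : W -> W') t :
  scalar f -> scalar g -> linear u -> linear v ->
  pairing f g (tensor_map u v t) = pairing (fun x => f (u x)) (fun x => g (v x)) t.
Proof.
move=> lf lg lu lv.
have lfu := scalar_compose lf lu; have lgv := scalar_compose lg lv.
move: t; apply: scalar_tensor_ext; first last.
- by move=> x y; rewrite tensor_mapE // !pairingE.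
- exact: pairing_linear.
exact: (scalar_compose (pairing_linear lf lg) (tensor_map_linear lu lv)).
Qed.

Lemma pairing_assoc U V W (f : U -> K) (g : V -> K) (h : W -> K) t :
  scalar f -> scalar g -> scalar h ->
  pairing f (pairing g h) (tensor_assoc t) = pairing (pairing f g) h t.
Proof.
move=> lf lg lh; have lgh := pairing_linear lg lh; have lfg := pairing_linear lf lg.
have l1 := pairing_linear lf lgh; have l2 := pairing_linear lfg lh.
move: t; apply: scalar_tensor_ext => //.
  exact: (scalar_compose l1 (@tensor_assoc_linear U V W)).
move=> t w; move: t; apply: scalar_tensor_ext.
- apply: (scalar_compose l1); apply: (linear_compose (@tensor_assoc_linear U V W)).
  exact: (tens_bilinear _ _).1.
- by apply: (scalar_compose l2); exact: (tens_bilinear _ _).1.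
by move=> u v; rewrite tensor_assocE !pairingE // mulrA.
Qed.

Lemma bilinear_scale_l V W (f : V -> K) : scalar f ->
  bilinear_map (fun (v : V) (w : W) => f v *: w).
Proof.
move=> lf; split=> [w a v v'|v a w w']; first by rewrite lf scalerDl scalerA.
by rewrite scalerDr !scalerA mulrC.
Qed.

Lemma bilinear_scale_r V W (f : W -> K) : scalar f ->
  bilinear_map (fun (v : V) (w : W) => f w *: v).
Proof.
move=> lf; split=> [w a v v'|v a w w']; last by rewrite lf scalerDl scalerA.
by rewrite scalerDr !scalerA mulrC.
Qed.

Lemma pairing_scale_l V W (f : V -> K) (g : W -> K) t : scalar f -> scalar g ->
  g (tensor_lift (fun v w => f v *: w) t) = pairing f g t.
Proof.
move=> lf lg; have bf := @bilinear_scale_l V W f lf; move: t; apply: scalar_tensor_ext.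
- exact: (scalar_compose lg (tensor_lift_linear bf)).
- exact: pairing_linear.
move=> v w; rewrite (tensor_lift_tens _ _ bf) pairingE //.
exact: (linear_Z (f v) w (scalar_linear lg)).
Qed.

Lemma pairing_scale_r V W (f : V -> K) (g : W -> K) t : scalar f -> scalar g ->
  f (tensor_lift (fun v w => g w *: v) t) = pairing f g t.
Proof.
move=> lf lg; have bf := @bilinear_scale_r V W g lg; move: t; apply: scalar_tensor_ext.
- exact: (scalar_compose lf (tensor_lift_linear bf)).
- exact: pairing_linear.
move=> v w; rewrite (tensor_lift_tens _ _ bf) pairingE // mulrC.
exact: (linear_Z (g w) v (scalar_linear lf)).
Qed.

End TensorOperations.

Section Functionals.
Variables (K : comNzRingType) (V : lmodType K) (f : V -> K).
Hypothesis lf : scalar f.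

Lemma scalar_D : {morph f : x y / x + y}.
Proof. exact: (linear_D (scalar_linear lf)). Qed.
Lemma scalar_Z a x : f (a *: x) = a * f x.
Proof. exact: (linear_Z _ _ (scalar_linear lf)). Qed.
Lemma scalar_B x y : f (x - y) = f x - f y.
Proof. exact: (linear_B _ _ (scalar_linear lf)). Qed.
Lemma scalar_sums I (r : seq I) (P : pred I) F :
  f (\sum_(i <- r | P i) F i) = \sum_(i <- r | P i) f (F i).
Proof. exact: (linear_sums _ _ _ (scalar_linear lf)). Qed.

End Functionals.

(** * Bases with their coordinate functionals *)

Section DualBasis.
Variable K : comNzRingType.

(** A basis in the algebraic sense: each expansion is finite, but the lengths of
    the expansions need not be bounded. *)
Record dual_basis (V : lmodType K) (I : eqType) (D : I -> V) (co : I -> V -> K) : Prop :=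
  DualBasis {
    coord_linear : forall i, scalar (co i);
    coord_dual : forall i j, co i (D j) = (i == j)%:R;
    coord_expansion : forall v, exists2 s : seq I, uniq s & v = \sum_(i <- s) co i v *: D i }.

Variables (V : lmodType K) (I : eqType) (D : I -> V) (co : I -> V -> K).
Hypothesis DB : dual_basis D co.

Lemma coord_inj v w : (forall i, co i v = co i w) -> v = w.
Proof.
move=> vw; pose u := v - w.
have u0 i : co i u = 0.
  by rewrite /u (linear_B _ _ (scalar_linear (coord_linear DB i))) vw subrr.
have [s _ E] := coord_expansion DB u.
apply/eqP; rewrite -subr_eq0 -/u E big1 // => i _.
by rewrite u0 scale0r.
Qed.

Lemma coord_sum (s : seq I) (c : I -> K) i : uniq s ->
  co i (\sum_(j <- s) c j *: D j) = if i \in s then c i else 0.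
Proof.
move=> us; have li := scalar_linear (coord_linear DB i).
rewrite (linear_sums _ _ _ li).
under eq_bigr => j _ do rewrite (linear_Z _ _ li) (coord_dual DB).
case: ifPn => [is_|iNs].
  rewrite (bigD1_seq i) //= eqxx [_ *: _]mulr1 big1 ?addr0 // => j ji.
  by rewrite eq_sym (negbTE ji) scaler0.
rewrite big_seq big1 // => j js; case: eqP => [E|_]; last exact: scaler0.
by rewrite E js in iNs.
Qed.

(** Enlarging the support of an expansion only adds zero terms, so finitely many
    vectors have a common support. *)
Lemma coord_expansion_seq (vs : seq V) : exists2 s : seq I, uniq s &
  forall v, v \in vs -> v = \sum_(i <- s) co i v *: D i.
Proof.
elim: vs => [|v vs [s us Hs]]; first by exists [::].
have [t ut Ht] := coord_expansion DB v.
exists (undup (s ++ t)); first exact: undup_uniq.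
have H w r : uniq r -> w = \sum_(i <- r) co i w *: D i -> {subset r <= s ++ t} ->
    w = \sum_(i <- undup (s ++ t)) co i w *: D i.
  move=> ur E sr; apply: coord_inj => i; rewrite coord_sum ?undup_uniq // mem_undup.
  case: ifPn => // iN; rewrite E coord_sum //; case: ifPn => // /sr.
  by rewrite (negbTE iN).
move=> w; rewrite inE => /predU1P[->|wvs].
  by apply: H ut Ht _ => i it; rewrite mem_cat it orbT.
by apply: H us (Hs w wvs) _ => i is_; rewrite mem_cat is_.
Qed.

End DualBasis.

Section DualBasisTensor.
Variables (K : comNzRingType) (V W : lmodType K) (I J : eqType).
Variables (D : I -> V) (co : I -> V -> K) (E : J -> W) (cp : J -> W -> K).
Hypotheses (DB : dual_basis D co) (EB : dual_basis E cp).

(** Expand both factors of each pure tensor occurring in t over supports that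
    are common to all of them. *)
Lemma dual_basis_tensor :
  dual_basis (fun p : I * J => D p.1 \ox E p.2) (fun p => pairing (co p.1) (cp p.2)).
Proof.
have lD := coord_linear DB; have lE := coord_linear EB.
split=> [p|[i j] [i' j']|t]; first exact: pairing_linear.
  rewrite /= pairingE // (coord_dual DB) (coord_dual EB) -natrM mulnb.
  by rewrite xpair_eqE.
have [s us Hs] := coord_expansion_seq DB (unzip1 (repr t)).
have [r ur Hr] := coord_expansion_seq EB (unzip2 (repr t)).
exists [seq (i, j) | i <- s, j <- r].
  by apply: allpairs_uniq => // -[? ?] [? ?].
rewrite big_allpairs /=.
have -> : \sum_(i <- s) \sum_(j <- r) pairing (co i) (cp j) t *: (D i \ox E j) =
  \sum_(p <- repr t) \sum_(i <- s) \sum_(j <- r) (co i p.1 * cp j p.2) *: (D i \ox E j).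
  rewrite [RHS]exchange_big /=; apply: eq_bigr => i _.
  rewrite [RHS]exchange_big /=; apply: eq_bigr => j _.
  by rewrite -scaler_suml.
rewrite {1}(tensor_span t) [LHS]big_seq [RHS]big_seq; apply: eq_bigr => p pt.
rewrite {1}(Hs p.1) ?map_f // {1}(Hr p.2) ?map_f //.
rewrite tens_suml; apply: eq_bigr => i _; rewrite tens_sumr; apply: eq_bigr => j _.
by rewrite tensZl tensZr scalerA.
Qed.

(** The main tool for equalities of tensors: it turns them into equalities of
    numbers, where the coalgebra axioms become properties of the addition of
    multi-indices. *)
Lemma pairing_inj (t u : tensor V W) :
  (forall i j, pairing (co i) (cp j) t = pairing (co i) (cp j) u) -> t = u.
Proof. by move=> tu; apply: (coord_inj dual_basis_tensor) => -[i j]; exact: tu. Qed.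

End DualBasisTensor.

(** * Coalgebras with a basis of divided powers *)

Section DividedPowers.
Variables (K : numFieldType) (m : nat) (C : coalgebra K).
Variables (D : multi_index m -> C) (co : multi_index m -> C -> K).

(** The third field is dual to X^a X^b = X^(a+b): it says that the
    comultiplication of D_c is the sum of the D_a (x) D_b over a + b = c. *)
Record divided_power_basis : Prop := DividedPowerBasis {
  dp_basis : dual_basis D co;
  dp_comul_linear : linear (@comul _ C);
  dp_comul : forall a b x, pairing (co a) (co b) (comul x) = co (a + b) x;
  dp_counit : forall x, counit x = co 0 x;
  dp_coaug : coaug C = D 0 }.

Hypothesis DP : divided_power_basis.
Let DB := dp_basis DP.
Let lco a : scalar (co a) := coord_linear DB a.
Let lcomul := dp_comul_linear DP.

Let counit_scalar : scalar (@counit _ C).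
Proof. by move=> a x y; rewrite !(dp_counit DP) lco. Qed.

Lemma multi_index_add_eq0 (a b : multi_index m) : (a + b == 0) = (a == 0) && (b == 0).
Proof. by rewrite -!ideg_eq0 idegD addn_eq0. Qed.

(** On coordinates, coassociativity is the associativity of the addition of
    multi-indices, and the counit laws are its unit laws. *)
Lemma divided_power_C3 : is_C3 C.
Proof.
have l1 a b := pairing_linear (lco a) (lco b).
split.
- exact: lcomul.
- exact: counit_scalar.
- move=> x; apply: (pairing_inj DB (dual_basis_tensor DB DB)) => a [b c] /=.
  rewrite pairing_assoc // pairing_map // pairing_map //.
  rewrite (_ : (fun y => pairing (co a) (co b) (comul y)) = co (a + b)); last first.
    by apply/funext => y; exact: dp_comul.
  rewrite (_ : (fun y => pairing (co b) (co c) (comul y)) = co (b + c)); last first.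
    by apply/funext => y; exact: dp_comul.
  by rewrite !(dp_comul DP) addrA.
- move=> x; apply: (coord_inj DB) => a; rewrite pairing_scale_l //.
  rewrite (_ : @counit _ C = co 0); last by apply/funext => y; exact: dp_counit.
  by rewrite (dp_comul DP) add0r.
- move=> x; apply: (coord_inj DB) => a; rewrite pairing_scale_r //.
  rewrite (_ : @counit _ C = co 0); last by apply/funext => y; exact: dp_counit.
  by rewrite (dp_comul DP) addr0.
- apply: (pairing_inj DB DB) => a b; rewrite (dp_comul DP) pairingE // (dp_coaug DP).
  by rewrite !(coord_dual DB) multi_index_add_eq0 -natrM mulnb.
- by rewrite (dp_counit DP) (dp_coaug DP) (coord_dual DB) eqxx.
Qed.

Lemma divided_power_cocommutative : cocommutative C.
Proof.
move=> x; apply: (pairing_inj DB DB) => a b.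
by rewrite pairing_swap // !(dp_comul DP) addrC.
Qed.

(** The (a, b) coordinate vanishes as soon as a and b are both nonzero, so that
    subtracting this term from the comultiplication of x only affects the terms in
    which an index is 0. *)
Lemma coord_primitive_part x a b :
  pairing (co a) (co b) (x \ox coaug C + coaug C \ox x) =
  (b == 0)%:R * co a x + (a == 0)%:R * co b x.
Proof.
have l1 := pairing_linear (lco a) (lco b).
rewrite (scalar_D l1) !pairingE // (dp_coaug DP) !(coord_dual DB).
by rewrite [co a x * _]mulrC.
Qed.

(** By induction: in the reduced comultiplication of x only the terms D_a (x)
    D_b with a and b nonzero survive, apart from one multiple of D_0 (x) D_0,
    and a + b of degree at most k + 1 then forces both degrees to be at most k.
    *)
Lemma order_le_filtration k x : (forall a, (k < ideg a)%N -> co a x = 0) ->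
  coalg_filtration k x.
Proof.
elim: k x => [|k IHk] x xk /=.
  exists (co 0 x); apply: (coord_inj DB) => a.
  rewrite (scalar_Z (lco a)) (dp_coaug DP) (coord_dual DB).
  have [->|] := eqVneq a 0; first by rewrite mulr1.
  by rewrite -ideg_eq0 -lt0n => /xk ->; rewrite mulr0.
have [S uS ES] := coord_expansion (dual_basis_tensor DB DB) (comul x).
pose P (p : multi_index m * multi_index m) :=
  [&& p.1 != 0, p.2 != 0 & co (p.1 + p.2) x != 0].
(* The coordinate of the reduced comultiplication at (0, 0) is x_0 - 2 x_0. *)
exists ((- co 0 x *: D 0, D 0) ::
  [seq (co (p.1 + p.2) x *: D p.1, D p.2) | p <- S & P p]).
  have coD c a : (ideg a <= k)%N -> coalg_filtration k (c *: D a).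
    move=> ak; apply: IHk => b bk; rewrite (scalar_Z (lco b)).
    rewrite (coord_dual DB); case: eqP => [E|_]; last by rewrite mulr0.
    by move: bk; rewrite E ltnNge ak.
  have coD1 a : (ideg a <= k)%N -> coalg_filtration k (D a).
    by rewrite -[D a]scale1r; exact: coD.
  have HP (a b : multi_index m) : P (a, b) ->
      coalg_filtration k (co (a + b) x *: D a) /\ coalg_filtration k (D b).
    rewrite /P /= => /and3P[a0 b0 ab0].
    have abk : (ideg (a + b)%R <= k.+1)%N.
      by rewrite leqNgt; apply: contra ab0 => /xk ->.
    move: a0 b0; rewrite -!ideg_eq0 -!lt0n => a0 b0; rewrite idegD in abk.
    split; [apply: coD|apply: coD1]; rewrite -ltnS; apply: leq_trans abk.
      by rewrite -addn1 leq_add2l.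
    by rewrite -add1n leq_add2r.
  move=> p; rewrite inE => /predU1P[->/=|].
    by split; [apply: coD|apply: coD1]; rewrite ideg0.
  by case/mapP => -[a b]; rewrite mem_filter => /andP[Pab _] ->; exact: HP.
apply: (pairing_inj DB DB) => a b.
have l1 := pairing_linear (lco a) (lco b).
rewrite -addrA -opprD (scalar_B l1) coord_primitive_part (dp_comul DP).
rewrite big_cons big_map big_filter (scalar_D l1) pairingE //.
rewrite (scalar_Z (lco a)) !(coord_dual DB).
rewrite (scalar_sums l1) /=.
transitivity (- co 0 x * (a == 0)%:R * (b == 0)%:R +
   (if P (a, b) && ((a, b) \in S) then co (a + b) x else 0)); last first.
  congr (_ + _).
  have E p : pairing (co a) (co b) ((co (p.1 + p.2) x *: D p.1) \ox D p.2) =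
      if p == (a, b) then co (a + b) x else 0.
    rewrite pairingE // (scalar_Z (lco a)) !(coord_dual DB).
    case: p => a' b' /=; rewrite xpair_eqE ![_ == a]eq_sym ![_ == b]eq_sym.
    have [<-|_] := eqVneq a a'; last by rewrite mulr0 mul0r.
    have [<-|_] := eqVneq b b'; last by rewrite mulr0.
    by rewrite !mulr1.
  under eq_bigr => p _ do rewrite E.
  have [abS|abS] := boolP ((a, b) \in S).
    rewrite -big_filter; case: (boolP (P (a, b))) => Pab /=.
      rewrite (bigD1_seq (a, b)) ?filter_uniq ?mem_filter ?Pab //= eqxx big1 ?addr0 //.
      by move=> p /negbTE ->.
    rewrite big_seq big1 // => p; rewrite mem_filter => /andP[Pp _].
    by case: eqP => // Ep; rewrite Ep (negbTE Pab) in Pp.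
  rewrite andbF big_seq_cond big1 // => p /andP[pS _].
  by case: eqP => // Ep; rewrite Ep (negbTE abS) in pS.
have abS0 : (a, b) \notin S -> co (a + b) x = 0.
  move=> abS; rewrite -(dp_comul DP) ES.
  by have /= -> := coord_sum (dual_basis_tensor DB DB)
    (fun p => pairing (co p.1) (co p.2) (comul x)) (a, b) uS; rewrite (negbTE abS).
rewrite /P /=; have [->|a0] := eqVneq a 0; have [->|b0] := eqVneq b 0; rewrite /= ?add0r ?addr0.
- by rewrite !mul1r !mulr1 opprD addrA subrr add0r.
- by rewrite mul0r mul1r add0r subrr mulr0.
- by rewrite mul0r mul1r addr0 subrr mulr0 mul0r.
rewrite !mul0r addr0 subr0 mulr0 add0r.
case: (boolP ((a, b) \in S)) => abS; last by rewrite andbF abS0.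
by rewrite andbT; case: ifPn => //; rewrite negbK => /eqP.
Qed.

Lemma divided_power_connected : coalg_connected C.
Proof.
move=> x; have [s us Es] := coord_expansion DB x.
exists (\sum_(a <- s) ideg a)%N; apply: order_le_filtration => a.
rewrite Es coord_sum //; case: ifPn => // as_.
by rewrite (big_rem a) //= ltnNge leq_addr.
Qed.

Theorem divided_power_C5 : is_C5 C.
Proof.
split; [exact: divided_power_C3|exact: divided_power_connected|].
exact: divided_power_cocommutative.
Qed.

(** If x is primitive, its coordinates vanish at each sum of two nonzero indices
    and at 0 = 0 + 0; the other indices have degree one. *)
Lemma divided_power_primitive x :
  primitive_elements x <-> forall a, ideg a != 1%N -> co a x = 0.
Proof.
split=> [px a a1|x0]; last first.
  rewrite /primitive_elements /=; apply: (pairing_inj DB DB) => a b.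
  rewrite (dp_comul DP) coord_primitive_part.
  have [->|a0] := eqVneq a 0; have [->|b0] := eqVneq b 0; rewrite /= ?add0r ?addr0 ?mul0r ?mul1r.
  - by rewrite x0 ?ideg0 // addr0.
  - by rewrite add0r.
  - by rewrite addr0.
  rewrite addr0 x0 // idegD; move: a0 b0; rewrite -!ideg_eq0.
  by case: (ideg a) => // i _; case: (ideg b) => // j _; rewrite addnS.
have H a' b : co (a' + b) x = (b == 0)%:R * co a' x + (a' == 0)%:R * co b x.
  by rewrite -coord_primitive_part -(dp_comul DP) px.
have [->|a0] := eqVneq a 0.
  have := H 0 0; rewrite eqxx addr0 mul1r => /(congr1 (fun z => z - co 0 x)).
  by rewrite subrr addrK.
have [i ai] : exists i, (0 < a i)%N.
  apply/existsP; apply: contraT; rewrite negb_exists => /forallP a0'.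
  move: a0; rewrite -ideg_eq0 /ideg big1 // => i _.
  by apply/eqP; rewrite -leqn0 leqNgt; exact: a0'.
(* a = (a - e_i) + e_i, where a - e_i is nonzero since a does not have degree 1. *)
rewrite -(ipredK ai) H -!ideg_eq0 ideg_unit /= mul0r add0r.
case: eqP => [p0|_]; last by rewrite mul0r.
by move: a1; rewrite -(ipredK ai) idegD p0 ideg_unit.
Qed.

End DividedPowers.

(** * The symmetric coalgebra *)

Section TensorAlgebra.
Variables (K : comNzRingType) (A B : algType K).

Let bil (t : tensor A B) : bilinear_map (fun (a : A) (b : B) =>
  tensor_lift (fun c d => (a * c) \ox (b * d)) t).
Proof.
have lA (a : A) : linear ( *%R a) by move=> c x y; rewrite mulrDr scalerAr.
have lB (b : B) : linear ( *%R b) by move=> c x y; rewrite mulrDr scalerAr.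
split=> [b|a].
  apply: (fun H1 H2 => (tensor_lift_bilinear_r
    (b := fun a c d => (a * c) \ox (b * d)) H1 H2).1 t).
    by move=> a; exact: bilinear_tens.
  by move=> c d z a a'; rewrite mulrDl -scalerAl tensDl tensZl.
apply: (fun H1 H2 => (tensor_lift_bilinear_r
    (b := fun b c d => (a * c) \ox (b * d)) H1 H2).1 t).
  by move=> b; exact: bilinear_tens.
by move=> c d z b b'; rewrite mulrDl -scalerAl tensDr tensZr.
Qed.

(** The product of the algebra A (x) B, in which the comultiplication of a monomial
    is computed. *)
Lemma tensor_mulE (a c : A) (b d : B) :
  tensor_mul (a \ox b) (c \ox d) = (a * c) \ox (b * d).
Proof.
rewrite /tensor_mul (tensor_lift_tens _ _ (bil _)).
apply: tensor_lift_tens; apply: (@bilinear_tens K A A B B) => z x y;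
by rewrite mulrDr scalerAr.
Qed.

Lemma tensor_mul_linear_l (t : tensor A B) : linear (fun s => tensor_mul s t).
Proof. exact: (tensor_lift_linear (bil t)). Qed.

Lemma tensor_mul_linear_r (s : tensor A B) : linear (tensor_mul s).
Proof.
move=> z t u; rewrite [LHS](_ : _ = (fun s => tensor_mul s (z *: t + u)) s) //.
rewrite [RHS](_ : _ = (fun s => z *: tensor_mul s t + tensor_mul s u) s) //.
move: s; apply: linear_tensor_ext.
- exact: tensor_mul_linear_l.
- move=> w x y; rewrite !tensor_mul_linear_l !scalerDr !scalerA [z * w]mulrC.
  by rewrite addrACA.
move=> a b /=.
have lA (c : A) : linear ( *%R c) by move=> w x y; rewrite mulrDr scalerAr.
have lB (d : B) : linear ( *%R d) by move=> w x y; rewrite mulrDr scalerAr.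
rewrite /tensor_mul !(tensor_lift_tens _ _ (bil _)).
exact: (tensor_lift_linear (bilinear_tens (lA a) (lB b))).
Qed.

Lemma tensor_mulA (s t u : tensor A B) :
  tensor_mul (tensor_mul s t) u = tensor_mul s (tensor_mul t u).
Proof.
have L := tensor_mul_linear_l; have Rr := tensor_mul_linear_r.
move: s; apply: (linear_tensor_ext (linear_compose (L u) (L t)) (L _)) => a b.
move: t; apply: (linear_tensor_ext (linear_compose (L u) (Rr _))
  (linear_compose (Rr (a \ox b)) (L u))) => c d.
move: u; apply: (linear_tensor_ext (Rr _) (linear_compose (Rr (a \ox b)) (Rr (c \ox d)))).
by move=> e f; rewrite !tensor_mulE !mulrA.
Qed.

Lemma tensor_mul1 (t : tensor A B) : tensor_mul (1 \ox 1) t = t.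
Proof.
move: t; apply: (linear_tensor_ext (tensor_mul_linear_r _) (@linear_id _ _)).
by move=> a b; rewrite tensor_mulE !mul1r.
Qed.

Lemma tensor_mul_iter n (u t : tensor A B) :
  tensor_mul (iter n (tensor_mul u) (1 \ox 1)) t = iter n (tensor_mul u) t.
Proof. by elim: n => [|n IHn] /=; rewrite ?tensor_mul1 // tensor_mulA IHn. Qed.

End TensorAlgebra.

Module SymmetricCoalgebraIso.
Import mpoly.

Section Iso.
Variables (K : numFieldType) (m : nat).
Local Notation S := (sym_alg K m).

Definition mnm_of (a : multi_index m) : 'X_{1..m} := [multinom a i | i < m].
Definition multi_of (a : 'X_{1..m}) : multi_index m := [ffun i => a i].

Lemma mnm_ofK : cancel mnm_of multi_of.
Proof. by move=> a; apply/ffunP => i; rewrite ffunE mnmE. Qed.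

Lemma multi_ofK : cancel multi_of mnm_of.
Proof. by move=> a; apply/mnmP => i; rewrite mnmE ffunE. Qed.

Lemma mnm_of_unit a i : mnm_of (a + iunit i) = (U_(i) + mnm_of a)%MM.
Proof.
by apply/mnmP => j; rewrite mnmDE !mnmE !ffunE addnC [i == j]eq_sym.
Qed.

(** The value at 0 of the iterated derivative of p of exponent a, that is, the
    coordinate functional dual to (1/a!) X^a. *)
Definition sym_coord (a : multi_index m) (p : S) : K :=
  mcoeff (mnm_of a) (p : {mpoly K[m]}) * (ifact a)%:R.

Lemma sym_coord_linear a : scalar (sym_coord a).
Proof. by move=> c p q; rewrite /sym_coord mcoeffD mcoeffZ mulrDl mulrA. Qed.

Lemma sym_coordX a b : sym_coord a ('X_[mnm_of b] : {mpoly K[m]}) = (a == b)%:R * (ifact a)%:R.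
Proof. by rewrite /sym_coord mcoeffX (can_eq mnm_ofK) eq_sym. Qed.

Lemma sym_ext (f g : S -> K) : scalar f -> scalar g ->
  (forall a, f ('X_[mnm_of a] : {mpoly K[m]}) = g ('X_[mnm_of a] : {mpoly K[m]})) -> f =1 g.
Proof.
move=> lf lg fg p; rewrite [p](@mpolyE m K p) (scalar_sums lf) (scalar_sums lg).
apply: eq_bigr => a _; rewrite (scalar_Z lf) (scalar_Z lg) -(multi_ofK a).
by rewrite fg.
Qed.

(** Leibniz rule at 0 for a product with a variable. It is what makes the
    divided powers appear. *)
Lemma sym_coord_gen a i (p : S) :
  sym_coord a (sym_gen K i * p) = (a i)%:R * sym_coord (ipred i a) p.
Proof.
move: p; apply: sym_ext.
- move=> c p q; rewrite mulrDr -scalerAr; exact: sym_coord_linear.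
- by move=> c p q; rewrite sym_coord_linear mulrDr mulrCA.
move=> b; rewrite (_ : _ * _ = ('X_[mnm_of (b + iunit i)] : {mpoly K[m]})); last first.
  by rewrite mnm_of_unit mpolyXD.
rewrite !sym_coordX; have [ai0|ai] := posnP (a i).
  rewrite ai0 mul0r; case: eqP => [/ffunP/(_ i)|_]; last by rewrite mul0r.
  by rewrite ai0 !ffunE eqxx /= [RHS]addn1.
rewrite -{1}(ipredK ai) (inj_eq (@multi_addI _ _)) (ifact_ipred ai) natrM.
by rewrite mulrCA.
Qed.

Lemma sym_coord1 a : sym_coord a 1 = (a == 0)%:R.
Proof.
rewrite (_ : 1 = ('X_[mnm_of 0] : {mpoly K[m]})); last first.
  by rewrite (_ : mnm_of 0 = 0%MM) ?mpolyX0 //; apply/mnmP => i; rewrite mnmE ffunE mnm0E.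
by rewrite sym_coordX; case: eqP => [->|_]; rewrite ?mul0r // ifact0 mulr1.
Qed.

(** The coordinates that the comultiplication of X^c must have; being satisfied
    by the unit and stable under multiplication by a primitive generator, they
    determine it by induction on c. *)
Definition comul_monomial (c : multi_index m) (t : tensor S S) :=
  forall a b, pairing (sym_coord a) (sym_coord b) t =
              (a + b == c)%:R * (ifact c)%:R.

Lemma comul_monomial_unit : comul_monomial 0 (sym_unit K m).
Proof.
move=> a b; rewrite pairingE; do ?exact: sym_coord_linear.
by rewrite !sym_coord1 multi_index_add_eq0 ifact0 mulr1 -natrM mulnb.
Qed.

(** Leibniz rule in both factors: the two terms contribute a_i and b_i, whose
    sum is the exponent of the new variable when a + b = c + e_i. *)
Lemma comul_monomial_gen c i t : comul_monomial c t ->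
  comul_monomial (c + iunit i)
    (tensor_mul (sym_gen K i \ox 1 + 1 \ox sym_gen K i) t).
Proof.
move=> ct a b; have lp a' b' := pairing_linear (sym_coord_linear a') (sym_coord_linear b').
have -> : pairing (sym_coord a) (sym_coord b)
    (tensor_mul (sym_gen K i \ox 1 + 1 \ox sym_gen K i) t) =
  (a i)%:R * pairing (sym_coord (ipred i a)) (sym_coord b) t +
  (b i)%:R * pairing (sym_coord a) (sym_coord (ipred i b)) t.
  move: t {ct}; apply: scalar_tensor_ext.
  - exact: (scalar_compose (lp a b) (tensor_mul_linear_r _)).
  - move=> z x y; rewrite !lp !mulrDr [in LHS]mulrCA [X in _ + (X + _)]mulrCA.
    by rewrite addrACA.
  move=> p q; rewrite (linear_D (tensor_mul_linear_l _)) !tensor_mulE !mul1r.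
  rewrite (scalar_D (lp a b)) !pairingE; do ?exact: sym_coord_linear.
  by rewrite !sym_coord_gen mulrA [X in _ + X]mulrCA.
rewrite !ct.
have E (x y : multi_index m) : (0 < x i)%N ->
    (ipred i x + y == c) = (x + y == c + iunit i).
  move=> xi; rewrite -[in RHS](ipredK xi) addrAC; apply/esym.
  exact: (inj_eq (@multi_addI _ _)).
have Ea : (a i)%:R * ((ipred i a + b == c)%:R * (ifact c)%:R) =
    (a i)%:R * ((a + b == c + iunit i)%:R * (ifact c)%:R) :> K.
  by have [->|ai] := posnP (a i); [rewrite !mul0r|rewrite E].
have Eb : (b i)%:R * ((a + ipred i b == c)%:R * (ifact c)%:R) =
    (b i)%:R * ((a + b == c + iunit i)%:R * (ifact c)%:R) :> K.
  by have [->|bi] := posnP (b i); [rewrite !mul0r|rewrite addrC E // addrC].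
rewrite Ea Eb -mulrDl -natrD.
case: eqP => [abc|_]; last by rewrite !mul0r mulr0.
rewrite !mul1r -natrM; congr (_%:R).
have /ffunP/(_ i) := abc; rewrite !ffunE eqxx => abi.
have -> : (a i + b i)%N = (c i).+1 by rewrite -addn1; exact: abi.
rewrite [RHS](@ifact_ipred _ i) ?ffunE ?eqxx; last by rewrite [X in (0 < X)%N]addn1.
rewrite [X in (_ = X * _)%N]addn1; congr (_ * ifact _)%N.
by apply/ffunP => j; rewrite !ffunE; exact: (esym (addnK _ _)).
Qed.

Lemma comul_monomial_iter c i n t : comul_monomial c t ->
  comul_monomial (c + iunit i *+ n)
    (iter n (tensor_mul (sym_gen K i \ox 1 + 1 \ox sym_gen K i)) t).
Proof.
move=> ct; elim: n => [|n IHn] /=; first by rewrite mulr0n addr0.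
by rewrite mulrSr addrA; exact: comul_monomial_gen.
Qed.

Lemma comul_monomial_prod (c : multi_index m) :
  comul_monomial c (\big[(@tensor_mul K S S)/sym_unit K m]_(i < m)
      iter (c i) (tensor_mul (sym_gen K i \ox 1 + 1 \ox sym_gen K i)) (sym_unit K m)).
Proof.
have E : c = \sum_(i <- index_enum 'I_m) iunit i *+ c i.
  apply/ffunP => j; rewrite sum_ffunE.
  rewrite (bigD1_seq j) ?mem_index_enum ?index_enum_uniq //= big1 => [|i ij].
    by rewrite ffunMnE ffunE eqxx addr0 /=; elim: (c j) => // n IHn; rewrite mulrS -IHn.
  by rewrite ffunMnE ffunE eq_sym (negbTE ij) mul0rn.
rewrite {1}E; elim: (index_enum 'I_m) => [|i r IHr].
  by rewrite !big_nil; exact: comul_monomial_unit.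
rewrite !big_cons [X in comul_monomial _ X]tensor_mul_iter addrC.
exact: comul_monomial_iter.
Qed.

(** The symmetric coalgebra has a basis of divided powers. *)
Lemma sym_comul_pairing a b (p : S) :
  pairing (sym_coord a) (sym_coord b) (sym_comul p) = sym_coord (a + b) p.
Proof.
have lp := pairing_linear (sym_coord_linear a) (sym_coord_linear b).
rewrite /sym_comul (scalar_sums lp).
rewrite [in RHS](@mpolyE m K p) (scalar_sums (sym_coord_linear _)).
apply: eq_bigr => c _; rewrite (scalar_Z lp) (scalar_Z (sym_coord_linear _)).
congr (_ * _); rewrite -[in RHS](multi_ofK c) sym_coordX.
rewrite (eq_bigr (fun i => iter (multi_of c i)
  (tensor_mul (sym_gen K i \ox 1 + 1 \ox sym_gen K i)) (sym_unit K m))); last first.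
  by move=> i _; rewrite ffunE.
rewrite comul_monomial_prod; case: eqP => [<-//|_]; by rewrite !mul0r.
Qed.

Variables (C : coalgebra K) (D : multi_index m -> C) (co : multi_index m -> C -> K).
Hypothesis DP : divided_power_basis D co.

(** The linear map sending (1/a!) X^a to D_a; both are bases of divided powers.
    *)
Definition sym_to (p : S) : C :=
  \sum_(a <- msupp (p : {mpoly K[m]})) sym_coord (multi_of a) p *: D (multi_of a).

Lemma coord_sym_to a p : co a (sym_to p) = sym_coord a p.
Proof.
rewrite /sym_to -(big_map multi_of xpredT (fun a => sym_coord a p *: D a)).
rewrite (coord_sum (dp_basis DP)); last first.
  by rewrite map_inj_uniq ?msupp_uniq //; exact: can_inj multi_ofK.
case: ifPn => // aN; rewrite /sym_coord memN_msupp_eq0 ?mul0r //.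
by apply: contra aN => aS; rewrite -(mnm_ofK a) map_f.
Qed.

Lemma sym_to_linear : linear sym_to.
Proof.
move=> c p q; apply: (coord_inj (dp_basis DP)) => a.
by rewrite (coord_linear (dp_basis DP)) !coord_sym_to sym_coord_linear.
Qed.

Lemma factr_neq0 (a : multi_index m) : (ifact a)%:R != 0 :> K.
Proof. by rewrite pnatr_eq0 -lt0n ifact_gt0. Qed.

Lemma sym_coord_inj (p q : S) : (forall a, sym_coord a p = sym_coord a q) -> p = q.
Proof.
move=> pq; apply/(@mpolyP m K p q) => a.
by have /(mulIf (factr_neq0 _)) := pq (multi_of a); rewrite multi_ofK.
Qed.

(** A linear bijection that identifies the coordinates is a morphism because
    comultiplication, counit and coaugmentation are determined by the
    coordinates in the same way on both sides. Dividing by a! requires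
    characteristic 0. *)
Theorem sym_coalg_iso : @coalg_iso K (sym_coalg K m) C sym_to.
Proof.
have lco := coord_linear (dp_basis DP).
split; first split.
- exact: sym_to_linear.
- move=> p; apply: (pairing_inj (dp_basis DP) (dp_basis DP)) => a b.
  rewrite pairing_map //; do ?exact: sym_to_linear.
  rewrite (dp_comul DP) coord_sym_to -sym_comul_pairing.
  by congr pairing; apply/funext => q; exact: coord_sym_to.
- move=> p; rewrite (dp_counit DP) coord_sym_to /sym_coord ifact0 mulr1.
  by congr mcoeff; apply/mnmP => i; rewrite mnmE ffunE mnm0E.
- apply: (coord_inj (dp_basis DP)) => a.
  by rewrite coord_sym_to sym_coord1 (dp_coaug DP) (coord_dual (dp_basis DP)).
(* The inverse map is read off from the expansions, where 1 / a! compensates sym_coord. *)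
pose g (v : C) : S := let s := s2val (cid2 (coord_expansion (dp_basis DP) v)) in
  \sum_(a <- s) (co a v / (ifact a)%:R) *: ('X_[mnm_of a] : {mpoly K[m]}).
have gE a v : sym_coord a (g v) = co a v.
  rewrite /g; case: cid2 => s /= us E; rewrite (scalar_sums (sym_coord_linear a)).
  rewrite [in RHS]E (scalar_sums (lco a)); apply: eq_bigr => b _.
  rewrite (scalar_Z (sym_coord_linear a)) (scalar_Z (lco a)) sym_coordX.
  rewrite (coord_dual (dp_basis DP)); case: eqP => [->|_]; last by rewrite mul0r !mulr0.
  by rewrite mul1r mulr1 divfK // factr_neq0.
exists g => x.
  by apply: sym_coord_inj => a; rewrite gE coord_sym_to.
by apply: (coord_inj (dp_basis DP)) => a; rewrite coord_sym_to gE.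
Qed.

End Iso.
End SymmetricCoalgebraIso.

From mathcomp Require Import all_classical all_reals all_analysis.
From mathcomp Require Import ring lra zify.
Import numFieldNormedType.Exports.
Local Open Scope classical_set_scope.

(** * Differentiability of functions with continuous partial derivatives *)

(** Turns a plain linear function into a structured one, as required by the
    differential. *)
Lemma linear_bundle (K : nzRingType) (V W : lmodType K) (f : V -> W) :
  linear f -> exists L : {linear V -> W}, L = f :> (V -> W).
Proof.
move=> lf; pose L : {linear V -> W} := HB.pack f (GRing.isLinear.Build _ _ _ _ f lf).
by exists L.
Qed.

Section Differentiability.
Variable R : realType.

Notation "''e_' i" := (delta_mx 0 i) (at level 8, i at level 2, format "''e_' i").

Lemma path_derive (V : normedModType R) (f : V -> R) (x w : V) (s : R) :
  derivable f (x + s *: w) w ->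
  is_derive s 1 (fun t => f (x + t *: w)) ('D_w f (x + s *: w)).
Proof.
have E : (fun h : R => h^-1 *: (((fun t => f (x + t *: w)) \o shift s) (h *: 1) -
    f (x + s *: w))) =
  (fun h : R => h^-1 *: ((f \o shift (x + s *: w)) (h *: w) - f (x + s *: w))).
  apply/funext => h /=; congr (_ *: (f _ - _)).
  by rewrite [h *: 1]mulr1 scalerDl addrCA.
move=> df; split; last by rewrite /derive E.
by rewrite /derivable E.
Qed.

Lemma MVT_segment_dir (V : normedModType R) (f : V -> R) (x w : V) :
  (forall s : R, 0 <= s <= 1 -> derivable f (x + s *: w) w) ->
  exists2 s : R, 0 <= s <= 1 & f (x + w) - f x = 'D_w f (x + s *: w).
Proof.
move=> df; pose g t := f (x + t *: w).
have dg (s : R) : 0 <= s <= 1 -> is_derive s 1 g ('D_w f (x + s *: w)).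
  by move=> /df /path_derive.
have [||s] := @MVT_segment R g (fun s => 'D_w f (x + s *: w)) 0 1 ler01.
- by move=> s; rewrite in_itv /= => /andP[s0 s1]; apply: dg; rewrite !ltW.
- apply: derivable_within_continuous => s; rewrite in_itv /= => /dg ds.
  exact: ex_derive.
rewrite in_itv /= /g scale1r scale0r addr0 subr0 mulr1 => s01 E.
by exists s.
Qed.

Lemma derive_scale (V : normedModType R) (f : V -> R) (x v : V) (t : R) :
  derivable f x v ->
  derivable f x (t *: v) /\ 'D_(t *: v) f x = t * 'D_v f x.
Proof.
move=> dv; have dv0 : derivable f (x + 0 *: v) v by rewrite scale0r addr0.
have d1 := path_derive dv0.
have E : (fun h : R => h^-1 *: (((fun u => f (x + (t * u) *: v)) \o shift 0) (h *: 1) -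
    f (x + (t * 0) *: v))) =
  (fun h : R => h^-1 *: ((f \o shift x) (h *: (t *: v)) - f x)).
  apply/funext => h /=; rewrite mulr0 scale0r !addr0 [h *: 1]mulr1.
  by rewrite scalerA [h * t]mulrC [x + _]addrC.
have dg : is_derive (0 : R) 1 (fun u => f (x + (t * u) *: v)) (t * 'D_v f x).
  have dt : is_derive (0 : R) 1 (fun u : R => t * u) t.
    by rewrite -[X in is_derive _ _ _ X]mulr1; exact: is_deriveZ.
  have d1' : is_derive (t * 0) 1 (fun u => f (x + u *: v)) ('D_v f x).
    by move: d1; rewrite mulr0 scale0r addr0.
  by have := is_derive1_comp (f := fun u => f (x + u *: v)) d1' dt;
     rewrite mulrC.
split; first by have [] := dg; rewrite /derivable E.
by have [_ <-] := dg; rewrite /derive E.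
Qed.

Lemma row_mx_norm_le m (h : 'rV[R]_m) (c : R) :
  0 <= c -> (forall i, `|h 0 i| <= c) -> `|h| <= c.
Proof.
move=> c0 hc; rewrite [leLHS]/Num.Def.normr /= mx_normrE.
by apply: bigmax_le => // -[i j] _ /=; rewrite ord1.
Qed.

Lemma coord_norm_le m (h : 'rV[R]_m) i : `|h 0 i| <= `|h|.
Proof.
rewrite [leRHS]/Num.Def.normr /= mx_normrE.
exact: (le_bigmax _ (fun ij : 'I_1 * 'I_m => `|h ij.1 ij.2|) (0, i)).
Qed.

Lemma differentiable_estimate (V W : normedModType R) (f : V -> W)
    (L : {linear V -> W}) (x : V) : continuous L ->
  (forall e : R, 0 < e ->
     \forall h \near 0, `|f (h + x) - (f x + L h)| <= e * `|h|) ->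
  differentiable f x.
Proof.
move=> cL fL; apply/diff_locallyP.
suff E : f \o shift x = cst (f x) + L +o_ 0 id.
  by have := diff_unique cL E => ->.
by apply/eqaddoP => e e0; exact: fL.
Qed.

(** The increment of f is split along a path parallel to the axes and the mean
    value theorem is applied to each piece. *)
Lemma derivable_C1_differentiable m (f : 'rV[R]_m -> R) (x : 'rV[R]_m) :
  (\forall y \near x, forall i, derivable f y 'e_i) ->
  (forall i, {for x, continuous ('D_('e_i) f)}) ->
  differentiable f x.
Proof.
move=> df cf.
pose L (h : 'rV[R]_m) : R := \sum_i h 0 i * 'D_('e_i) f x.
have Llin : linear L.
  move=> a u v; rewrite /L scaler_sumr -big_split; apply: eq_bigr => i _ /=.
  by rewrite !mxE mulrDl -mulrA.
have [Lf LfE] : exists Lf : {linear 'rV[R]_m -> R}, Lf = L :> (_ -> _).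
  exact: linear_bundle.
have cL : continuous Lf.
  rewrite LfE /L; apply: continuous_big => [|i _]; first exact: add_continuous.
  move=> u.
  exact: (cvgM (@coord_continuous R 1 m 0 i u) (cvg_cst _)).
apply: (differentiable_estimate cL) => _/posnumP[e].
(* Each of the m coordinate steps will contribute at most e' * |h|. *)
pose e' := e%:num / (m%:R + 1).
have e'0 : 0 < e' by rewrite divr_gt0 // ltr_wpDl.
have near_x : \forall y \near x, forall i, derivable f y 'e_i /\
    `|'D_('e_i) f x - 'D_('e_i) f y| <= e'.
  near=> y => i; split; first by move: i; near: y.
  by move: i; near: y; apply: filter_forall => i;
    exact: ((cvgrPdist_le _ _).1 (cf i)).
have [r /= r0 xr] := (nbhs_ballP _ _).1 near_x.
near=> h.
have hr : `|h| < r by near: h; exact: (@nbhs0_lt _ 'rV[R]_m).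
(* tr i keeps the first i coordinates of h. *)
pose tr (i : nat) : 'rV[R]_m := \row_j (if (j < i)%N then h 0 j else 0).
have trS (i : 'I_m) : tr i.+1 = tr i + h 0 i *: 'e_i.
  apply/rowP => j; rewrite !mxE ltnS leq_eqVlt eqxx /=.
  by case: (ltngtP j i) => [ji|ij|/val_inj ->];
    rewrite ?mulr0 ?addr0 // -?val_eqE /= ?(gtn_eqF ij) ?(ltn_eqF ji)
      ?mulr0 ?addr0 ?eqxx ?mulr1 ?add0r.
have trm : tr m = h by apply/rowP => j; rewrite !mxE ltn_ord.
have tr0 : tr 0%N = 0 by apply/rowP => j; rewrite !mxE.
have seg (i : 'I_m) (s : R) : 0 <= s <= 1 -> ball x r (x + tr i + s *: (h 0 i *: 'e_i)).
  move=> /andP[s0 s1]; rewrite -ball_normE /=.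
  rewrite opprD addrA opprD addNKr -opprD normrN.
  apply: le_lt_trans hr; apply: row_mx_norm_le => // j; rewrite !mxE eqxx /=.
  have [ji|ij] := ltnP j i.
    rewrite (_ : j == i = false) ?mulr0 ?addr0; first exact: coord_norm_le.
    by rewrite -val_eqE /= (ltn_eqF ji).
  rewrite add0r; have [_|_] := eqVneq j i; last by rewrite !mulr0 normr0.
  rewrite mulr1 normrM (ger0_norm s0).
  by rewrite (le_trans _ (coord_norm_le _ i)) // ler_piMl.
have step (i : 'I_m) : `|f (x + tr i.+1) - f (x + tr i) - h 0 i * 'D_('e_i) f x| <= e' * `|h|.
  have [s s01 E] : exists2 s : R, 0 <= s <= 1 &
      f (x + tr i + h 0 i *: 'e_i) - f (x + tr i) =
      'D_(h 0 i *: 'e_i) f (x + tr i + s *: (h 0 i *: 'e_i)).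
    apply: MVT_segment_dir => s s01.
    have [ds _] := xr _ (seg i s s01) i.
    by have [] := derive_scale (h 0 i) ds.
  have [ds Ds] := xr _ (seg i s s01) i.
  rewrite trS addrA E (derive_scale (h 0 i) ds).2 -mulrBr normrM mulrC.
  by rewrite ler_pM // ?coord_norm_le // distrC.
have -> : f (h + x) - (f x + Lf h) =
    \sum_(i < m) (f (x + tr i.+1) - f (x + tr i) - h 0 i * 'D_('e_i) f x).
  rewrite LfE sumrB -(big_mkord xpredT (fun i => f (x + tr i.+1) - f (x + tr i))).
  rewrite (telescope_sumr (fun i => f (x + tr i))) // trm tr0 addr0.
  by rewrite opprD addrA [h + x]addrC.
apply: le_trans (ler_norm_sum _ _ _) _.
apply: (@le_trans _ _ (\sum_(i < m) e' * `|h|)); first exact: ler_sum.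
rewrite sumr_const card_ord -mulr_natl mulrA ler_wpM2r //.
rewrite /e' mulrCA ler_piMr // ler_pdivrMr ?mul1r; last by rewrite ltr_wpDl.
by rewrite lerDl.
Unshelve. all: by end_near. Qed.

Lemma derive_coord m (f : 'rV[R]_m -> R) (x v : 'rV[R]_m) :
  differentiable f x -> 'd f x v = \sum_i v 0 i * 'D_('e_i) f x.
Proof.
move=> df; rewrite {1}[v]row_sum_delta linear_sum; apply: eq_bigr => i _.
by rewrite linearZ deriveE.
Qed.

Lemma row_differentiable m n (g : 'rV[R]_m -> 'rV[R]_n) x :
  (forall j, differentiable (fun y => g y 0 j) x) -> differentiable g x.
Proof.
move=> dg.
have -> : g = \sum_(j < n) (fun y => g y 0 j *: ('e_j : 'rV[R]_n)).
  apply/funext => y; rewrite fct_sumE; exact: row_sum_delta.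
by apply: differentiable_sum => j; exact: differentiableZl.
Qed.

Lemma diff_row m n (g : 'rV[R]_m -> 'rV[R]_n) x v j :
  differentiable g x -> ('d g x v) 0 j = 'd (fun y => g y 0 j) x v.
Proof.
move=> dg.
have dc : differentiable (fun M : 'rV[R]_n => M 0 j) (g x).
  exact: differentiable_coord.
have clin : linear (fun M : 'rV[R]_n => M 0 j : R) by move=> a u w; rewrite !mxE.
have [C CE] := linear_bundle clin.
have -> : 'd (fun y => g y 0 j) x = 'd C (g x) \o 'd g x :> (_ -> _).
  by rewrite CE; exact: (diff_comp dg dc).
have -> : 'd C (g x) = C :> (_ -> _).
  by apply: diff_lin; rewrite CE; exact: coord_continuous.
by rewrite /= CE.
Qed.

End Differentiability.

(** * Calculus of smooth functions *)

Section CkCalculus.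
Variable R : realType.

Notation "''e_' i" := (delta_mx 0 i) (at level 8, i at level 2, format "''e_' i").

Lemma Ck_W k m (U : set 'rV[R]_m) (f : 'rV[R]_m -> R) : Ck k.+1 U f -> Ck k U f.
Proof.
elim: k f => [|k IHk] f [cf Hf]; split=> // i.
by have [df Cf] := Hf i; split=> //; exact: IHk.
Qed.

Lemma Ck_sub k m (U V : set 'rV[R]_m) (f : 'rV[R]_m -> R) :
  V `<=` U -> Ck k U f -> Ck k V f.
Proof.
move=> VU; elim: k f => [|k IHk] f [cf Hf]; split=> //; do ?by move=> x /VU /cf.
move=> i; have [df Cf] := Hf i; split; first by move=> x /VU /df.
exact: IHk.
Qed.

Lemma Ck_local k m (U : set 'rV[R]_m) (f : 'rV[R]_m -> R) :
  (forall x, U x -> exists2 V : set 'rV[R]_m, V x & Ck k V f) -> Ck k U f.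
Proof.
elim: k f => [|k IHk] f H; split=> //.
- by move=> x /H[V Vx /Ck_continuous]; exact.
- by move=> x /H[V Vx /Ck_continuous]; exact.
move=> i; split; first by move=> x /H[V Vx [_ Hf]]; exact: (Hf i).1.
by apply: IHk => x /H[V Vx [_ Hf]]; exists V => //; exact: (Hf i).2.
Qed.

Lemma Ck_differentiable k m (U : set 'rV[R]_m) (f : 'rV[R]_m -> R) x :
  open U -> Ck k.+1 U f -> U x -> differentiable f x.
Proof.
move=> oU [cf Hf] Ux; apply: derivable_C1_differentiable.
  near=> y; move=> i; apply: (Hf i).1; near: y; exact: open_nbhs_nbhs.
by move=> i; have [_ /Ck_continuous] := Hf i; exact.
Unshelve. all: by end_near. Qed.

Lemma Ck_sum k m (U : set 'rV[R]_m) I (r : seq I) (F : I -> 'rV[R]_m -> R) :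
  open U -> (forall i, Ck k U (F i)) -> Ck k U (fun x => \sum_(i <- r) F i x).
Proof.
move=> oU CF; elim: r => [|i r IHr].
  by under [X in Ck _ _ X]funext do rewrite big_nil; exact: Ck_cst.
under [X in Ck _ _ X]funext => x do rewrite big_cons -[F i x]mul1r.
exact: Ck_lin.
Qed.

Lemma Ck_mul k m (U : set 'rV[R]_m) (f g : 'rV[R]_m -> R) : open U ->
  Ck k U f -> Ck k U g -> Ck k U (fun x => f x * g x).
Proof.
move=> oU; elim: k f g => [|k IHk] f g Cf Cg; have [cf Hf] := Cf; have [cg Hg] := Cg;
  split=> //; do ?by move=> x Ux; exact: (cvgM (cf x Ux) (cg x Ux)).
move=> i; have [df Ckf] := Hf i; have [dg Ckg] := Hg i; split.
  by move=> x Ux; apply: derivableM; [exact: df|exact: dg].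
have h : Ck k U (fun x => 1 * (f x * 'D_('e_i) g x) + g x * 'D_('e_i) f x).
  apply: Ck_lin => //; apply: IHk => //; exact: Ck_W.
apply: Ck_eq h => // x Ux; rewrite mul1r.
by rewrite [RHS](deriveM (df x Ux) (dg x Ux)).
Qed.

Lemma row_continuous (T : topologicalType) n (g : T -> 'rV[R]_n) x :
  (forall j, {for x, continuous (fun y => g y 0 j)}) -> {for x, continuous g}.
Proof.
move=> cg A [P zP PA]; rewrite /nbhs /=.
have H : \forall y \near x, forall j, P 0 j (g y 0 j).
  by apply: filter_forall => j; exact: (cg j (P 0 j) (zP 0 j)).
apply: filterS H => y Py; apply: PA => i j.
by move: (Py j); rewrite (ord1 i).
Qed.

Lemma derive_comp_row m n (f : 'rV[R]_n -> R) (g : 'rV[R]_m -> 'rV[R]_n) x v :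
  differentiable f (g x) -> (forall j, differentiable (fun y => g y 0 j) x) ->
  differentiable (f \o g) x /\
  'D_v (f \o g) x = \sum_j 'D_('e_j) f (g x) * 'D_v (fun y => g y 0 j) x.
Proof.
move=> df dgj; have dg := row_differentiable dgj.
have dfg := differentiable_comp dg df; split; first exact: dfg.
rewrite deriveE // (_ : 'd (f \o g) x = 'd f (g x) \o 'd g x :> (_ -> _)); last first.
  exact: diff_comp.
rewrite /= derive_coord //; apply: eq_bigr => j _.
by rewrite mulrC; congr (_ * _); rewrite (diff_row v j dg) deriveE.
Qed.

(** By the chain rule the partial derivatives of the composite are sums of
    products of functions that are C^k by induction. *)
Lemma Ck_comp k m n (U : set 'rV[R]_m) (V : set 'rV[R]_n) (f : 'rV[R]_n -> R)
    (g : 'rV[R]_m -> 'rV[R]_n) : open U -> open V ->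
  (forall x, U x -> V (g x)) ->
  (forall j, Ck k U (fun x => g x 0 j)) -> Ck k V f -> Ck k U (f \o g).
Proof.
move=> oU oV UV; elim: k f => [|k IHk] f Cg Cf.
  split=> // x Ux; apply: continuous_comp; last exact: Ck_continuous Cf (UV _ Ux).
  by apply: row_continuous => j; exact: Ck_continuous (Cg j) Ux.
have D x v : U x -> differentiable (f \o g) x /\
    'D_v (f \o g) x = \sum_j 'D_('e_j) f (g x) * 'D_v (fun y => g y 0 j) x.
  move=> Ux; apply: derive_comp_row; first exact: Ck_differentiable Cf (UV _ Ux).
  by move=> j; exact: Ck_differentiable (Cg j) Ux.
split=> [x Ux|i]; first by apply: differentiable_continuous; have [] := D x 0 Ux.
split=> [x Ux|]; first by apply: diff_derivable; have [] := D x 0 Ux.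
have h : Ck k U (fun x => \sum_(j <- index_enum 'I_n)
    ('D_('e_j) f \o g) x * 'D_('e_i) (fun y => g y 0 j) x).
  apply: Ck_sum => // j; apply: Ck_mul => //.
    by apply: IHk => [l|]; [exact: Ck_W|have [_ /(_ j)[]] := Cf].
  by have [_ /(_ i)[]] := Cg j.
by apply: Ck_eq h => // x Ux; rewrite (D x _ Ux).2.
Qed.

Lemma derive_comp1 (V : normedModType R) (phi dphi : R -> R) (u : V -> R) (x v : V) :
  is_derive (u x) (1 : R) phi (dphi (u x)) -> differentiable u x ->
  differentiable (phi \o u) x /\
  'D_v (phi \o u) x = dphi (u x) * 'D_v u x.
Proof.
move=> dp du.
have dphi' : differentiable phi (u x) by apply/derivable1_diffP; exact: ex_derive.
split; first exact: differentiable_comp.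
rewrite !deriveE //; last exact: differentiable_comp.
rewrite (_ : 'd (phi \o u) x = 'd phi (u x) \o 'd u x :> (_ -> _)); last first.
  exact: diff_comp.
rewrite /= -[X in 'd phi _ X]mulr1 [LHS]linearZ /=.
rewrite [LHS]mulrC -(deriveE (1 : R) dphi'); congr (_ * _).
by have [_ ->] := dp.
Qed.

(** Composition with a function of one real variable, given together with all
    its derivatives. *)
Lemma Ck_comp1 (phi : nat -> R -> R) k m (U : set 'rV[R]_m) (u : 'rV[R]_m -> R) l :
  (forall j (t : R), is_derive t (1 : R) (phi j) (phi j.+1 t)) -> open U ->
  Ck k U u -> Ck k U (phi l \o u).
Proof.
move=> dphi oU; have cphi j : continuous (phi j).
  move=> t; apply: differentiable_continuous; apply/derivable1_diffP.
  exact: ex_derive.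
elim: k l => [|k IHk] l Cu.
  split=> // x Ux; apply: continuous_comp; first exact: Ck_continuous Cu Ux.
  exact: cphi.
have D x v : U x -> differentiable (phi l \o u) x /\
    'D_v (phi l \o u) x = phi l.+1 (u x) * 'D_v u x.
  move=> Ux; have du := Ck_differentiable oU Cu Ux.
  exact: (@derive_comp1 _ (phi l) (phi l.+1) u x v (dphi l (u x)) du).
split=> [x Ux|i]; first by apply: differentiable_continuous; have [] := D x 0 Ux.
split=> [x Ux|]; first by apply: diff_derivable; have [] := D x 0 Ux.
have h : Ck k U (fun x => (phi l.+1 \o u) x * 'D_('e_i) u x).
  apply: Ck_mul => //; first by apply: IHk; exact: Ck_W.
  by have [_ /(_ i)[]] := Cu.
by apply: Ck_eq h => // x Ux; rewrite (D x _ Ux).2.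
Qed.

Lemma is_derive_coord m (x v : 'rV[R]_m) (j : 'I_m) :
  is_derive x v (fun y : 'rV[R]_m => y 0 j) (v 0 j).
Proof.
apply: DeriveDef; first exact/diff_derivable/differentiable_coord.
rewrite deriveE; last exact: differentiable_coord.
have clin : linear (fun M : 'rV[R]_m => M 0 j : R) by move=> a u w; rewrite !mxE.
have [C CE] := linear_bundle clin.
have E : 'd C x = C :> (_ -> _).
  by apply: diff_lin; rewrite CE; exact: coord_continuous.
by move: E; rewrite CE => ->.
Qed.

Lemma Ck_coord k m (U : set 'rV[R]_m) (j : 'I_m) : Ck k U (fun x => x 0 j).
Proof.
have D x v := is_derive_coord x v j.
case: k => [|k]; split=> //; do ?by move=> x _; exact: coord_continuous.
move=> i; split=> [x _|]; first exact: ex_derive.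
rewrite (_ : 'D_('e_i) _ = cst (('e_i : 'rV[R]_m) 0 j)); first exact: Ck_cst.
by apply/funext => x; rewrite derive_val.
Qed.

Lemma smooth_derive m (U : set 'rV[R]_m) (f : 'rV[R]_m -> R) i :
  smooth_on U f -> smooth_on U ('D_('e_i) f).
Proof. by move=> sf k; have [_ /(_ i)[]] := sf k.+1. Qed.

Lemma smooth_partials m (U : set 'rV[R]_m) (f : 'rV[R]_m -> R) s :
  smooth_on U f -> smooth_on U (partials s f).
Proof. by move=> sf; elim: s => //= i s; exact: smooth_derive. Qed.

Lemma smooth_derivable m (U : set 'rV[R]_m) (f : 'rV[R]_m -> R) x i :
  smooth_on U f -> U x -> derivable f x 'e_i.
Proof. by move=> sf Ux; have [_ /(_ i)[+ _]] := sf 1%N; exact. Qed.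

Lemma smooth_differentiable m (U : set 'rV[R]_m) (f : 'rV[R]_m -> R) x :
  open U -> smooth_on U f -> U x -> differentiable f x.
Proof. by move=> oU sf; exact: Ck_differentiable (sf 1%N). Qed.

Lemma smooth_cst m (U : set 'rV[R]_m) (a : R) : smooth_on U (fun=> a).
Proof. by move=> k; exact: Ck_cst. Qed.

Lemma smooth_lin m (U : set 'rV[R]_m) (a : R) (f g : 'rV[R]_m -> R) : open U ->
  smooth_on U f -> smooth_on U g -> smooth_on U (fun x => a * f x + g x).
Proof. by move=> oU sf sg k; exact: Ck_lin. Qed.

Lemma smooth_add m (U : set 'rV[R]_m) (f g : 'rV[R]_m -> R) : open U ->
  smooth_on U f -> smooth_on U g -> smooth_on U (fun x => f x + g x).
Proof.
move=> oU sf sg; under [X in smooth_on _ X]funext => x do rewrite -[f x]mul1r.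
exact: smooth_lin.
Qed.

Lemma smooth_mul m (U : set 'rV[R]_m) (f g : 'rV[R]_m -> R) : open U ->
  smooth_on U f -> smooth_on U g -> smooth_on U (fun x => f x * g x).
Proof. by move=> oU sf sg k; exact: Ck_mul. Qed.

Lemma smooth_sum m (U : set 'rV[R]_m) I (r : seq I) (F : I -> 'rV[R]_m -> R) :
  open U -> (forall i, smooth_on U (F i)) -> smooth_on U (fun x => \sum_(i <- r) F i x).
Proof. by move=> oU sF k; apply: Ck_sum => // i; exact: sF. Qed.

Lemma smooth_prod m (U : set 'rV[R]_m) I (r : seq I) (F : I -> 'rV[R]_m -> R) :
  open U -> (forall i, smooth_on U (F i)) -> smooth_on U (fun x => \prod_(i <- r) F i x).
Proof.
move=> oU sF; elim: r => [|i r IHr].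
  by under [X in smooth_on _ X]funext do rewrite big_nil; exact: smooth_cst.
under [X in smooth_on _ X]funext => x do rewrite big_cons.
exact: smooth_mul.
Qed.

Lemma smooth_exp m (U : set 'rV[R]_m) (f : 'rV[R]_m -> R) n : open U ->
  smooth_on U f -> smooth_on U (fun x => f x ^+ n).
Proof.
move=> oU sf; elim: n => [|n IHn].
  by under [X in smooth_on _ X]funext do rewrite expr0; exact: smooth_cst.
under [X in smooth_on _ X]funext => x do rewrite exprS.
exact: smooth_mul.
Qed.

Lemma smooth_coord m (U : set 'rV[R]_m) (j : 'I_m) : smooth_on U (fun x => x 0 j).
Proof. by move=> k; exact: Ck_coord. Qed.

Lemma smooth_eq m (U : set 'rV[R]_m) (f g : 'rV[R]_m -> R) : open U ->
  (forall x, U x -> f x = g x) -> smooth_on U f -> smooth_on U g.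
Proof. by move=> oU fg sf k; exact: Ck_eq (sf k). Qed.

Lemma smooth_sub m (U V : set 'rV[R]_m) (f : 'rV[R]_m -> R) :
  V `<=` U -> smooth_on U f -> smooth_on V f.
Proof. by move=> VU sf k; exact: Ck_sub (sf k). Qed.

Lemma smooth_local m (U : set 'rV[R]_m) (f : 'rV[R]_m -> R) :
  (forall x, U x -> exists2 V : set 'rV[R]_m, V x & smooth_on V f) -> smooth_on U f.
Proof. by move=> H k; apply: Ck_local => x /H[V Vx sf]; exists V. Qed.

Lemma smooth_continuous m (U : set 'rV[R]_m) (f : 'rV[R]_m -> R) x :
  smooth_on U f -> U x -> {for x, continuous f}.
Proof. by move=> sf; exact: Ck_continuous (sf 0%N). Qed.

Lemma smooth_comp m n (U : set 'rV[R]_m) (V : set 'rV[R]_n) (f : 'rV[R]_n -> R)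
    (g : 'rV[R]_m -> 'rV[R]_n) : open U -> open V ->
  (forall x, U x -> V (g x)) -> smooth_map_on U g -> smooth_on V f ->
  smooth_on U (f \o g).
Proof. by move=> oU oV UV sg sf k; apply: (Ck_comp oU oV) => // j; exact: sg. Qed.

Lemma derive_smooth_comp m n (U : set 'rV[R]_m) (V : set 'rV[R]_n)
    (f : 'rV[R]_n -> R) (g : 'rV[R]_m -> 'rV[R]_n) x v : open U -> open V ->
  U x -> V (g x) -> smooth_map_on U g -> smooth_on V f ->
  'D_v (f \o g) x = \sum_j 'D_('e_j) f (g x) * 'D_v (fun y => g y 0 j) x.
Proof.
move=> oU oV Ux Vgx sg sf; apply: (derive_comp_row _ _ _).2.
  exact: smooth_differentiable sf Vgx.
by move=> j; exact: smooth_differentiable (sg j) Ux.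
Qed.

Lemma near_partials m (s : seq 'I_m) (f g : 'rV[R]_m -> R) (x : 'rV[R]_m) :
  (\forall y \near x, f y = g y) ->
  \forall y \near x, partials s f y = partials s g y.
Proof.
move=> fg; elim: s => //= i s /near_join IH.
by near=> y; apply: near_eq_derive; near: y.
Unshelve. all: by end_near. Qed.

Lemma partials_eq_on m (U : set 'rV[R]_m) (s : seq 'I_m) (f g : 'rV[R]_m -> R) x :
  open U -> (forall y, U y -> f y = g y) -> U x -> partials s f x = partials s g x.
Proof.
move=> oU fg Ux; apply: (nbhs_singleton (near_partials s _)).
by near=> y; apply: fg; near: y; exact: open_nbhs_nbhs.
Unshelve. all: by end_near. Qed.

Lemma derive_lin m (U : set 'rV[R]_m) (a : R) (f g : 'rV[R]_m -> R) x i :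
  U x -> smooth_on U f -> smooth_on U g ->
  'D_('e_i) (fun y => a * f y + g y) x = a * 'D_('e_i) f x + 'D_('e_i) g x.
Proof.
move=> Ux sf sg; have df := smooth_derivable (i := i) sf Ux; have dg := smooth_derivable (i := i) sg Ux.
have daf : derivable (a \*: f) x 'e_i by exact: derivableZ.
rewrite [RHS](_ : _ = 'D_('e_i) (a \*: f) x + 'D_('e_i) g x); last by rewrite deriveZ.
by rewrite -deriveD.
Qed.

Lemma derive_mul m (U : set 'rV[R]_m) (f g : 'rV[R]_m -> R) x i :
  U x -> smooth_on U f -> smooth_on U g ->
  'D_('e_i) (fun y => f y * g y) x = f x * 'D_('e_i) g x + g x * 'D_('e_i) f x.
Proof.
move=> Ux sf sg; have df := smooth_derivable (i := i) sf Ux; have dg := smooth_derivable (i := i) sg Ux.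
exact: (deriveM df dg).
Qed.

Lemma partials_lin m (U : set 'rV[R]_m) (s : seq 'I_m) (a : R) (f g : 'rV[R]_m -> R) x :
  open U -> U x -> smooth_on U f -> smooth_on U g ->
  partials s (fun y => a * f y + g y) x = a * partials s f x + partials s g x.
Proof.
move=> oU Ux sf sg; elim: s x Ux => //= i s IHs x Ux.
rewrite -(@derive_lin _ U); do ?exact: smooth_partials; last exact: Ux.
by apply: near_eq_derive; near=> y; apply: IHs; near: y; exact: open_nbhs_nbhs.
Unshelve. all: by end_near. Qed.

Lemma partials_rcons m (s : seq 'I_m) i (f : 'rV[R]_m -> R) :
  partials (rcons s i) f = partials s ('D_('e_i) f).
Proof. by rewrite /partials foldr_rcons. Qed.

Lemma partials_cat m (s t : seq 'I_m) (f : 'rV[R]_m -> R) :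
  partials (s ++ t) f = partials s (partials t f).
Proof. by rewrite /partials foldr_cat. Qed.

Lemma partials_cst0 m (s : seq 'I_m) : partials s (fun=> 0 : R) = fun=> 0.
Proof.
elim: s => //= i s ->; apply/funext => x; exact: (derive_cst (0 : R)).
Qed.

Lemma partials_sum m (U : set 'rV[R]_m) (s : seq 'I_m) I (r : seq I) (c : I -> R)
    (F : I -> 'rV[R]_m -> R) x : open U -> U x -> (forall i, smooth_on U (F i)) ->
  partials s (fun y => \sum_(i <- r) c i * F i y) x =
  \sum_(i <- r) c i * partials s (F i) x.
Proof.
move=> oU Ux sF; elim: r => [|i r IHr].
  under [X in partials _ X]funext do rewrite big_nil.
  by rewrite big_nil partials_cst0.
under [X in partials _ X]funext => y do rewrite big_cons.
rewrite big_cons -IHr; apply: (partials_lin s (c i) oU Ux (sF i)).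
apply: smooth_sum => // j; under [X in smooth_on _ X]funext => y do
  rewrite -[_ * _]addr0.
by apply: smooth_lin => //; exact: smooth_cst.
Qed.

(** * Vanishing to finite order *)

(** Vanishing at p of all derivatives of order less than N. The recursion
    differentiates on the inside, which suits the induction on products and
    composites; [flatP] gives the usual form. *)
Fixpoint flat m (N : nat) (p : 'rV[R]_m) (h : 'rV[R]_m -> R) : Prop :=
  if N is N'.+1 then h p = 0 /\ forall i, flat N' p ('D_('e_i) h) else True.

Lemma flatP m N (p : 'rV[R]_m) h :
  flat N p h <-> forall s, (size s < N)%N -> partials s h p = 0.
Proof.
elim: N h => [|N IHN] h /=; first by split.
split=> [[hp dh]|H].
  case/lastP => [_|s i]; first exact: hp.
  by rewrite size_rcons ltnS partials_rcons; exact: (IHN _).1.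
split=> [|i]; first exact: (H [::]).
by apply/IHN => s sN; rewrite -partials_rcons; apply: H; rewrite size_rcons.
Qed.

Lemma flat_near m N (p : 'rV[R]_m) f g : (\forall y \near p, f y = g y) -> flat N p f -> flat N p g.
Proof.
move=> fg /flatP H; apply/flatP => s /H <-.
by rewrite (nbhs_singleton (near_partials s fg)).
Qed.

Lemma flat_W m N (p : 'rV[R]_m) f : flat N.+1 p f -> flat N p f.
Proof. by move=> /flatP H; apply/flatP => s sN; apply: H; exact: ltnW. Qed.

Lemma flat_le m N N' (p : 'rV[R]_m) f : (N <= N')%N -> flat N' p f -> flat N p f.
Proof. by move=> NN' /flatP H; apply/flatP => s sN; apply: H; exact: leq_trans NN'. Qed.

Lemma flat_lin m N (U : set 'rV[R]_m) (p : 'rV[R]_m) a f g : open U -> U p ->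
  smooth_on U f -> smooth_on U g -> flat N p f -> flat N p g ->
  flat N p (fun x => a * f x + g x).
Proof.
move=> oU Up sf sg /flatP Hf /flatP Hg; apply/flatP => s sN.
by rewrite (partials_lin _ _ oU Up sf sg) Hf // Hg // mulr0 addr0.
Qed.

Lemma flat_add m N (U : set 'rV[R]_m) (p : 'rV[R]_m) f g : open U -> U p ->
  smooth_on U f -> smooth_on U g -> flat N p f -> flat N p g ->
  flat N p (fun x => f x + g x).
Proof.
move=> oU Up sf sg Hf Hg; under [X in flat _ _ X]funext => x do rewrite -[f x]mul1r.
exact: (flat_lin 1 oU Up sf sg).
Qed.

Lemma flat_cst0 m N (p : 'rV[R]_m) : flat N p (fun=> 0).
Proof. by apply/flatP => s _; rewrite partials_cst0. Qed.

Lemma flat_sum m N (U : set 'rV[R]_m) (p : 'rV[R]_m) I (r : seq I) (F : I -> 'rV[R]_m -> R) :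
  open U -> U p -> (forall i, smooth_on U (F i)) -> (forall i, flat N p (F i)) ->
  flat N p (fun x => \sum_(i <- r) F i x).
Proof.
move=> oU Up sF fF; elim: r => [|i r IHr].
  by under [X in flat _ _ X]funext do rewrite big_nil; exact: flat_cst0.
under [X in flat _ _ X]funext => x do rewrite big_cons.
by apply: (flat_add oU Up) => //; exact: smooth_sum.
Qed.

(** By induction on the total order with the Leibniz rule: a derivative of f g
    is a sum of two products, each of total order one less. *)
Lemma flat_mul m a b (U : set 'rV[R]_m) (p : 'rV[R]_m) f g : open U -> U p ->
  smooth_on U f -> smooth_on U g -> flat a p f -> flat b p g ->
  flat (a + b) p (fun x => f x * g x).
Proof.
move=> oU Up; have [n] := ubnP (a + b).
elim: n a b f g => // n IHn a b f g abn sf sg ff fg.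
case def_ab: (a + b)%N => [//|c] /=; split.
  case: a ff {abn} def_ab => [_|a [-> _] _]; last by rewrite mul0r.
  by case: b fg => // b [-> _] _; rewrite mulr0.
have dg i := smooth_derive i sg; have df i := smooth_derive i sf.
have cn : (c < n)%N by rewrite -ltnS -def_ab.
move=> i; have fi : flat c p (fun x => f x * 'D_('e_i) g x).
  case: b fg abn def_ab => [|b] /= fg abn def_ab.
    have ff' : flat c p f by apply: flat_W; rewrite -def_ab addn0.
    by rewrite -[c]addn0; apply: IHn => //; rewrite addn0.
  have -> : c = (a + b)%N by move: def_ab; rewrite addnS => -[].
  apply: IHn => //; first by rewrite -ltnS -addnS.
  by case: fg => _; apply.
have gi : flat c p (fun x => g x * 'D_('e_i) f x).
  under [X in flat _ _ X]funext => x do rewrite mulrC.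
  case: a ff abn def_ab {fi} => [|a] /= ff abn def_ab.
    have fg' : flat c p g by apply: flat_W; rewrite -def_ab add0n.
    by rewrite -[c]add0n; apply: IHn.
  have -> : c = (a + b)%N by move: def_ab; rewrite addSn => -[].
  apply: IHn => //; last by case: ff => _; apply.
have := flat_add oU Up (smooth_mul oU sf (dg i)) (smooth_mul oU sg (df i)) fi gi.
apply: flat_near; near=> x; rewrite (@derive_mul _ U) //.
by near: x; exact: open_nbhs_nbhs.
Unshelve. all: by end_near. Qed.

Lemma flat_mull m N (U : set 'rV[R]_m) (p : 'rV[R]_m) f g : open U -> U p ->
  smooth_on U f -> smooth_on U g -> flat N p g ->
  flat N p (fun x => f x * g x).
Proof. by move=> oU Up sf sg; exact: (@flat_mul m 0 N U p f g oU Up sf sg). Qed.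

(** The chain rule expresses the derivatives of the composite by those of f,
    which are flat of order one less, times smooth functions. *)
Lemma flat_comp m n N (U : set 'rV[R]_m) (V : set 'rV[R]_n) (f : 'rV[R]_n -> R)
    (g : 'rV[R]_m -> 'rV[R]_n) p : open U -> open V ->
  (forall x, U x -> V (g x)) -> smooth_map_on U g -> smooth_on V f -> U p ->
  flat N (g p) f -> flat N p (f \o g).
Proof.
move=> oU oV UV sg sf Up; elim: N f sf => //= N IHN f sf [fp df]; split=> // i.
have sD j : smooth_on U (fun x => 'D_('e_j) f (g x)).
  exact: (smooth_comp oU oV UV sg (smooth_derive j sf)).
have sD' j : smooth_on U ('D_('e_i) (fun y => g y 0 j)) by exact: smooth_derive.
have H : flat N p (fun x => \sum_(j <- index_enum 'I_n)
    'D_('e_j) f (g x) * 'D_('e_i) (fun y => g y 0 j) x).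
  apply: (flat_sum _ oU Up) => j; first exact: smooth_mul.
  under [X in flat _ _ X]funext => x do rewrite mulrC.
  apply: (flat_mull oU Up) => //; apply: (IHN ('D_('e_j) f)) => //.
  exact: smooth_derive.
apply: flat_near H; near=> x.
have Ux : U x by near: x; exact: open_nbhs_nbhs.
by rewrite (derive_smooth_comp _ oU oV Ux (UV _ Ux) sg sf).
Unshelve. all: by end_near. Qed.

(** A function flat of order N is O(|x - p|^N): induction on N, by the mean
    value theorem along the segment from p to x. *)
Lemma flat_estimate m N (U : set 'rV[R]_m) (f : 'rV[R]_m -> R) p :
  open U -> smooth_on U f -> U p -> flat N p f ->
  exists2 C : R, 0 <= C & \forall x \near p, `|f x| <= C * `|x - p| ^+ N.
Proof.
move=> oU + Up; elim: N f => [|N IHN] f sf.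
  exists (`|f p| + 1); first by rewrite addr_ge0.
  have cf : f x @[x --> p] --> f p := smooth_continuous sf Up.
  near=> x; have fx : `|f p - f x| <= 1.
    by near: x; exact: (cvgrPdist_le _ _).1 cf 1 ltr01.
  rewrite expr0 mulr1 -[f x](subrK (f p)) addrC.
  by apply: (le_trans (ler_normD _ _)); rewrite lerD2l distrC.
move=> [fp df]; have /choice[P HP] i : exists C : R, 0 <= C /\
    \forall x \near p, `|'D_('e_i) f x| <= C * `|x - p| ^+ N.
  by have [C C0 H] := IHN _ (smooth_derive i sf) (df i); exists C.
have P0 i : 0 <= P i by have [] := HP i.
have nP i : \forall x \near p, `|'D_('e_i) f x| <= P i * `|x - p| ^+ N.
  by have [] := HP i.
exists (\sum_i P i); first by rewrite sumr_ge0.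
have nU : \forall x \near p, U x /\ forall i, `|'D_('e_i) f x| <= P i * `|x - p| ^+ N.
  near=> x; split; first by near: x; exact: open_nbhs_nbhs.
  by near: x; apply: filter_forall.
have [r /= r0 pr] := (nbhs_ballP _ _).1 nU.
near=> x.
have xr : ball p r x by near: x; exact: nbhsx_ballx.
have seg (s : R) : 0 <= s <= 1 -> `|s *: (x - p)| <= `|x - p|.
  by move=> /andP[s0 s1]; rewrite normrZ ger0_norm // ler_piMl.
have segr (s : R) : 0 <= s <= 1 -> ball p r (p + s *: (x - p)).
  move=> s01; rewrite -ball_normE /= opprD addNKr normrN.
  by apply: le_lt_trans (seg s s01) _; rewrite -normrN opprB; move: xr; rewrite -ball_normE.
have [s s01] : exists2 s : R, 0 <= s <= 1 &
    f (p + (x - p)) - f p = 'D_(x - p) f (p + s *: (x - p)).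
  apply: MVT_segment_dir => s s01; apply: diff_derivable.
  exact: smooth_differentiable sf (pr _ (segr _ s01)).1.
have [Us Ds] := pr _ (segr _ s01).
rewrite [p + (x - p)]addrC subrK fp subr0 deriveE; last exact: smooth_differentiable sf Us.
rewrite derive_coord; last exact: smooth_differentiable sf Us.
move=> ->; apply: le_trans (ler_norm_sum _ _ _) _; rewrite mulr_suml.
apply: ler_sum => i _; rewrite normrM exprS mulrCA ler_pM //.
  exact: coord_norm_le.
apply: (le_trans (Ds i)); rewrite ler_wpM2l //.
by rewrite lerXn2r ?nnegrE // [p + _]addrC addrK; exact: seg.
Unshelve. all: by end_near. Qed.

(** * Symmetry of iterated derivatives *)

Lemma derive_shiftE (V : normedModType R) (f : V -> R) (x v w : V) :
  'D_v (fun y => f (y + w)) x = 'D_v f (x + w) /\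
  (derivable f (x + w) v -> derivable (fun y => f (y + w)) x v).
Proof.
have E : (fun h : R => h^-1 *: (((fun y => f (y + w)) \o shift x) (h *: v) - f (x + w)))
   = (fun h : R => h^-1 *: ((f \o shift (x + w)) (h *: v) - f (x + w))).
  by apply/funext => h /=; rewrite addrA.
by split; [rewrite /derive E|rewrite /derivable E].
Qed.

Lemma norm_delta m (i : 'I_m) : `|('e_i : 'rV[R]_m)| <= 1.
Proof.
apply: row_mx_norm_le => // j; rewrite !mxE.
by case: (_ && _); rewrite ?normr1 ?normr0.
Qed.

(** The mean value theorem, applied first in direction i to a difference in
    direction j and then in direction j. *)
Lemma second_difference m (U : set 'rV[R]_m) (f : 'rV[R]_m -> R) x i j (r : R) :
  smooth_on U f -> 0 < r -> ball x r `<=` U ->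
  exists2 y, ball x r y &
    f (x + (r / 3) *: 'e_i + (r / 3) *: 'e_j) - f (x + (r / 3) *: 'e_i)
      - (f (x + (r / 3) *: 'e_j) - f x)
    = (r / 3) ^+ 2 * 'D_('e_j) ('D_('e_i) f) y.
Proof.
(* Two steps of length r / 3 stay inside of the ball. *)
move=> sf r0 rU; set h := r / 3; have h0 : 0 < h by rewrite divr_gt0.
have inU (s t : R) : 0 <= s <= 1 -> 0 <= t <= 1 ->
    ball x r (x + s *: (h *: 'e_i) + t *: (h *: 'e_j)).
  move=> /andP[s0 s1] /andP[t0 t1]; rewrite -ball_normE /=.
  rewrite -addrA opprD addNKr normrN; apply: le_lt_trans (ler_normD _ _) _.
  have N (c : R) l : 0 <= c ->
      `|c *: (h *: ('e_l : 'rV[R]_m))| = c * (h * `|('e_l : 'rV[R]_m)|).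
    by move=> c0; rewrite normrZ (ger0_norm c0) normrZ (gtr0_norm h0).
  rewrite (N _ _ s0) (N _ _ t0).
  have H (c : R) l : 0 <= c -> c <= 1 -> c * (h * `|('e_l : 'rV[R]_m)|) <= h.
    move=> c0 c1; have h1 : h * `|('e_l : 'rV[R]_m)| <= h.
      by rewrite ler_piMr ?norm_delta // ltW.
    by apply: le_trans h1; rewrite ler_piMl // mulr_ge0 // ltW.
  apply: le_lt_trans (lerD (H _ i s0 s1) (H _ j t0 t1)) _.
  rewrite /h; lra.
pose F y := f (y + h *: 'e_j) - f y.
have DF y : U y -> U (y + h *: 'e_j) -> derivable F y 'e_i /\
    'D_('e_i) F y = 'D_('e_i) f (y + h *: 'e_j) - 'D_('e_i) f y.
  move=> Uy Uyj; have [E D] := derive_shiftE f y 'e_i (h *: 'e_j).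
  have d1 := D (smooth_derivable (i := i) sf Uyj).
  have d2 := smooth_derivable (i := i) sf Uy.
  split; first exact: derivableB.
  by rewrite (deriveB d1 d2) E.
have U1 (s : R) : 0 <= s <= 1 -> U (x + s *: (h *: 'e_i)).
  move=> s01; apply: rU; have := inU s 0 s01; rewrite scale0r addr0; apply.
  by rewrite lexx ler01.
have U2 (s : R) : 0 <= s <= 1 -> U (x + s *: (h *: 'e_i) + h *: 'e_j).
  move=> s01; apply: rU; have := inU s 1 s01; rewrite scale1r; apply.
  by rewrite lexx ler01.
have [s s01 E] : exists2 s : R, 0 <= s <= 1 &
    F (x + h *: 'e_i) - F x = 'D_(h *: 'e_i) F (x + s *: (h *: 'e_i)).
  apply: MVT_segment_dir => s s01; have [dF _] := DF _ (U1 s s01) (U2 s s01).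
  by have [] := derive_scale h dF.
have [dF DFE] := DF _ (U1 s s01) (U2 s s01).
have sDf := smooth_derive i sf.
set y := x + s *: (h *: 'e_i) in dF DFE E.
set g := 'D_('e_i) f.
have sDg : smooth_on U g := sDf.
have DFE' : 'D_('e_i) F y = g (y + h *: 'e_j) - g y := DFE.
clearbody g; clear DF.
have [t t01 E'] : exists2 t : R, 0 <= t <= 1 &
    g (y + h *: 'e_j) - g y = 'D_(h *: 'e_j) g (y + t *: (h *: 'e_j)).
  apply: (@MVT_segment_dir _ _ g y (h *: 'e_j)) => t t01.
  have Ut := rU _ (inU s t s01 t01).
  by have [] := derive_scale h (smooth_derivable (i := j) sDg Ut).
have Ut := rU _ (inU s t s01 t01).
exists (y + t *: (h *: 'e_j)); first exact: inU.
rewrite -[LHS]/(F (x + h *: 'e_i) - F x) E (derive_scale h dF).2 DFE' E'.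
by rewrite (derive_scale h (smooth_derivable (i := j) sDg Ut)).2 mulrA.
Qed.

(** The points y and z at which the values agree need not coincide, which is the
    situation of [derive_comm]. *)
Lemma continuous_eq_near m (U : set 'rV[R]_m) (g1 g2 : 'rV[R]_m -> R) x :
  open U -> U x -> {for x, continuous g1} -> {for x, continuous g2} ->
  (forall r : R, 0 < r -> ball x r `<=` U ->
     exists y z, [/\ ball x r y, ball x r z & g1 y = g2 z]) ->
  g1 x = g2 x.
Proof.
move=> oU Ux c1 c2 H; apply/eqP; rewrite -subr_eq0 -normr_le0.
apply/ler_addgt0Pl => e e0; rewrite addr0.
have e2 : 0 < e / 2 by rewrite divr_gt0.
have nU : \forall y \near x, [/\ U y, `|g1 x - g1 y| <= e / 2 & `|g2 x - g2 y| <= e / 2].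
  near=> y; split; first by near: y; exact: open_nbhs_nbhs.
    by near: y; exact: (cvgrPdist_le _ _).1 c1 _ e2.
  by near: y; exact: (cvgrPdist_le _ _).1 c2 _ e2.
have [r /= r0 xr] := (nbhs_ballP _ _).1 nU.
have [|y [z [/xr[_ Hy _] /xr[_ _ Hz] yz]]] := H r r0; first by move=> y /xr[].
have -> : g1 x - g2 x = (g1 x - g1 y) - (g2 x - g2 z) by rewrite yz; ring.
apply: le_trans (ler_normB _ _) _; rewrite [leRHS]splitr; exact: lerD.
Unshelve. all: by end_near. Qed.

(** The second difference is symmetric in i and j, and both mixed derivatives
    are limits of its quotients. *)
Lemma derive_comm m (U : set 'rV[R]_m) (f : 'rV[R]_m -> R) x i j :
  open U -> smooth_on U f -> U x ->
  'D_('e_i) ('D_('e_j) f) x = 'D_('e_j) ('D_('e_i) f) x.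
Proof.
move=> oU sf Ux.
have c a b : {for x, continuous ('D_('e_a) ('D_('e_b) f))}.
  by apply: smooth_continuous Ux; do 2 apply: smooth_derive.
apply: (continuous_eq_near oU Ux (c i j) (c j i)) => r r0 rU.
have [y xy Ey] := second_difference j i sf r0 rU.
have [z xz Ez] := second_difference i j sf r0 rU.
exists y, z; split; [exact: xy|exact: xz|].
have h2 : (r / 3) ^+ 2 != 0 by rewrite expf_neq0 // gt_eqF // divr_gt0.
apply: (mulfI h2); refine (etrans (esym Ey) (etrans _ Ez)).
by rewrite [x + _ + (r / 3) *: 'e_j]addrAC; ring.
Qed.

Lemma partials_derive_comm m (U : set 'rV[R]_m) (f : 'rV[R]_m -> R) s i x :
  open U -> smooth_on U f -> U x ->
  partials s ('D_('e_i) f) x = 'D_('e_i) (partials s f) x.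
Proof.
move=> oU sf; elim: s x => //= j s IHs x Ux.
rewrite -(@derive_comm _ U) //; last exact: smooth_partials.
by apply: near_eq_derive; near=> y; apply: IHs; near: y; exact: open_nbhs_nbhs.
Unshelve. all: by end_near. Qed.

Lemma partials_perm m (U : set 'rV[R]_m) (f : 'rV[R]_m -> R) s t x :
  open U -> smooth_on U f -> perm_eq s t -> U x -> partials s f x = partials t f x.
Proof.
move=> oU sf; elim: s t x => [|i s IHs] t x st Ux.
  by move: st; rewrite perm_sym => /perm_nilP ->.
have it : i \in t by rewrite -(perm_mem st) mem_head.
case/splitPr: it st => t1 t2 st.
have st' : perm_eq s (t1 ++ t2).
  by rewrite -(perm_cons i) (perm_trans st) // -cat1s perm_catCA.
rewrite partials_cat /= (@partials_derive_comm _ U) //; last exact: smooth_partials.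
apply: near_eq_derive; near=> y; rewrite -partials_cat; apply: IHs => //.
by near: y; exact: open_nbhs_nbhs.
Unshelve. all: by end_near. Qed.

End CkCalculus.

(** * A cutoff function on the line *)

Section Bump.
Variable R : realType.

(** The functions t |-> p(1/t) exp(-1/t) for t > 0, extended by 0. They are
    closed under differentiation, and so are smooth. *)
Definition flatexp (p : {poly R}) (t : R) : R :=
  if 0 < t then p.[t^-1] * expR (- t^-1) else 0.

(** exp(-1/t) decreases faster than any power of t; a quadratic bound is enough
    for differentiability at 0. *)
Lemma flatexp_bound p : exists2 C : R, 0 <= C & forall t, `|flatexp p t| <= C * t ^+ 2.
Proof.
exists (\sum_(i < size p) `|p`_i| * (i.+2)`!%:R) => [|t].
  by apply: sumr_ge0 => i _; rewrite mulr_ge0.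
rewrite /flatexp; case: ifPn => t0; last first.
  by rewrite normr0 mulr_ge0 ?sqr_ge0 // sumr_ge0 // => i _; rewrite mulr_ge0.
have [u u0 ->] : exists2 u, 0 < u & t = u^-1.
  by exists t^-1; rewrite ?invr_gt0 ?invrK.
rewrite invrK.
have E i : u ^+ i.+2 * expR (- u) <= (i.+2)`!%:R.
  have := expR_ge1Dxn i.+1 (ltW u0) => H.
  rewrite expRN ler_pdivrMr ?expR_gt0 // mulrC -ler_pdivrMr ?ltr0n ?fact_gt0 //.
  by apply: le_trans H; rewrite lerDr.
rewrite normrM (ger0_norm (expR_ge0 _)) horner_coef.
apply: (@le_trans _ _ ((\sum_(i < size p) `|p`_i| * u ^+ i) * expR (- u))).
  rewrite ler_wpM2r ?expR_ge0 //; apply: le_trans (ler_norm_sum _ _ _) _.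
  by apply: ler_sum => i _; rewrite normrM normrX (gtr0_norm u0).
rewrite !mulr_suml; apply: ler_sum => i _; rewrite -!mulrA ler_wpM2l //.
rewrite exprVn ler_pdivlMr ?exprn_gt0 // mulrAC -exprD addn2.
exact: E.
Qed.

Lemma is_derive_quadratic (f : R -> R) (C : R) :
  (forall t, `|f t| <= C * t ^+ 2) -> is_derive (0 : R) (1 : R) f 0.
Proof.
move=> fC; have f0 : f 0 = 0.
  by apply/eqP; rewrite -normr_le0; have := fC 0; rewrite expr0n mulr0.
have H : (fun h : R => h^-1 *: ((f \o shift 0) (h *: 1) - f 0)) @ 0^' --> (0 : R).
  apply/cvgrPdist_le => e e0; near=> h.
  have h0 : h != 0 by near: h; exact: nbhs_dnbhs_neq.
  rewrite sub0r normrN /= addr0 f0 subr0 [h *: 1]mulr1 normrM normfV.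
  rewrite mulrC ler_pdivrMr ?normr_gt0 //; apply: le_trans (fC h) _.
  rewrite -[h ^+ 2]ger0_norm ?sqr_ge0 // normrX expr2 mulrA ler_wpM2r //.
  have c0 : 0 < `|C| + 1 by rewrite ltr_wpDl.
  apply: (@le_trans _ _ ((`|C| + 1) * `|h|)).
    by rewrite ler_wpM2r // (le_trans (ler_norm C)) // lerDl.
  rewrite mulrC -ler_pdivlMr // ltW //; near: h.
  by apply: dnbhs0_lt; rewrite divr_gt0.
by split; [apply/cvg_ex; exists 0|exact: cvg_lim].
Unshelve. all: by end_near. Qed.

Lemma is_derive_flatexp p t :
  is_derive t (1 : R) (flatexp p) (flatexp ('X^2 * (p - p^`())) t).
Proof.
have [t0|t0|->] := ltgtP t 0; last first.
- rewrite /flatexp ltxx; have [C _ H] := flatexp_bound p.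
  exact: is_derive_quadratic H.
- have -> : flatexp ('X^2 * (p - p^`())) t =
     (p.[t^-1] - p^`().[t^-1]) * t ^- 2 * expR (- t^-1).
    by rewrite /flatexp t0 !hornerE -exprVn; congr (_ * _); rewrite mulrC.
  apply: (@near_eq_is_derive _ _ _ (fun s : R => p.[s^-1] * expR (- s^-1))).
    near=> s; rewrite /flatexp (_ : 0 < s) //; near: s; exact: lt_nbhsr.
  have tn0 : t != 0 by rewrite gt_eqF.
  have dV : is_derive t (1 : R) (fun s : R => s^-1) (- t ^- 2).
    have := @is_deriveV R id t 1 1 tn0 (is_derive_id _ _).
    by rewrite [X in is_derive _ _ _ X]mulr1.
  have dP : is_derive t (1 : R) (fun s : R => p.[s^-1]) (p^`().[t^-1] * - t ^- 2).
    exact: (@is_derive1_comp R (horner p) _ t _ _ (is_derive_poly _ _) dV).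
  have dE : is_derive t (1 : R) (fun s : R => expR (- s^-1)) (expR (- t^-1) * t ^- 2).
    have dN : is_derive t (1 : R) (fun s : R => - s^-1) (t ^- 2).
      by have := is_deriveN dV; rewrite opprK.
    exact: (@is_derive1_comp R expR _ t _ _ (is_derive_expR _) dN).
  have [dM EM] := is_deriveM dP dE; split; first exact: dM.
  rewrite [LHS]EM.
  rewrite /GRing.scale /=; ring.
- rewrite [X in is_derive _ _ _ X](_ : _ = 0); last by rewrite /flatexp ltNge ltW.
  apply: (@near_eq_is_derive _ _ _ (cst (0 : R))).
  near=> s; rewrite /flatexp ltNge ltW //; near: s; exact: lt_nbhsl.
Unshelve. all: by end_near. Qed.

(** n-fold differentiability on the whole line, in a form stable under sums,
    products and composites by plain induction. *)
Fixpoint diffn (n : nat) (f : R -> R) : Prop :=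
  if n is n'.+1 then (forall t : R, derivable f t (1 : R)) /\ diffn n' (f^`()) else True.

Lemma diffnW n f : diffn n.+1 f -> diffn n f.
Proof. by elim: n f => // n IHn f [df /IHn]; split. Qed.

Lemma diffn_cst n (a : R) : diffn n (cst a).
Proof.
elim: n a => //= n IHn a; split; first by move=> t; exact: derivable_cst.
by rewrite (_ : (cst a)^`() = cst 0) //; apply/funext => t; rewrite derive1_cst.
Qed.

Lemma diffn_id n : diffn n id.
Proof.
case: n => //= n; split; first by move=> t; exact: derivable_id.
by rewrite (_ : (@id R)^`() = cst 1); [exact: diffn_cst|apply/funext => t; rewrite derive1_id].
Qed.

Lemma diffnD n f g : diffn n f -> diffn n g -> diffn n (fun t => f t + g t).
Proof.
elim: n f g => //= n IHn f g [df Df] [dg Dg]; split.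
  by move=> t; exact: (derivableD (df t) (dg t)).
rewrite (_ : derive1 _ = fun t => derive1 f t + derive1 g t); first exact: IHn.
by apply/funext => t; rewrite !derive1E; exact: (deriveD (df t) (dg t)).
Qed.

Lemma diffnM n f g : diffn n f -> diffn n g -> diffn n (fun t => f t * g t).
Proof.
elim: n f g => // n IHn f g Hf Hg; have [df Df] := Hf; have [dg Dg] := Hg; split.
  by move=> t; exact: (derivableM (df t) (dg t)).
rewrite (_ : derive1 _ = fun t => f t * derive1 g t + g t * derive1 f t).
  by apply: diffnD; apply: IHn => //; exact: diffnW.
by apply/funext => t; rewrite !derive1E; exact: (deriveM (df t) (dg t)).
Qed.

Lemma diffn_comp n f g : diffn n f -> diffn n g -> diffn n (f \o g).
Proof.
elim: n f g => // n IHn f g Hf Hg; have [df Df] := Hf; have [dg Dg] := Hg; split.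
  move=> t; apply/derivable1_diffP; apply: differentiable_comp;
  exact/derivable1_diffP.
rewrite (_ : derive1 _ = fun t => (derive1 f \o g) t * derive1 g t).
  by apply: diffnM => //; apply: IHn => //; exact: diffnW.
by apply/funext => t; rewrite derive1_comp.
Qed.

Lemma diffn_flatexp n p : diffn n (flatexp p).
Proof.
elim: n p => //= n IHn p; split; first by move=> t; have [] := is_derive_flatexp p t.
rewrite (_ : _^`() = flatexp ('X^2 * (p - p^`()))); first exact: IHn.
by apply/funext => t; rewrite derive1E; have [_ ->] := is_derive_flatexp p t.
Qed.

Lemma diffn_derive1n n l f : diffn (l + n) f -> diffn n (f^`(l)).
Proof. by elim: l f => // l IHl f [_ Df]; rewrite derive1Sn; exact: IHl. Qed.

(** The function E(a - E(t - 1/2)) / E(a), where E(t) = exp(-1/t) for t > 0 and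
    0 otherwise, and a = E(1/2). The inner term vanishes for t <= 1/2, and is at
    least a for t > 1. The functions phi l are the successive derivatives. *)
Lemma bump_exists : exists phi : nat -> R -> R,
  [/\ forall l (t : R), is_derive t (1 : R) (phi l) (phi l.+1 t),
      forall t, t <= 1 / 2 -> phi 0%N t = 1 &
      forall l t, 1 < t -> phi l t = 0].
Proof.
pose E := flatexp 1; pose a := E (1 / 2).
have E0 t : t <= 0 -> E t = 0 by move=> t0; rewrite /E /flatexp ltNge t0.
have Epos t : 0 < t -> E t = expR (- t^-1).
  by move=> t0; rewrite /E /flatexp t0 hornerC mul1r.
have a0 : 0 < a by rewrite /a Epos ?expR_gt0 // divr_gt0.
pose f t := E (a + (-1) * E (t + - (1 / 2))) * (E a)^-1.
have Df n : diffn n f.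
  apply: diffnM; last exact: diffn_cst.
  apply: (@diffn_comp _ E); first exact: diffn_flatexp.
  apply: diffnD; first exact: diffn_cst.
  apply: diffnM; first exact: diffn_cst.
  apply: (@diffn_comp _ E); first exact: diffn_flatexp.
  by apply: diffnD; [exact: diffn_id|exact: diffn_cst].
have f1 t : 1 < t -> f t = 0.
  move=> t1; rewrite /f (E0 (_ + _)) ?mul0r // mulN1r subr_le0 /a.
  rewrite !Epos ?divr_gt0 ?subr_gt0 //; last lra.
  rewrite ler_expR lerN2 lef_pV2 ?posrE ?divr_gt0 ?subr_gt0 //; lra.
exists (fun l => f^`(l)); split.
- move=> l t; rewrite derive1nS derive1E; apply: derivableP.
  by have := @diffn_derive1n 1 l f (Df _); case.
- move=> t t2; rewrite derive1n0 /f (E0 (t + _)) ?mulr0 ?addr0 ?divff //; last lra.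
  by rewrite Epos // gt_eqF // expR_gt0.
elim=> [|l IHl] t t1; first exact: f1.
rewrite derive1nS derive1E (@near_eq_derive _ _ _ _ (cst 0)) ?derive_cst //.
by near=> s; apply: IHl; near: s; exact: lt_nbhsr.
Unshelve. all: by end_near. Qed.

End Bump.

(** * Monomials and the Taylor formula *)

Section Taylor.
Variable R : realType.

Notation "''e_' i" := (delta_mx 0 i) (at level 8, i at level 2, format "''e_' i").

Definition monomial m (p : 'rV[R]_m) (a : multi_index m) (x : 'rV[R]_m) : R :=
  \prod_i (x 0 i - p 0 i) ^+ a i.

Lemma smooth_shift_coord m (U : set 'rV[R]_m) (p : 'rV[R]_m) i : open U ->
  smooth_on U (fun x => x 0 i - p 0 i).
Proof. by move=> oU; apply: smooth_add => //; [exact: smooth_coord|exact: smooth_cst]. Qed.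

Lemma smooth_monomial m (U : set 'rV[R]_m) (p : 'rV[R]_m) a : open U ->
  smooth_on U (monomial p a).
Proof.
by move=> oU; apply: smooth_prod => // i; apply: smooth_exp => //; exact: smooth_shift_coord.
Qed.

Lemma derive_monomial m (p : 'rV[R]_m) (a : multi_index m) i :
  'D_('e_i) (monomial p a) = fun x => (a i)%:R * monomial p (ipred i a) x.
Proof.
apply/funext => x; pose c := \prod_(j | j != i) (x 0 j - p 0 j) ^+ a j.
have E (h : R) : monomial p a (h *: 'e_i + x) = (h + (x 0 i - p 0 i)) ^+ a i * c.
  rewrite /monomial (bigD1 i) //= !mxE !eqxx mulr1 addrA; congr (_ * _).
  by apply: eq_bigr => j ji; rewrite !mxE (negbTE ji) andbF mulr0 add0r.
have E0 : monomial p a x = (0 + (x 0 i - p 0 i)) ^+ a i * c.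
  by rewrite -E scale0r add0r.
have dg : is_derive (0 : R) (1 : R) (fun h : R => (h + (x 0 i - p 0 i)) ^+ a i * c)
    ((a i)%:R * (x 0 i - p 0 i) ^+ (a i).-1 * c).
  pose q : {poly R} := ('X + (x 0 i - p 0 i)%:P) ^+ a i * c%:P.
  have := is_derive_poly q 0.
  rewrite /q derivM derivC mulr0 addr0 deriv_exp derivD derivX derivC addr0 mul1r.
  rewrite [X in is_derive _ _ X _](_ : _ =
      fun h => (h + (x 0 i - p 0 i)) ^+ a i * c); last first.
    by apply/funext => h; rewrite !(hornerE, horner_exp).
  by rewrite !(hornerE, horner_exp, hornerMn) mulr_natl.
have -> : (a i)%:R * monomial p (ipred i a) x =
    (a i)%:R * (x 0 i - p 0 i) ^+ (a i).-1 * c.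
  rewrite -mulrA; congr (_ * _); rewrite /monomial (bigD1 i) //= ffunE eqxx subn1.
  by congr (_ * _); apply: eq_bigr => j ji; rewrite ffunE (negbTE ji) subn0.
have [_ <-] := dg; rewrite /derive.
rewrite (_ : (fun h : R => h^-1 *: ((monomial p a \o shift x) (h *: 'e_i) -
    monomial p a x)) = (fun h : R => h^-1 *:
    (((fun h : R => (h + (x 0 i - p 0 i)) ^+ a i * c) \o shift 0) (h *: 1) -
    (0 + (x 0 i - p 0 i)) ^+ a i * c))) //.
by apply/funext => h; rewrite /= E E0 addr0 [h *: 1]mulr1.
Qed.

Lemma monomial_center m (p : 'rV[R]_m) (a : multi_index m) :
  monomial p a p = (a == 0)%:R.
Proof.
have [->|] := eqVneq a 0; first by apply: big1 => i _; rewrite ffunE expr0.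
rewrite -ideg_eq0 /monomial => aN0; apply/eqP/prodf_eq0.
have [i ai] : exists i, a i != 0%N.
  apply/existsP; apply: contraNT aN0; rewrite negb_exists => /forallP a0.
  by rewrite /ideg big1 // => i _; apply/eqP; have := a0 i; rewrite negbK.
by exists i => //; rewrite subrr expr0n (negbTE ai).
Qed.

(** Differentiating along the letters of s lowers the exponents one by one; the
    result is nonzero at the centre exactly when all of them are used up. *)
Lemma partials_monomial m (p : 'rV[R]_m) (a : multi_index m) s :
  partials s (monomial p a) p = if mult s == a then (ifact a)%:R else 0.
Proof.
elim/last_ind: s a => [|s i IHs] a.
  rewrite /= monomial_center eq_sym (_ : mult [::] = 0); last first.
    by apply/ffunP => i; rewrite !ffunE.
  by have [<-|//] := eqVneq 0 a; rewrite ifact0.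
rewrite partials_rcons derive_monomial mult_rcons.
(* If a_i = 0 the derivative in direction i vanishes identically. *)
have [ai0|] := posnP (a i).
  under [X in partials _ X]funext => x do rewrite ai0 mul0r.
  rewrite partials_cst0; case: eqP => // /ffunP/(_ i).
  by rewrite !ffunE eqxx ai0 /= [LHS]addn1.
move=> ai; under [X in partials _ X]funext => x do rewrite -[_ * _]addr0.
rewrite (@partials_lin _ _ setT) //; first last.
- exact: smooth_cst.
- by apply: smooth_monomial; exact: openT.
- exact: openT.
have -> : (mult s + iunit i == a) = (mult s == ipred i a).
  by rewrite -{1}(ipredK ai) (inj_eq (@multi_addI _ _)).
rewrite partials_cst0 addr0 IHs.
by case: eqP => _; rewrite ?mulr0 // (ifact_ipred ai) natrM.
Qed.

(** Meaningful for smooth f, for which the order of the letters of the word is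
    immaterial. *)
Definition taylor_coef m (p : 'rV[R]_m) (a : multi_index m) (f : 'rV[R]_m -> R) : R :=
  (ifact a)%:R^-1 * partials (word a) f p.

(** The derivatives of the polynomial at p are known by [partials_monomial], and
    those of f do not depend on the order of differentiation by [partials_perm].
    *)
Lemma taylor_flat m N (U : set 'rV[R]_m) (p : 'rV[R]_m) f : open U -> U p ->
  smooth_on U f ->
  flat N p (fun x => f x - \sum_(a <- box m N) taylor_coef p a f * monomial p a x).
Proof.
move=> oU Up sf; apply/flatP => s sN.
have sM a : smooth_on U (monomial p a) by exact: smooth_monomial.
have sS : smooth_on U
    (fun x => \sum_(a <- box m N) taylor_coef p a f * monomial p a x).
  apply: smooth_sum => // a; apply: smooth_mul => //; exact: smooth_cst.
under [X in partials _ X]funext => x do rewrite addrC -mulN1r.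
rewrite (partials_lin _ _ oU Up sS sf) (partials_sum _ _ _ oU Up sM) mulN1r.
have ms : mult s \in box m N by apply: mem_box_ideg; rewrite ideg_mult.
rewrite (bigD1_seq (mult s)) ?uniq_box //= partials_monomial eqxx.
rewrite big1 ?addr0 => [|a sa]; last first.
  by rewrite partials_monomial eq_sym (negbTE sa) mulr0.
rewrite /taylor_coef mulrAC mulVf ?mul1r; last first.
  by rewrite pnatr_eq0 -lt0n ifact_gt0.
by rewrite (partials_perm oU sf (perm_word s) Up) addNr.
Qed.

Lemma taylor_coef_monomial m (p : 'rV[R]_m) (a b : multi_index m) :
  taylor_coef p a (monomial p b) = (a == b)%:R.
Proof.
rewrite /taylor_coef partials_monomial word_mult.
have [->|_] := eqVneq a b; last by rewrite mulr0.
by rewrite mulVf // pnatr_eq0 -lt0n ifact_gt0.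
Qed.

End Taylor.

(** * Cutting off flat functions *)

Section CutoffEstimate.
Variable R : realType.

Notation "''e_' i" := (delta_mx 0 i) (at level 8, i at level 2, format "''e_' i").

Lemma derive_cstM m (U : set 'rV[R]_m) (a : R) (f : 'rV[R]_m -> R) x i :
  U x -> smooth_on U f -> 'D_('e_i) (fun y => a * f y) x = a * 'D_('e_i) f x.
Proof.
move=> Ux sf; have df := smooth_derivable (i := i) sf Ux.
exact: (@deriveZ _ _ _ f a x 'e_i df).
Qed.

Definition derivative_sequence (phi : nat -> R -> R) :=
  forall l (t : R), is_derive t (1 : R) (phi l) (phi l.+1 t).

(** On [0, 1] by compactness, beyond 1 by the vanishing of the function. *)
Lemma derivative_sequence_bounded phi : derivative_sequence phi ->
  (forall l t, 1 < t -> phi l t = 0) ->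
  forall l, exists2 B : R, 0 <= B & forall t, 0 <= t -> `|phi l t| <= B.
Proof.
move=> dphi phi0 l.
have cphi : continuous (phi l).
  move=> t; apply: differentiable_continuous; apply/derivable1_diffP.
  exact: ex_derive.
have cn : {within `[0 : R, 1], continuous (fun t => `|phi l t|)}.
  apply: continuous_subspaceT => t.
  by apply: (@continuous_comp _ _ _ (phi l) (@Num.norm _ R)); [exact: cphi|exact: norm_continuous].
have [c _ Hc] := EVT_max ler01 cn.
exists `|phi l c| => // t t0; have [t1|t1] := leP t 1.
  by apply: Hc; rewrite in_itv /= t0 t1.
by rewrite phi0 // normr0.
Qed.

(** Here r is comparable to the squared distance to y. Differentiating the
    cutoff phi(n r) brings down a factor n times a derivative of r, so that the
    family of functions n^j phi_l(n r) h is stable under differentiation: j and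
    l increase by one, while h is multiplied by a function vanishing at y. On
    the support of the cutoff |x - y|^2 = O(1/n), so h = O(n^(-j-1)) when it is
    flat of order 2 j + 2, which settles the case without derivatives. Each
    derivative requires two more orders of vanishing. *)
Lemma cutoff_estimate m (W : set 'rV[R]_m) (y : 'rV[R]_m) (r : 'rV[R]_m -> R)
    (k : R) (phi : nat -> R -> R) :
  open W -> W y -> smooth_on W r -> flat 2 y r -> (forall x, W x -> 0 <= r x) ->
  0 < k -> (\forall x \near y, k * `|x - y| ^+ 2 <= r x) ->
  derivative_sequence phi -> (forall l t, 1 < t -> phi l t = 0) ->
  forall s j l (h : 'rV[R]_m -> R), smooth_on W h ->
    flat (j.*2 + (size s).*2 + 2) y h ->
    forall e : R, 0 < e -> \forall x \near y & n \near \oo,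
      `|partials s (fun x => n%:R ^+ j * (phi l (n%:R * r x) * h x)) x| <= e.
Proof.
move=> oW Wy sr fr r0 k0 kr dphi phi0.
have sphi j l (n : nat) h : smooth_on W h ->
    smooth_on W (fun x => n%:R ^+ j * (phi l (n%:R * r x) * h x)).
  move=> sh; apply: smooth_mul => //; first exact: smooth_cst.
  apply: smooth_mul => // q.
  apply: (@Ck_comp1 _ phi _ _ _ (fun x => n%:R * r x)) => //.
  by apply: (smooth_mul oW _ sr); exact: smooth_cst.
elim/last_ind => [|s i IHs] j l h sh fh e e0.
  have [B B0 HB] := derivative_sequence_bounded dphi phi0 l.
  have fh' : flat j.+1.*2 y h by apply: flat_le fh; rewrite /= addn0 addn2 doubleS.
  have [C C0 HC] := flat_estimate oW sh Wy fh'.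
  (* Where phi l (n r) is nonzero, n r <= 1 and hence k |x - y|^2 <= 1 / n. *)
  pose c := B * (C * k^-1 ^+ j.+1).
  have c0 : 0 <= c by rewrite !mulr_ge0 // exprn_ge0 // invr_ge0 ltW.
  near=> x n => /=.
  have Wx : W x by near: x; exact: open_nbhs_nbhs.
  have rx : 0 <= r x by exact: r0.
  have n0 : (0 < n)%N by near: n; exact: nbhs_infty_gt.
  have nR : (0 : R) < n%:R by rewrite ltr0n.
  have [nr|nr] := leP (n%:R * r x) 1; last by rewrite phi0 // mul0r mulr0 normr0 ltW.
  have hx : `|h x| <= C * (k^-1 ^+ j.+1 * n%:R^-1 ^+ j.+1).
    apply: (@le_trans _ _ (C * `|x - y| ^+ j.+1.*2)); first by near: x.
    rewrite ler_wpM2l // -exprMn -muln2 mulnC exprM lerXn2r ?nnegrE //.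
      by rewrite mulr_ge0 // invr_ge0 ltW.
    rewrite mulrC ler_pdivlMr // mulrC.
    apply: (@le_trans _ _ (r x)); first by near: x.
    by rewrite -[leRHS]mul1r ler_pdivlMr // mulrC.
  rewrite !normrM ger0_norm ?exprn_ge0 //.
  apply: (@le_trans _ _ (n%:R ^+ j * (B * (C * (k^-1 ^+ j.+1 * n%:R^-1 ^+ j.+1))))).
    rewrite ler_wpM2l ?exprn_ge0 // ler_pM //.
    by apply: HB; rewrite mulr_ge0 // ltW.
  rewrite [leLHS](_ : _ = c / n%:R); last first.
    rewrite /c exprS [n%:R^-1 ^+ j.+1]exprS [n%:R^-1 ^+ j]exprVn.
    by field; rewrite !gt_eqF // exprn_gt0.
  rewrite ler_pdivrMr // mulrC -ler_pdivrMr //.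
  near: n; exact: nbhs_infty_ger.
have IH1 : flat (j.+1.*2 + (size s).*2 + 2) y (fun x => 'D_('e_i) r x * h x).
  have f1 : flat 1 y ('D_('e_i) r) by case: fr => _ /(_ i).
  have := flat_mul oW Wy (smooth_derive i sr) sh f1 fh.
  by apply: flat_le; rewrite size_rcons !doubleS; lia.
have IH2 : flat (j.*2 + (size s).*2 + 2) y ('D_('e_i) h).
  have : flat (j.*2 + (size s).*2 + 2).+1 y h.
    by apply: flat_le fh; rewrite size_rcons !doubleS; lia.
  by case=> _ /(_ i).
have e2 : 0 < e / 2 by rewrite divr_gt0.
have s1 : smooth_on W (fun x => 'D_('e_i) r x * h x).
  by apply: smooth_mul => //; exact: smooth_derive.
have s2 : smooth_on W ('D_('e_i) h) by exact: smooth_derive.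
have H1 := IHs j.+1 l.+1 _ s1 IH1 _ e2.
have H2 := IHs j l _ s2 IH2 _ e2.
have H0 : \forall x \near y & n \near \oo, W x.
  exists (W, setT); last by move=> [x n] [].
  by split; [exact: open_nbhs_nbhs|exact: filterT].
apply: filterS3 H0 H1 H2 => -[x n] /= Wx Hx1 Hx2.
rewrite partials_rcons.
have sg : smooth_on W (fun x => n%:R * r x).
  by apply: (smooth_mul oW _ sr); exact: smooth_cst.
have D z : W z ->
    'D_('e_i) (fun x => n%:R ^+ j * (phi l (n%:R * r x) * h x)) z =
    1 * (n%:R ^+ j.+1 * (phi l.+1 (n%:R * r z) * ('D_('e_i) r z * h z))) +
    n%:R ^+ j * (phi l (n%:R * r z) * 'D_('e_i) h z).
  move=> Wz; have sp : smooth_on W (fun x => phi l (n%:R * r x)).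
    by move=> q; exact: (@Ck_comp1 _ phi _ _ _ (fun x => n%:R * r x)).
  have := @derive_comp1 _ _ _ _ (fun x => n%:R * r x) z ('e_i)
    (dphi l (n%:R * r z)) (smooth_differentiable oW sg Wz).
  case=> _ Dp.
  rewrite (derive_cstM _ _ Wz (smooth_mul oW sp sh)).
  rewrite (derive_mul _ Wz sp sh) [X in h z * X]Dp (derive_cstM _ _ Wz sr).
  by rewrite mul1r exprS; ring.
rewrite (partials_eq_on s oW D Wx).
rewrite (partials_lin _ _ oW Wx (sphi _ _ _ _ s1) (sphi _ _ _ _ s2)).
rewrite mul1r; apply: le_trans (ler_normD _ _) _; rewrite [leRHS]splitr.
exact: lerD.
Unshelve. all: by end_near. Qed.

End CutoffEstimate.

(** * Smooth real functions on manifolds *)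

Lemma open_preimage_on (T U : topologicalType) (A : set T) (f : T -> U) (W : set U) :
  open A -> (forall x, A x -> {for x, continuous f}) -> open W ->
  open (A `&` f @^-1` W).
Proof.
move=> oA cf oW; rewrite openE => x [Ax Wfx]; rewrite /interior.
apply: filterI; first exact: open_nbhs_nbhs.
by apply: (cf x Ax); exact: open_nbhs_nbhs.
Qed.

Section ManifoldFunctions.
Variable R : realType.

Definition smooth_real (M : manifold R) (u : M -> R) :=
  forall c, atlas c -> smooth_on (cimg c) (u \o cinv c).

Lemma open_chart_preimage m (M : topologicalType) (c : chart R m M) (W : set M) : open W ->
  open (cimg c `&` cinv c @^-1` W).
Proof.
by apply: open_preimage_on; [exact: cimg_open|exact: cinv_continuous].
Qed.

Lemma open_chart_image m (M : topologicalType) (c : chart R m M) (V : set 'rV[R]_m) : open V ->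
  open (cdom c `&` cfun c @^-1` V).
Proof.
by apply: open_preimage_on; [exact: cdom_open|exact: cfun_continuous].
Qed.

Lemma open_map_preimage (M N : manifold R) (phi : M -> N) (c : chart R (mdim M) M) (V : set N) :
  continuous phi -> open V -> open (cimg c `&` (phi \o cinv c) @^-1` V).
Proof.
move=> cphi oV; apply: open_preimage_on; [exact: cimg_open| |exact: oV].
by move=> y cy; apply: continuous_comp; [exact: cinv_continuous|exact: cphi].
Qed.

(** Near each point it is enough to look at one chart, by the compatibility of
    the atlas. *)
Lemma smooth_real_local (M : manifold R) (u : M -> R) :
  (forall z, exists (c : chart R (mdim M) M) (V : set 'rV[R]_(mdim M)),
     [/\ atlas c, cdom c z, open V, V (cfun c z) & smooth_on (V `&` cimg c) (u \o cinv c)]) ->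
  smooth_real u.
Proof.
move=> H c' Ac'; apply: smooth_local => x c'x.
have [c [V [Ac cz oV Vz su]]] := H (cinv c' x).
pose W := cimg c' `&` cinv c' @^-1` (cdom c `&` cfun c @^-1` V).
have oW : open W by apply: open_chart_preimage; exact: open_chart_image.
exists W; first by split.
have oVc : open (V `&` cimg c) by apply: openI => //; exact: cimg_open.
have sc : smooth_map_on W (cfun c \o cinv c').
  move=> j; apply: smooth_sub (atlas_compat Ac' Ac j).
  by move=> y [c'y [cy _]].
have WV y : W y -> (V `&` cimg c) ((cfun c \o cinv c') y).
  by move=> [_ [cy Vy]]; split=> //; exact: cfun_img.
apply: smooth_eq (smooth_comp oW oVc WV sc su) => // y [_ [cy _]] /=.
by rewrite cfunK.
Qed.

Lemma smooth_real_comp (M N : manifold R) (phi : M -> N) (v : N -> R) :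
  smooth_map phi -> smooth_real v -> smooth_real (v \o phi).
Proof.
move=> [cphi sphi] sv c Ac; apply: smooth_local => x cx.
have [d Ad dx] := atlas_cover (phi (cinv c x)).
pose W := cimg c `&` (phi \o cinv c) @^-1` cdom d.
have oW : open W by apply: open_map_preimage cphi _; exact: cdom_open.
exists W; first by split.
have WV y : W y -> cimg d ((cfun d \o phi \o cinv c) y).
  by move=> [_ dy]; exact: cfun_img.
apply: smooth_eq (smooth_comp oW (@cimg_open _ _ _ d) WV (sphi c d Ac Ad) (sv d Ad)) => //.
by move=> y [_ dy] /=; rewrite cfunK.
Qed.

(** Vanishing to order n is invariant under smooth maps; in particular it does
    not depend on the chart. *)
Lemma flat_pullback (M N : manifold R) (phi : M -> N) (v : N -> R) (e : M) n
    (c : chart R (mdim M) M) (d : chart R (mdim N) N) :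
  smooth_map phi -> smooth_real v -> atlas c -> atlas d ->
  cdom c e -> cdom d (phi e) ->
  flat n (cfun d (phi e)) (v \o cinv d) -> flat n (cfun c e) (v \o phi \o cinv c).
Proof.
move=> [cphi sphi] sv Ac Ad ce de fv.
pose W := cimg c `&` (phi \o cinv c) @^-1` cdom d.
have oW : open W by apply: open_map_preimage cphi _; exact: cdom_open.
have We : W (cfun c e) by split; rewrite /= ?cfunK //; exact: cfun_img.
have WV y : W y -> cimg d ((cfun d \o phi \o cinv c) y).
  by move=> [_ dy]; exact: cfun_img.
have : flat n (cfun c e) ((v \o cinv d) \o (cfun d \o phi \o cinv c)).
  apply: (flat_comp oW (@cimg_open _ _ _ d) WV (sphi c d Ac Ad) (sv d Ad) We).
  by rewrite /= cfunK.
apply: flat_near; near=> y; have [_ dy] : W y by near: y; exact: open_nbhs_nbhs.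
by rewrite /= cfunK.
Unshelve. all: by end_near. Qed.

Lemma smooth_map_id (M : manifold R) : smooth_map (@idfun M).
Proof.
split=> [x|c d Ac Ad]; first exact: cvg_id.
exact: atlas_compat.
Qed.

Lemma flat_chart (M : manifold R) (u : M -> R) (e : M) n (c d : chart R (mdim M) M) :
  smooth_real u -> atlas c -> atlas d -> cdom c e -> cdom d e ->
  flat n (cfun d e) (u \o cinv d) -> flat n (cfun c e) (u \o cinv c).
Proof. move=> su; exact: (flat_pullback (@smooth_map_id M)). Qed.

Lemma smooth_real_cst (M : manifold R) (a : R) : smooth_real (fun=> a : R) (M := M).
Proof. by move=> c _; exact: smooth_cst. Qed.

Lemma smooth_real_lin (M : manifold R) a (u v : M -> R) :
  smooth_real u -> smooth_real v -> smooth_real (fun x => a * u x + v x).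
Proof.
by move=> su sv c Ac; apply: (smooth_lin a (@cimg_open _ _ _ c) (su c Ac) (sv c Ac)).
Qed.

Lemma smooth_realM (M : manifold R) (u v : M -> R) :
  smooth_real u -> smooth_real v -> smooth_real (fun x => u x * v x).
Proof.
by move=> su sv c Ac; apply: (smooth_mul (@cimg_open _ _ _ c) (su c Ac) (sv c Ac)).
Qed.

Definition chart_ext m (M : topologicalType) (c : chart R m M) (h : 'rV[R]_m -> R) (y : M) : R :=
  if `[< cdom c y >] then h (cfun c y) else 0.

Lemma chart_extE m (M : topologicalType) (c : chart R m M) (h : 'rV[R]_m -> R) x :
  cimg c x -> chart_ext c h (cinv c x) = h x.
Proof. by move=> cx; rewrite /chart_ext asboolT ?cinvK //; exact: cinv_dom. Qed.

(** A compact subset of the chart is closed in M because M is Hausdorff, so the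
    extension vanishes on a neighbourhood of each point outside of the chart. *)
Lemma chart_ext_smooth (M : manifold R) (c : chart R (mdim M) M)
    (h : 'rV[R]_(mdim M) -> R) (K : set 'rV[R]_(mdim M)) :
  atlas c -> smooth_on (cimg c) h -> compact K -> K `<=` cimg c ->
  (forall x, cimg c x -> ~ K x -> h x = 0) -> smooth_real (chart_ext c h).
Proof.
move=> Ac sh cK Kc h0; apply: smooth_real_local => z.
have [cz|ncz] := pselect (cdom c z).
  exists c, setT; split=> //; first exact: openT.
  rewrite setTI; apply: smooth_eq sh; first exact: cimg_open.
  by move=> x cx /=; rewrite chart_extE.
have [d Ad dz] := atlas_cover z.
pose O := ~` (cinv c @` K).
have oO : open O.
  rewrite openC; apply: compact_closed; first exact: mhausdorff.
  apply: continuous_compact => //; apply: continuous_in_subspaceT => x.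
  by rewrite inE => /Kc; exact: cinv_continuous.
(* Outside of the chart, the extension vanishes on the complement of the image of K. *)
exists d, (cimg d `&` cinv d @^-1` O); split=> //.
- exact: open_chart_preimage.
- split; first exact: cfun_img.
  by rewrite /= cfunK // => -[x /Kc cx xz]; apply: ncz; rewrite -xz; exact: cinv_dom.
apply: smooth_eq (smooth_cst _ 0).
  by apply: openI; [exact: open_chart_preimage|exact: cimg_open].
move=> x [[dx Ox] _] /=; rewrite /chart_ext; case: asboolP => // cx.
rewrite h0 //; first exact: cfun_img.
by move=> Kx; apply: Ox; exists (cfun c (cinv d x)) => //; rewrite cfunK.
Qed.

End ManifoldFunctions.

(** * Cutoffs around a point of a manifold *)

Section Cutoff.
Variable R : realType.

Notation "''e_' i" := (delta_mx 0 i) (at level 8, i at level 2, format "''e_' i").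

Definition bump : nat -> R -> R := sval (cid (@bump_exists R)).

Lemma bump_derive : derivative_sequence bump.
Proof. by case: (svalP (cid (@bump_exists R))). Qed.

Lemma bump1 t : t <= 1 / 2 -> bump 0 t = 1.
Proof. by case: (svalP (cid (@bump_exists R))) => _ H _; exact: H. Qed.

Lemma bump0 l t : 1 < t -> bump l t = 0.
Proof. by case: (svalP (cid (@bump_exists R))) => _ _; exact. Qed.

(** The square of the Euclidean distance, used because the norm of row vectors
    is not differentiable. *)
Definition sqdist m (p x : 'rV[R]_m) : R := \sum_i (x 0 i - p 0 i) ^+ 2.

Lemma smooth_sqdist m (U : set 'rV[R]_m) (p : 'rV[R]_m) : open U -> smooth_on U (sqdist p).
Proof.
move=> oU; apply: smooth_sum => // i; apply: smooth_exp => //.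
exact: smooth_shift_coord.
Qed.

Lemma flat_coord m (p : 'rV[R]_m) i : flat 1 p (fun x => x 0 i - p 0 i).
Proof. by split=> //; rewrite subrr. Qed.

Lemma flat_sqdist m (p : 'rV[R]_m) : flat 2 p (sqdist p).
Proof.
apply: (@flat_sum _ _ _ setT) => //; first exact: openT.
  by move=> i; apply: smooth_exp; [exact: openT|apply: smooth_shift_coord; exact: openT].
move=> i; rewrite -[2%N]/(1 + 1)%N.
under [X in flat _ _ X]funext => x do rewrite expr2.
apply: (@flat_mul _ _ 1 1 setT) => //; do ?exact: flat_coord; first exact: openT.
all: by apply: smooth_shift_coord; exact: openT.
Qed.

Lemma sqdist_ge0 m (p x : 'rV[R]_m) : 0 <= sqdist p x.
Proof. by apply: sumr_ge0 => i _; exact: sqr_ge0. Qed.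

Lemma norm_sqdist m (p x : 'rV[R]_m) : `|x - p| ^+ 2 <= sqdist p x.
Proof.
have H : `|x - p| <= Num.sqrt (sqdist p x).
  apply: row_mx_norm_le => [|i]; first exact: sqrtr_ge0.
  rewrite -sqrtr_sqr ler_sqrt ?sqdist_ge0 // !mxE /sqdist (bigD1 i) //= lerDl.
  by apply: sumr_ge0 => j _; exact: sqr_ge0.
rewrite -[leRHS](sqr_sqrtr (sqdist_ge0 p x)).
by rewrite lerXn2r ?nnegrE ?sqrtr_ge0.
Qed.

Lemma sqdistxx m (p : 'rV[R]_m) : sqdist p p = 0.
Proof. by apply: big1 => i _; rewrite subrr expr0n. Qed.

Lemma sqdist_continuous m (p : 'rV[R]_m) : continuous (sqdist p).
Proof.
by move=> x; apply: (smooth_continuous (smooth_sqdist p openT)).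
Qed.

Definition sqball m (p : 'rV[R]_m) (n : nat) : set 'rV[R]_m :=
  [set x | n%:R * sqdist p x <= 1].

Lemma sqball_ball m (p : 'rV[R]_m) (U : set 'rV[R]_m) : nbhs p U ->
  \forall n \near \oo, (0 < n)%N /\ sqball p n `<=` U.
Proof.
move=> /nbhs_ballP[r /= r0 rU].
near=> n; have n0 : (0 < n)%N by near: n; exact: nbhs_infty_gt.
split=> // x /= nx; apply: rU; rewrite -ball_normE /= -normrN opprB.
have nR : (0 : R) < n%:R by rewrite ltr0n.
rewrite -(@ltr_pXn2r _ 2) ?nnegrE // ?ltW //.
apply: le_lt_trans (norm_sqdist p x) _.
have : sqdist p x <= n%:R^-1 by rewrite -[leRHS]mul1r ler_pdivlMr // mulrC.
move=> /le_lt_trans; apply; rewrite -(invrK (r ^+ 2)) ltf_pV2 ?posrE ?invr_gt0 ?exprn_gt0 //.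
by near: n; exact: nbhs_infty_gtr.
Unshelve. all: by end_near. Qed.

Lemma sqball_compact m (p : 'rV[R]_m) n : (0 < n)%N -> compact (sqball p n).
Proof.
move=> n0; have nR : (0 : R) < n%:R by rewrite ltr0n.
apply: bounded_closed_compact.
  exists (`|p| + 1); split; first by rewrite num_real.
  move=> y y1 x /= nx; apply: (le_trans _ (ltW y1)).
  rewrite -[x](subrK p) addrC; apply: (le_trans (ler_normD _ _)); rewrite lerD2l.
  rewrite -(@ler_pXn2r _ 2) ?nnegrE // expr1n; apply: (le_trans (norm_sqdist p x)).
  apply: le_trans nx; rewrite ler_peMl ?sqdist_ge0 //.
  by rewrite ler1n.
have -> : sqball p n = (fun x => n%:R * sqdist p x) @^-1` [set y : R | y <= 1] by [].
apply: closed_comp; last exact: closed_le.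
by move=> x _; exact: (cvgM (cvg_cst _) (@sqdist_continuous m p x)).
Qed.

Definition chart_cutoff m (M : topologicalType) (c : chart R m M) (e : M) (n : nat) : M -> R :=
  chart_ext c (fun x => bump 0 (n%:R * sqdist (cfun c e) x)).

Lemma smooth_bump m (U : set 'rV[R]_m) (p : 'rV[R]_m) (n : nat) : open U ->
  smooth_on U (fun x => bump 0 (n%:R * sqdist p x)).
Proof.
move=> oU k; apply: (@Ck_comp1 _ bump _ _ _ (fun x => n%:R * sqdist p x)) => //.
  exact: bump_derive.
by apply: (smooth_mul oU); [exact: smooth_cst|exact: smooth_sqdist].
Qed.

Lemma near_bump m (p : 'rV[R]_m) (n : nat) :
  \forall x \near p, bump 0 (n%:R * sqdist p x) = 1.
Proof.
have c0 : (n%:R * sqdist p x) @[x --> p] --> (n%:R * sqdist p p).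
  exact: (cvgM (cvg_cst _) (@sqdist_continuous m p p)).
rewrite sqdistxx mulr0 in c0.
near=> x; rewrite bump1 // ltW //; near: x.
apply: (c0 [set y : R | y < 1 / 2]); apply: lt_nbhsl; lra.
Unshelve. all: by end_near. Qed.

(** For large n the support of the cutoff is a compact subset of the chart. *)
Lemma chart_local_ext (M : manifold R) (c : chart R (mdim M) M) e :
  atlas c -> cdom c e ->
  exists n0, forall n, (n0 <= n)%N ->
   forall h, smooth_on (cimg c) h ->
    smooth_real (chart_ext c (fun x => bump 0 (n%:R * sqdist (cfun c e) x) * h x)).
Proof.
move=> Ac ce; have oc := @cimg_open _ _ _ c.
have nc : nbhs (cfun c e) (cimg c).
  by apply: open_nbhs_nbhs; split=> //; exact: cfun_img.
have [n0 _ Hn] := sqball_ball nc.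
exists n0 => n n0n h sh; have [np nc'] := Hn n n0n.
apply: (@chart_ext_smooth _ _ c _ (sqball (cfun c e) n)) => //.
- by apply: smooth_mul => //; exact: smooth_bump.
- exact: sqball_compact.
move=> x cx nx; rewrite bump0 ?mul0r // ltNge; exact/negP.
Qed.

Lemma chart_near (M : topologicalType) m (c : chart R m M) (e : M) (P : set 'rV[R]_m) :
  cdom c e -> nbhs (cfun c e) P -> \forall y \near e, cdom c y /\ P (cfun c y).
Proof.
move=> ce nP; apply: filterI; first by apply: open_nbhs_nbhs; split=> //; exact: cdom_open.
exact: (cfun_continuous ce).
Qed.

(** Every germ at e of a smooth function extends to a global smooth function. *)
Lemma chart_extension (M : manifold R) (c : chart R (mdim M) M) e (h : 'rV[R]_(mdim M) -> R) :
  atlas c -> cdom c e -> smooth_on (cimg c) h ->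
  exists2 u : M -> R, smooth_real u & \forall y \near e, u y = h (cfun c y).
Proof.
move=> Ac ce sh; have [n0 H] := chart_local_ext Ac ce.
exists (chart_ext c (fun x => bump 0 (n0%:R * sqdist (cfun c e) x) * h x)); first exact: H.
have := chart_near ce (near_bump (cfun c e) n0).
by apply: filterS => y [cy E]; rewrite /chart_ext asboolT // E mul1r.
Qed.

Lemma chart_cutoff_smooth (M : manifold R) (c : chart R (mdim M) M) e :
  atlas c -> cdom c e ->
  \forall n \near \oo, smooth_real (chart_cutoff c e n).
Proof.
move=> Ac ce; have [n0 H] := chart_local_ext Ac ce.
exists n0 => // n /H/(_ (fun=> 1) (smooth_cst _ _)).
rewrite /chart_cutoff.
by under [X in chart_ext _ X]funext => x do rewrite mulr1.
Qed.

Lemma chart_cutoff_near (M : topologicalType) m (c : chart R m M) (e : M) n :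
  cdom c e -> \forall y \near e, chart_cutoff c e n y = 1.
Proof.
move=> ce; have := chart_near ce (near_bump (cfun c e) n).
by apply: filterS => y [cy E]; rewrite /chart_cutoff /chart_ext asboolT.
Qed.

(** The supports of the cutoffs shrink to e. *)
Lemma chart_cutoff_away (M : topologicalType) m (c : chart R m M) (e : M) (B : set M) :
  cdom c e -> nbhs e B ->
  \forall n \near \oo, forall z, ~ B z -> chart_cutoff c e n z = 0.
Proof.
move=> ce nB; have nc : nbhs (cfun c e) (cimg c `&` cinv c @^-1` B).
  apply: filterI.
    by apply: open_nbhs_nbhs; split; [exact: cimg_open|exact: cfun_img].
  by apply: (cinv_continuous (cfun_img ce)); rewrite /= cfunK.
apply: filterS (sqball_ball nc) => n [n0 nB'] z nBz.
rewrite /chart_cutoff /chart_ext; case: asboolP => // cz.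
rewrite bump0 // ltNge; apply/negP => /nB'[_ /=].
by rewrite cfunK.
Qed.

Lemma near_prod_fst (T U : Type) (F : set_system T) (G : set_system U)
    {FF : Filter F} {FG : Filter G} (P : set T) : F P ->
  \forall x \near F & n \near G, P x.
Proof.
by move=> FP; exists (P, setT); [split=> //; exact: filterT|move=> [x n] []].
Qed.

Lemma near_prod_snd (T U : Type) (F : set_system T) (G : set_system U)
    {FF : Filter F} {FG : Filter G} (P : set U) : G P ->
  \forall x \near F & n \near G, P n.
Proof.
by move=> FP; exists (setT, P); [split=> //; exact: filterT|move=> [x n] []].
Qed.

(** Transition maps are Lipschitz near e; this compares the squared distances
    measured in two charts. *)
Lemma chart_lipschitz (M : manifold R) (c d : chart R (mdim M) M) (e : M) :
  atlas c -> atlas d -> cdom c e -> cdom d e ->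
  exists2 C : R, 0 < C & \forall x \near cfun d e,
    `|x - cfun d e| <= C * `|cfun c (cinv d x) - cfun c e|.
Proof.
move=> Ac Ad ce de; set y := cfun d e; set p := cfun c e.
pose V := cimg c `&` cinv c @^-1` cdom d.
have oV : open V by apply: open_chart_preimage; exact: cdom_open.
have Vp : V p by split; rewrite /= /p ?cfunK //; exact: cfun_img.
have sV i : smooth_on V (fun z => (cfun d (cinv c z)) 0 i - y 0 i).
  by apply: smooth_add => //; [exact: (atlas_compat Ac Ad i)|exact: smooth_cst].
have /choice[C HC] i : exists C : R, 0 <= C /\ \forall z \near p,
    `|(cfun d (cinv c z)) 0 i - y 0 i| <= C * `|z - p|.
  have f1 : flat 1 p (fun z => (cfun d (cinv c z)) 0 i - y 0 i).
    by split=> //; rewrite /p cfunK // subrr.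
  have [C C0 H] := flat_estimate oV (sV i) Vp f1.
  by exists C; split=> //; apply: filterS H => z; rewrite expr1.
have S0 : 0 <= \sum_i C i by apply: sumr_ge0 => i _; have [] := HC i.
exists (1 + \sum_i C i); first by rewrite ltr_pwDl.
have nz : \forall z \near p, `|cfun d (cinv c z) - y| <= (1 + \sum_i C i) * `|z - p|.
  have H : \forall z \near p, forall i, `|(cfun d (cinv c z)) 0 i - y 0 i| <= C i * `|z - p|.
    by near=> z; near: z; apply: filter_forall => i; have [] := HC i.
  apply: filterS H => z Hz; apply: row_mx_norm_le => [|i].
    by rewrite mulr_ge0 // addr_ge0.
  rewrite !mxE; apply: (le_trans (Hz i)); rewrite ler_wpM2r //.
  rewrite (bigD1 i) //= addrCA lerDl addr_ge0 // sumr_ge0 // => j _.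
  by have [] := HC j.
have cd : {for y, continuous (cfun c \o cinv d)}.
  apply: continuous_comp; first by apply: cinv_continuous; exact: cfun_img.
  by rewrite /y cfunK //; exact: cfun_continuous.
have nd : nbhs y (cimg d `&` cinv d @^-1` cdom c).
  apply: open_nbhs_nbhs; split; first by apply: open_chart_preimage; exact: cdom_open.
  by split; rewrite /= /y ?cfunK //; exact: cfun_img.
have nx : \forall x \near y,
    `|cfun d (cinv c (cfun c (cinv d x))) - y| <= (1 + \sum_i C i) * `|cfun c (cinv d x) - p|.
  by apply: (cd [set z | `|cfun d (cinv c z) - y| <= (1 + \sum_i C i) * `|z - p|]);
     rewrite /= /y cfunK.
by apply: filterS2 nd nx => x [dx cx]; rewrite /= cfunK // cinvK.
Unshelve. all: by end_near. Qed.

(** Away from e the cutoffs vanish locally, for large n. At e, the estimate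
    [cutoff_estimate] applies in the chart d to the squared distance measured in
    the chart c, which is comparable to the one of d by [chart_lipschitz]. *)
Lemma chart_cutoff_cvg (M : manifold R) (c d : chart R (mdim M) M) e (u : M -> R) N s y :
  atlas c -> cdom c e -> atlas d -> cimg d y -> smooth_real u ->
  flat N (cfun c e) (u \o cinv c) -> ((size s).*2 + 2 <= N)%N ->
  forall eps : R, 0 < eps -> \forall x \near y & n \near \oo,
    `|partials s ((fun z => chart_cutoff c e n z * u z) \o cinv d) x| <= eps.
Proof.
move=> Ac ce Ad dy su fu sN eps eps0.
have oWd (W : set M) := @open_chart_preimage _ _ _ d W.
(* Away from e: separate the point from e. *)
have [ze|/eqP zNe] := pselect (cinv d y = e); last first.
  have := @mhausdorff _ M; rewrite open_hausdorff => /(_ _ _ zNe)[[A B] /= [zA eB] [oA oB AB]].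
  have nB : nbhs e B by apply: open_nbhs_nbhs; split=> //; rewrite inE in eB.
  have H := chart_cutoff_away ce nB.
  pose V := cimg d `&` cinv d @^-1` A.
  have oV : open V by exact: oWd.
  have nV : nbhs y V by apply: open_nbhs_nbhs; split=> //; split=> //; rewrite inE in zA.
  apply: filterS2 (near_prod_fst nV) (near_prod_snd H) => -[x n] /= Vx Hn.
  rewrite (@partials_eq_on _ _ V _ _ (fun=> 0)) //; last first.
    move=> w [dw Aw] /=; rewrite Hn ?mul0r // => Bw.
    by have : (A `&` B) (cinv d w) by []; rewrite (eqP AB).
  by rewrite partials_cst0 normr0 ltW.
have de : cdom d e by rewrite -ze; exact: cinv_dom.
have yE : y = cfun d e by rewrite -ze cinvK.
pose p := cfun c e.
pose W := cimg d `&` cinv d @^-1` cdom c.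
have oW : open W by apply: oWd; exact: cdom_open.
have Wy : W y by split=> //; rewrite /= ze.
have st : smooth_map_on W (cfun c \o cinv d) by exact: atlas_compat.
have WV x : W x -> cimg c ((cfun c \o cinv d) x) by move=> [_ cx]; exact: cfun_img.
pose r := sqdist p \o (cfun c \o cinv d).
have sr : smooth_on W r.
  by apply: (smooth_comp oW (@cimg_open _ _ _ c) WV st); exact: smooth_sqdist (@cimg_open _ _ _ c).
have fr : flat 2 y r.
  apply: (flat_comp oW (@cimg_open _ _ _ c) WV st _ Wy).
    exact: smooth_sqdist (@cimg_open _ _ _ c).
  by rewrite /= ze; exact: flat_sqdist.
have [k k0 kr] : exists2 k : R, 0 < k & \forall x \near y, k * `|x - y| ^+ 2 <= r x.
  have [C C0 HC] := chart_lipschitz Ac Ad ce de.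
  exists (C ^+ 2)^-1; first by rewrite invr_gt0 exprn_gt0.
  rewrite yE; apply: filterS HC => x Hx; rewrite mulrC ler_pdivrMr ?exprn_gt0 //.
  apply: (@le_trans _ _ ((C * `|cfun c (cinv d x) - p|) ^+ 2)).
    by rewrite lerXn2r ?nnegrE // mulr_ge0 // ltW.
  by rewrite exprMn mulrC ler_wpM2r ?norm_sqdist // exprn_ge0 // ltW.
have fdu : flat N y (u \o cinv d) by rewrite yE; exact: (flat_chart su Ad Ac).
have H := @cutoff_estimate R (mdim M) W y r k bump oW Wy sr fr
  (fun x _ => sqdist_ge0 p _) k0 kr bump_derive (fun l t => @bump0 l t) s 0%N 0%N
  (u \o cinv d) (fun q => smooth_sub (@subIsetl _ _ _) (su d Ad) q)
  (flat_le sN fdu) eps eps0.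
apply: filterS2 (near_prod_fst (open_nbhs_nbhs (conj oW Wy))) H => -[x n] /= Wx.
rewrite (@partials_eq_on _ _ W _ _ (fun x0 =>
   n%:R ^+ 0 * (bump 0 (n%:R * r x0) * u (cinv d x0)))) //.
move=> w [dw cw] /=; rewrite expr0 mul1r /chart_cutoff /chart_ext asboolT //.
Qed.

End Cutoff.

From mathcomp Require Import complex finmap.

Section CutoffUniform.
Variable R : realType.

(** The convergence is locally uniform in both variables, hence uniform on
    compact sets. The function v leaves room for neighbourhoods that are not
    centred at 0. *)
Lemma chart_cutoff_uniform (M : manifold R) (c d : chart R (mdim M) M) e
    (u v : M -> R) N s (L : set 'rV[R]_(mdim M)) (eps : R) :
  atlas c -> cdom c e -> atlas d -> compact L -> L `<=` cimg d ->
  smooth_real u -> smooth_real v ->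
  flat N (cfun c e) (u \o cinv c) -> ((size s).*2 + 2 <= N)%N ->
  (forall x, L x -> `|partials s (v \o cinv d) x| < eps) ->
  \forall n \near \oo, forall x, L x ->
    `|partials s ((fun z => chart_cutoff c e n z * u z + v z) \o cinv d) x| < eps.
Proof.
move=> Ac ce Ad cL Ld su sv fu sN Hv.
have cut : \forall n \near \oo, smooth_real (chart_cutoff c e n).
  exact: chart_cutoff_smooth.
suff : \forall n \near \oo, L `<=` (fun n x => smooth_real (chart_cutoff c e n) ->
    `|partials s ((fun z => chart_cutoff c e n z * u z + v z) \o cinv d) x| < eps) n.
  by apply: filterS2 cut => n sn H x Lx; exact: H.
apply: ((compact_near_coveringP L).1 cL) => y Ly; have dy := Ld _ Ly.
pose w := partials s (v \o cinv d).
have sw : smooth_on (cimg d) w by apply: smooth_partials; exact: sv.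
(* A third of the gap at y bounds the cutoff term, another one the variation of w. *)
pose dl := (eps - `|w y|) / 3.
have dl0 : 0 < dl by rewrite divr_gt0 // subr_gt0 Hv.
have nw : \forall x \near y, `|w y - w x| <= dl.
  exact: (cvgrPdist_le _ _).1 (smooth_continuous sw dy) _ dl0.
have nd : nbhs y (cimg d) by apply: open_nbhs_nbhs; split=> //; exact: cimg_open.
have H := chart_cutoff_cvg Ac ce Ad dy su fu sN dl0.
apply: filterS2 (near_prod_fst (filterI nd nw)) H => -[x n] /= [dx wx] Hn sn.
have sp : smooth_on (cimg d) ((fun z => chart_cutoff c e n z * u z) \o cinv d).
  by apply: (smooth_realM sn su).
rewrite (_ : (fun z => chart_cutoff c e n z * u z + v z) \o cinv d =
  fun x => 1 * ((fun z => chart_cutoff c e n z * u z) \o cinv d) x + (v \o cinv d) x);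
  last by apply/funext => z /=; rewrite mul1r.
rewrite (partials_lin _ _ (@cimg_open _ _ _ d) dx sp (sv d Ad)) mul1r.
apply: (@le_lt_trans _ _ (dl + (dl + `|w y|))).
  apply: (le_trans (ler_normD _ _)); rewrite lerD // -/w.
  rewrite -[w x](subrK (w y)); apply: (le_trans (ler_normD _ _)).
  by rewrite lerD2r distrC.
by rewrite /dl; have := dl0; rewrite /dl; lra.
Qed.

End CutoffUniform.

(** * Real and imaginary parts *)

Section Scalars.
Variables (R : realType) (k : scalar_kind).
Local Notation K := (scalars R k).

(** The imaginary unit, or 0 in the real case, so that [scalar_decomp] covers
    both cases. *)
Definition scalar_I : K := match k return scalars R k with
  RealScalars => 0 | ComplexScalars => 'i%C end.

Lemma scalar_re_is_linear : (forall a (x y : K),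
  scalar_re (of_real k a * x + y) = a * scalar_re x + scalar_re y).
Proof.
move=> a x y; move: x y; rewrite /scalars /scalar_re /of_real; case: k => //= -[x x'] [y y'] /=.
by rewrite mul0r subr0.
Qed.

Lemma scalar_im_is_linear : (forall a (x y : K),
  scalar_im (of_real k a * x + y) = a * scalar_im x + scalar_im y).
Proof.
move=> a x y; move: x y; rewrite /scalars /scalar_im /of_real; case: k => /= [x y|[x x'] [y y'] /=].
  by rewrite mulr0 addr0.
by rewrite mul0r addr0.
Qed.

Lemma scalar_re_real a : @scalar_re R k (of_real k a) = a.
Proof. by rewrite /scalar_re /of_real; case: k. Qed.

Lemma scalar_im_real a : @scalar_im R k (of_real k a) = 0.
Proof. by rewrite /scalar_im /of_real; case: k. Qed.

Lemma of_real0 : of_real k (0 : R) = 0.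
Proof. by rewrite /of_real; case: k. Qed.

Lemma scalar_re0 : scalar_re (0 : K) = 0.
Proof. by rewrite -of_real0 scalar_re_real. Qed.

Lemma scalar_im0 : scalar_im (0 : K) = 0.
Proof. by rewrite -of_real0 scalar_im_real. Qed.

Lemma scalar_decomp (x : K) :
  x = of_real k (scalar_re x) + scalar_I * of_real k (scalar_im x).
Proof.
move: x; rewrite /scalars /scalar_I /scalar_re /scalar_im /of_real.
case: k => /= [x|[a b]]; first by rewrite mul0r addr0.
exact: complexE.
Qed.

Lemma of_real_nat n : of_real k n%:R = n%:R :> K.
Proof.
elim: n => [|n IHn]; first exact: of_real0.
by rewrite -addn1 !natrD of_realD IHn of_real1.
Qed.

Lemma of_realV (a : R) : of_real k a^-1 = (of_real k a)^-1.
Proof.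
rewrite /of_real /scalars; case: k => //=.
exact: fmorphV.
Qed.

Lemma norm_of_real (a : R) : `|of_real k a| = of_real k `|a|.
Proof.
rewrite /of_real /scalars; case: k => //=.
by rewrite normc_def /= expr0n /= addr0 sqrtr_sqr.
Qed.

Lemma of_real_lt (a b : R) : a < b -> of_real k a < of_real k b.
Proof. by rewrite /of_real /scalars; case: k => //=; rewrite ltcR. Qed.

Lemma scalar_gt0 (e : K) : 0 < e -> exists2 a : R, 0 < a & e = of_real k a.
Proof.
move: e; rewrite /scalars /of_real; case: k => /= [e e0|[a b]]; first by exists e.
rewrite ltcE /= => /andP[/eqP E a0]; exists a => //.
by apply/eqP; rewrite eq_complex /= E !eqxx.
Qed.

Lemma norm_scalar_I : `|scalar_I| <= 1.
Proof.
rewrite /scalar_I /scalars; case: k => /=; first by rewrite normr0.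
by rewrite normc_def /= expr0n /= add0r expr1n sqrtr1.
Qed.

End Scalars.

(** * Distributions at a point have finite order *)

Section FiniteOrder.
Variables (R : realType) (k : scalar_kind) (M : manifold R).
Local Notation K := (scalars R k).
Local Notation smoothK := (@smooth_fun R k M).

Lemma smooth_funP (f : M -> K) : f \in smoothK <->
  smooth_real (@scalar_re R k \o f) /\ smooth_real (@scalar_im R k \o f).
Proof.
split=> [/asboolP H|[H1 H2]].
  by split=> c Ac; have [] := H c Ac.
by apply/asboolP => c Ac; split; [exact: H1|exact: H2].
Qed.

Lemma Cinfty_smoothK (f : Cinfty k M) : (f : M -> K) \in smoothK.
Proof. exact: Cinfty_smooth. Qed.

(** A left inverse of the inclusion of smooth functions into all functions; it lets
    distributions act on plain functions. *)
Definition to_Cinfty (f : M -> K) : Cinfty k M := insubd (0 : Cinfty k M) f.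

Lemma to_CinftyE (f : M -> K) : f \in smoothK -> to_Cinfty f = f :> (M -> K).
Proof. by move=> sf; rewrite /to_Cinfty; exact: (@insubdK _ _ (Cinfty k M) 0 f sf). Qed.

Lemma to_CinftyK (f : Cinfty k M) : to_Cinfty f = f.
Proof. exact: valKd. Qed.

Lemma smooth_of_real (u : M -> R) : smooth_real u -> (of_real k \o u) \in smoothK.
Proof.
move=> su; apply/smooth_funP; split=> c Ac.
  apply: smooth_eq (su c Ac); first exact: cimg_open.
  by move=> x _ /=; rewrite scalar_re_real.
apply: smooth_eq (smooth_cst _ 0); first exact: cimg_open.
by move=> x _ /=; rewrite scalar_im_real.
Qed.

Lemma smooth_cstK (a : K) : (fun=> a) \in smoothK.
Proof. by apply/smooth_funP; split; exact: smooth_real_cst. Qed.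

Lemma smooth_linK (a : K) (f g : M -> K) : f \in smoothK -> g \in smoothK ->
  (fun x => a * f x + g x) \in smoothK.
Proof. by move=> sf sg; have [_ H] := @smooth_fun_submod R k M; exact: H. Qed.

Lemma smooth_mulK (f g : M -> K) : f \in smoothK -> g \in smoothK ->
  (fun x => f x * g x) \in smoothK.
Proof.
move=> /smooth_funP[rf jf] /smooth_funP[rg jg]; apply/smooth_funP; split.
  have := smooth_real_lin (-1) (smooth_realM jf jg) (smooth_realM rf rg).
  rewrite (_ : (fun _ => _) = @scalar_re R k \o (fun x => f x * g x)) //.
  by apply/funext => x /=; rewrite scalar_reM mulN1r addrC.
have := smooth_real_lin 1 (smooth_realM rf jg) (smooth_realM jf rg).
rewrite (_ : (fun _ => _) = @scalar_im R k \o (fun x => f x * g x)) //.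
by apply/funext => x /=; rewrite scalar_imM mul1r.
Qed.

Variable e : M.

(** Flatness at e, read in the chart c. By [flat_pullback] the chart does not
    matter. *)
Definition flatK (c : chart R (mdim M) M) N (f : M -> K) :=
  flat N (cfun c e) (@scalar_re R k \o f \o cinv c) /\
  flat N (cfun c e) (@scalar_im R k \o f \o cinv c).

Lemma flatK_scale (c : chart R (mdim M) M) N (a : K) f : atlas c -> cdom c e ->
  f \in smoothK -> flatK c N f -> flatK c N (fun x => a * f x).
Proof.
move=> Ac ce /smooth_funP[rf jf] [Rf If].
have oc := @cimg_open _ _ _ c; have pc := cfun_img ce.
have F b d : flat N (cfun c e)
   (fun x => b * (@scalar_re R k \o f \o cinv c) x +
             d * (@scalar_im R k \o f \o cinv c) x).
  apply: (flat_lin _ oc pc (rf c Ac) _ Rf).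
    by apply: smooth_mul; [exact: oc|exact: smooth_cst|exact: jf].
  apply: (flat_mull oc pc (smooth_cst _ _) (jf c Ac) If).
split.
  have := F (scalar_re a) (- scalar_im a); congr flat.
  by apply/funext => x /=; rewrite scalar_reM mulNr.
have := F (scalar_im a) (scalar_re a); congr flat.
by apply/funext => x /=; rewrite scalar_imM addrC.
Qed.

Definition subbasic (B : set (Cinfty k M)) :=
  exists f c L s d, [/\ atlas c, compact L, L `<=` cimg c, 0 < d &
                        B = Cinfty_nbhd f c L s d].

(** Neighbourhoods are given by finitely many conditions on derivatives on
    compact sets, which is where the finite order of distributions comes from.
    *)
Lemma Cinfty_nbhs_subbasic (f : Cinfty k M) (A : set (Cinfty k M)) : nbhs f A ->
  exists F : {fset (set (Cinfty k M))},
    (forall B, B \in F -> subbasic B /\ B f) /\ \bigcap_(B in [set` F]) B `<=` A.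
Proof.
rewrite nbhsE => -[B [[D sD EB] Bf] BA].
move: Bf; rewrite -EB => -[C DC Cf].
have [F sF EC] := sD _ DC.
exists F; split=> [U UF|g Fg].
  split; first by have /set_mem := sF U UF.
  by move: Cf; rewrite -EC => /(_ U); apply.
by apply: BA; rewrite -EB; exists C => //; rewrite -EC.
Qed.

Variable T : distr_at k e.

Lemma distr_props : [/\ scalar (T : Cinfty k M -> K), continuous (T : Cinfty k M -> K) &
  vanishes_on (T : Cinfty k M -> K) (~` [set e])].
Proof. by have /asboolP := distr_atP T. Qed.

(** The closure of the set where f and g differ does not contain e. *)
Lemma distr_local (f g : Cinfty k M) : (\forall x \near e, f x = g x) -> T f = T g.
Proof.
move=> fg; have [lT _ vT] := distr_props.
suff : T (f - g) = 0.
  have E := lT (-1) g f; rewrite scaleN1r mulN1r in E.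
  by rewrite [f - g]addrC E addrC => /eqP; rewrite subr_eq0 => /eqP.
apply: vT => x cx; apply: contrapT => /= /contrapT xe; subst x.
have [x [/= fgx fgx']] := cx _ fg.
have : f x - g x != 0 := fgx.
by rewrite fgx' subrr eqxx.
Qed.

(** The neighbourhood of 0 on which |T| < 1 involves finitely many derivatives,
    whose lengths give N. If f is flat of order N and T f is nonzero, then the
    cutoffs of f / T f have value 1 under T and eventually lie in this
    neighbourhood. *)
Lemma distr_finite_order (c : chart R (mdim M) M) : atlas c -> cdom c e ->
  exists N, forall f : Cinfty k M, flatK c N f -> T f = 0.
Proof.
move=> Ac ce; have [lT cT vT] := distr_props.
have T0 : T 0 = 0.
  by have := lT (-1) 0 0; rewrite scaleN1r oppr0 addr0 mulN1r addNr.
have nT : nbhs (0 : Cinfty k M) [set f | `|T f| < 1].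
  have := cT 0 [set x : K | `|x| < 1]; rewrite T0; apply.
  exact: (@nbhs0_lt K K^o).
have [F [HF FT]] := Cinfty_nbhs_subbasic nT.
have /choice[sz Hsz] (B : set (Cinfty k M)) : exists n, B \in F ->
    exists f d L s eps, [/\ [/\ atlas d, compact L, L `<=` cimg d & 0 < eps],
      B = @Cinfty_nbhd R k M f d L s eps & ((size s).*2 + 2 <= n)%N].
  have [BF|] := boolP (B \in F); last by exists 0%N.
  have [[f [d [L [s [eps [Ad cL Ld e0 E]]]]]] _] := HF B BF.
  by exists ((size s).*2 + 2)%N => _; exists f, d, L, s, eps.
(* The sum is merely a convenient upper bound of the orders needed. *)
exists (\sum_(B <- F) sz B)%N => f fN.
apply: contrapT => /eqP Tf0.
pose f' : M -> K := fun x => (T f)^-1 * f x.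
have sf' : f' \in smoothK.
  by apply: smooth_mulK; [exact: smooth_cstK|exact: Cinfty_smoothK].
have ff' : flatK c (\sum_(B <- F) sz B)%N f'.
  by apply: flatK_scale => //; exact: Cinfty_smoothK.
have [rf' jf'] := (smooth_funP f').1 sf'.
pose g n := to_Cinfty (fun x => of_real k (chart_cutoff c e n x) * f' x).
have cut : \forall n \near \oo, smooth_real (chart_cutoff c e n).
  exact: chart_cutoff_smooth.
have gE n : smooth_real (chart_cutoff c e n) ->
    g n = (fun x => of_real k (chart_cutoff c e n x) * f' x) :> (M -> K).
  by move=> sn; rewrite to_CinftyE //; apply: smooth_mulK => //; exact: smooth_of_real.
have gF : \forall n \near \oo, (\bigcap_(B in [set` F]) B) (g n).
  apply: filter_bigI => B BF.
  have [f0 [d [L [s [eps [[Ad cL Ld e0] EB sN]]]]]] := Hsz B BF.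
  have [_ B0] := HF B BF; rewrite EB /Cinfty_nbhd /= in B0.
  have {}sN : ((size s).*2 + 2 <= \sum_(B <- F) sz B)%N.
    by apply: (leq_trans sN); rewrite (big_rem B) //= leq_addr.
  have [rf0 jf0] := (smooth_funP (0 - f0 : Cinfty k M)).1 (Cinfty_smoothK _).
  have H1 := chart_cutoff_uniform Ac ce Ad cL Ld rf' rf0 ff'.1 sN
    (fun x Lx => (B0 x Lx).1).
  have H2 := chart_cutoff_uniform Ac ce Ad cL Ld jf' jf0 ff'.2 sN
    (fun x Lx => (B0 x Lx).2).
  apply: filterS3 cut H1 H2 => n sn H1 H2; rewrite EB => x Lx.
  have gf0 z : (g n - f0 : Cinfty k M) z =
      of_real k (chart_cutoff c e n z) * f' z + (0 - f0 : Cinfty k M) z.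
    by rewrite -[LHS]/(g n z - f0 z) gE // -[(0 - f0 : Cinfty k M) z]/(0 - f0 z) sub0r.
  have RH1 : (fun z => chart_cutoff c e n z * (@scalar_re R k \o f') z +
      (@scalar_re R k \o (0 - f0 : Cinfty k M)) z) =
      @scalar_re R k \o (g n - f0 : Cinfty k M).
    apply/funext => z; apply: esym.
    exact: (etrans (congr1 (@scalar_re R k) (gf0 _)) (scalar_re_is_linear _ _ _)).
  rewrite RH1 in H1.
  have RH2 : (fun z => chart_cutoff c e n z * (@scalar_im R k \o f') z +
      (@scalar_im R k \o (0 - f0 : Cinfty k M)) z) =
      @scalar_im R k \o (g n - f0 : Cinfty k M).
    apply/funext => z; apply: esym.
    exact: (etrans (congr1 (@scalar_im R k) (gf0 _)) (scalar_im_is_linear _ _ _)).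
  rewrite RH2 in H2.
  by split; [exact: H1|exact: H2].
have [n [sn /FT /= Tg]] := filter_ex (filterI cut gF).
suff : T (g n) = 1 by move=> E; move: Tg; rewrite E normr1 ltxx.
have -> : T (g n) = T ((T f)^-1 *: f).
  apply: distr_local; have := chart_cutoff_near n ce; apply: filterS => x E.
  by rewrite gE // E of_real1 mul1r.
have := lT (T f)^-1 f 0; rewrite addr0 T0 addr0 => ->.
by rewrite mulVf.
Qed.

End FiniteOrder.

(** * The basis of divided derivatives *)

Section PointFunctionals.
Variables (R : realType) (k : scalar_kind) (M : manifold R) (e : M).
Local Notation K := (scalars R k).
Local Notation smoothK := (@smooth_fun R k M).
Variable c : chart R (mdim M) M.
Hypotheses (Ac : atlas c) (ce : cdom c e).
Let p := cfun c e.
Let oc : open (cimg c) := @cimg_open _ _ _ c.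
Let pc : cimg c p := cfun_img ce.

Lemma scalar_eq (x y : K) : scalar_re x = scalar_re y -> scalar_im x = scalar_im y -> x = y.
Proof. by move=> E1 E2; rewrite (scalar_decomp x) (scalar_decomp y) E1 E2. Qed.

(** The iterated partial derivative of a K-valued function, taken on real and
    imaginary parts. *)
Definition partial_at (s : seq 'I_(mdim M)) (f : M -> K) : K :=
  of_real k (partials s (@scalar_re R k \o f \o cinv c) p) +
  scalar_I R k * of_real k (partials s (@scalar_im R k \o f \o cinv c) p).

Lemma partial_at_re s f :
  scalar_re (partial_at s f) = partials s (@scalar_re R k \o f \o cinv c) p.
Proof.
rewrite /partial_at /scalar_re /scalar_im /of_real /scalar_I /scalars.
move: f; case: k => f /=; first by rewrite mul0r addr0.
by rewrite !mul0r mulr0 subr0 addr0.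
Qed.

Lemma partial_at_im s f :
  scalar_im (partial_at s f) = partials s (@scalar_im R k \o f \o cinv c) p.
Proof.
rewrite /partial_at /scalar_re /scalar_im /of_real /scalar_I /scalars.
move: f; case: k => f /=.
  by rewrite (_ : _ \o _ = fun=> 0) ?partials_cst0.
by rewrite !mul0r mul1r !add0r.
Qed.

Lemma partials_lin2 s a b (u v w : M -> R) : smooth_real u -> smooth_real v -> smooth_real w ->
  partials s ((fun x => a * u x + (b * v x + w x)) \o cinv c) p =
  a * partials s (u \o cinv c) p + (b * partials s (v \o cinv c) p + partials s (w \o cinv c) p).
Proof.
move=> su sv sw; rewrite -(partials_lin s b oc pc (sv c Ac) (sw c Ac)).
rewrite -(partials_lin s a oc pc (su c Ac)) //.
exact: (smooth_lin b oc (sv c Ac) (sw c Ac)).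
Qed.

Lemma partial_at_lin s a f g : f \in smoothK -> g \in smoothK ->
  partial_at s (fun x => a * f x + g x) = a * partial_at s f + partial_at s g.
Proof.
move=> /smooth_funP[rf jf] /smooth_funP[rg jg].
apply: scalar_eq.
  rewrite partial_at_re scalar_reD scalar_reM !partial_at_re partial_at_im.
  rewrite (_ : _ \o _ \o _ = (fun x => scalar_re a * (@scalar_re R k \o f) x +
    (- scalar_im a * (@scalar_im R k \o f) x + (@scalar_re R k \o g) x)) \o cinv c); last first.
    by apply/funext => x /=; rewrite scalar_reD scalar_reM mulNr addrA.
  by rewrite partials_lin2 // mulNr addrA.
rewrite partial_at_im scalar_imD scalar_imM partial_at_re !partial_at_im.
rewrite (_ : _ \o _ \o _ = (fun x => scalar_re a * (@scalar_im R k \o f) x +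
    (scalar_im a * (@scalar_re R k \o f) x + (@scalar_im R k \o g) x)) \o cinv c); last first.
  by apply/funext => x /=; rewrite scalar_imD scalar_imM addrA.
by rewrite partials_lin2 // addrA.
Qed.

Lemma near_chart (P : set M) : nbhs e P -> \forall x \near p, P (cinv c x).
Proof. by move=> nP; apply: (cinv_continuous pc); rewrite /= cfunK. Qed.

Lemma partial_at_near s f g : (\forall x \near e, f x = g x) ->
  partial_at s f = partial_at s g.
Proof.
move=> fg; have H := near_chart fg.
have E (q : K -> R) : partials s (q \o f \o cinv c) p = partials s (q \o g \o cinv c) p.
  apply: (nbhs_singleton (near_partials s _)).
  by apply: filterS H => x /= ->.
by rewrite /partial_at !E.
Qed.

Lemma subbasic_nbhs (B : set (Cinfty k M)) f : subbasic B -> B f -> nbhs f B.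
Proof.
move=> sB Bf; apply: open_nbhs_nbhs; split=> //.
exists [set B] => [_ ->|]; last by rewrite bigcup_set1.
exists [fset B]%fset; first by move=> C; rewrite inE => /eqP ->; exact: mem_set.
by rewrite set_fset1 bigcap_set1.
Qed.

(** Continuity: the derivative along s at p is controlled by one subbasic
    neighbourhood, with the compact set {p}. *)
Lemma partial_at_distribution s :
  (fun f : Cinfty k M => partial_at s f) \in @point_distribution R k M e.
Proof.
apply/asboolP; split.
- by move=> a f g; exact: (partial_at_lin s a (Cinfty_smoothK f) (Cinfty_smoothK g)).
- move=> f; apply/(@cvgrPdist_lt K K^o _ _ (nbhs_filter f)) => eps e0.
  have [d d0 ->] := scalar_gt0 e0.
  pose B := Cinfty_nbhd f c [set p] s (d / 2).
  have d2 : 0 < d / 2 by rewrite divr_gt0.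
  have sB : subbasic B.
    exists f, c, [set p], s, (d / 2); split=> //; first exact: compact_set1.
    by move=> _ ->.
  have Bf : B f.
    move=> _ ->; rewrite subrr.
    have E (q : K -> R) : q 0 = 0 ->
        partials s (q \o (0 : Cinfty k M) \o cinv c) p = 0.
      by move=> q0; rewrite (_ : _ \o _ \o _ = fun=> 0) ?partials_cst0 //; apply/funext => x.
    by rewrite !E ?normr0 ?scalar_re0 ?scalar_im0.
  apply: filterS (subbasic_nbhs sB Bf) => g Bg /=.
  have [Hr Hj] := Bg p erefl.
  have -> : partial_at s f - partial_at s g = - partial_at s (g - f : Cinfty k M).
    have := partial_at_lin s (-1) (Cinfty_smoothK f) (Cinfty_smoothK g).
    rewrite mulN1r => E; rewrite -[LHS]opprB; congr (- _).
    rewrite addrC -E; congr partial_at; apply/funext => x.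
    by rewrite mulN1r addrC.
  rewrite normrN /partial_at; apply: le_lt_trans (ler_normD _ _) _.
  rewrite [d]splitr of_realD; apply: ltr_leD.
    by rewrite norm_of_real; exact: of_real_lt.
  rewrite normrM norm_of_real; apply: (@le_trans _ _ (1 * of_real k (d / 2))); last by rewrite mul1r.
  apply: ler_pM => //; [|exact: norm_scalar_I|exact/ltW/of_real_lt].
  by rewrite -norm_of_real.
move=> f ef; rewrite (@partial_at_near s _ (fun=> 0)).
  have := partial_at_lin s (-1) (smooth_cstK M 0) (smooth_cstK M 0).
  by rewrite (_ : -1 * 0 + 0 = 0 :> K) ?mulr0 ?addr0 // mulN1r addNr.
have : ~ closure [set x | f x != 0] e by move=> /ef; apply.
move=> /existsNP[B /not_implyP[nB H]]; apply: filterS nB => x Bx.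
by apply: contrapT => /eqP fx; apply: H; exists x.
Qed.

Definition partial_distr s : distr_at k e := MkDistrAt (partial_at_distribution s).

(** The divided derivative (1/a!) d^a at e. *)
Definition basis_distr (a : multi_index (mdim M)) : distr_at k e :=
  (ifact a)%:R^-1 *: partial_distr (word a).

Lemma basis_distrE a (f : Cinfty k M) :
  basis_distr a f = (ifact a)%:R^-1 * partial_at (word a) f.
Proof. by []. Qed.

Lemma partial_at_of_real s (h : 'rV[R]_(mdim M) -> R) :
  partial_at s (fun y => of_real k (h (cfun c y))) = of_real k (partials s h p).
Proof.
have E (q : K -> R) (g : R -> R) : (forall x, q (of_real k x) = g x) ->
    partials s (q \o (fun y => of_real k (h (cfun c y))) \o cinv c) p =
    partials s (g \o h) p.
  move=> H; apply: (partials_eq_on s oc) pc => x cx /=.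
  by rewrite H cinvK.
rewrite /partial_at (E _ id) ?(E _ (fun=> 0)); last first.
- exact: scalar_re_real.
- exact: scalar_im_real.
by rewrite (_ : (fun=> 0) \o h = fun=> 0) // partials_cst0 of_real0 mulr0 addr0.
Qed.

(** The monomials are defined on the chart only; their germs at e extend. *)
Lemma monomial_function_exists a : exists f : Cinfty k M,
  \forall y \near e, f y = of_real k (monomial p a (cfun c y)).
Proof.
have [u su eu] := chart_extension Ac ce (smooth_monomial p a oc).
exists (to_Cinfty (of_real k \o u)).
by rewrite to_CinftyE; [apply: filterS eu => y /= ->|exact: smooth_of_real].
Qed.

Definition monomial_function a : Cinfty k M := sval (cid (monomial_function_exists a)).

Lemma monomial_functionE a :
  \forall y \near e, monomial_function a y = of_real k (monomial p a (cfun c y)).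
Proof. exact: (svalP (cid (monomial_function_exists a))). Qed.

Lemma basis_distr_local a (f : Cinfty k M) (h : 'rV[R]_(mdim M) -> R) :
  (\forall y \near e, f y = of_real k (h (cfun c y))) ->
  basis_distr a f = of_real k (taylor_coef p a h).
Proof.
move=> H; rewrite basis_distrE (partial_at_near _ H) partial_at_of_real.
by rewrite /taylor_coef of_realM of_realV of_real_nat.
Qed.

Lemma basis_distr_monomial a b : basis_distr a (monomial_function b) = (a == b)%:R.
Proof.
by rewrite (basis_distr_local a (monomial_functionE b)) taylor_coef_monomial of_real_nat.
Qed.

Lemma Cinfty_sumE I (r : seq I) (F : I -> Cinfty k M) x :
  (\sum_(i <- r) F i : Cinfty k M) x = \sum_(i <- r) F i x.
Proof.
elim: r => [|i r IH]; first by rewrite !big_nil.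
by rewrite !big_cons -IH.
Qed.

Lemma distr_sumE I (r : seq I) (F : I -> distr_at k e) (f : Cinfty k M) :
  (\sum_(i <- r) F i : distr_at k e) f = \sum_(i <- r) F i f.
Proof.
elim: r => [|i r IH]; first by rewrite !big_nil.
by rewrite !big_cons -IH.
Qed.

Lemma scalar_re_basis_distr a (f : Cinfty k M) :
  scalar_re (basis_distr a f) = taylor_coef p a (@scalar_re R k \o f \o cinv c).
Proof.
rewrite basis_distrE -of_real_nat -of_realV scalar_reM scalar_re_real scalar_im_real.
by rewrite mul0r subr0 partial_at_re.
Qed.

Lemma scalar_im_basis_distr a (f : Cinfty k M) :
  scalar_im (basis_distr a f) = taylor_coef p a (@scalar_im R k \o f \o cinv c).
Proof.
rewrite basis_distrE -of_real_nat -of_realV scalar_imM scalar_re_real scalar_im_real.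
by rewrite mul0r addr0 partial_at_im.
Qed.

(** The Taylor formula, for the global functions that represent the monomials
    near e. *)
Lemma taylor_flatK N (f : Cinfty k M) :
  flatK e c N (f - \sum_(a <- box (mdim M) N) basis_distr a f *: monomial_function a : Cinfty k M).
Proof.
have /smooth_funP[rf jf] := Cinfty_smoothK f.
have nm : \forall y \near e, forall a, a \in box (mdim M) N ->
    monomial_function a y = of_real k (monomial p a (cfun c y)).
  elim: (box _ _) => [|a s IH]; first by apply: filterE.
  apply: filterS2 (monomial_functionE a) IH => y H1 H2 b.
  by rewrite inE => /orP[/eqP ->//|]; exact: H2.
have nx := near_chart nm.
have ox : \forall x \near p, cimg c x by apply: open_nbhs_nbhs.
have G (q : K -> R) : (forall a x y, q (of_real k a * x + y) = a * q x + q y) ->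
    smooth_real (q \o f) ->
    (forall a, q (basis_distr a f) = taylor_coef p a (q \o f \o cinv c)) ->
    flat N p (q \o (f - \sum_(a <- box (mdim M) N) basis_distr a f *: monomial_function a : Cinfty k M) \o cinv c).
  move=> lq sq qE; apply: flat_near (taylor_flat N oc pc (sq c Ac)).
  apply: filterS2 nx ox => x H cx.
  set g := \sum_(a <- _) basis_distr a f *: _.
  rewrite -[RHS]/(q ((f - g : Cinfty k M) (cinv c x))).
  have -> : q ((f - g : Cinfty k M) (cinv c x)) = q (of_real k (-1) * g (cinv c x) + f (cinv c x)).
    congr q; rewrite addrC -[-1]/(- 1%:R) -[1]/(1%:R).
    have -> : of_real k (- 1%:R) = -1 :> K.
      by apply/eqP; rewrite -addr_eq0 -[1 in X in _ + X](@of_real1 R k) -of_realD addNr of_real0.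
    by rewrite mulN1r.
  rewrite lq mulN1r [RHS]addrC; congr (_ - _).
  rewrite /g Cinfty_sumE.
  have q0 : q 0 = 0 by have := lq (-1) 0 0; rewrite mulr0 addr0 mulN1r addNr.
  have qs (F : multi_index (mdim M) -> K) (r : multi_index (mdim M) -> R) t : 
      (forall a, a \in box (mdim M) N -> F a = of_real k (r a) * basis_distr a f) ->
      {subset t <= box (mdim M) N} ->
      q (\sum_(a <- t) F a) = \sum_(a <- t) taylor_coef p a (q \o f \o cinv c) * r a.
    move=> HF; elim: t => [|a t IH] st; first by rewrite !big_nil.
    rewrite !big_cons HF ?st ?mem_head // lq IH; last first.
      by move=> b bt; apply: st; rewrite inE bt orbT.
    by rewrite qE mulrC.
  rewrite (qs _ (fun a => monomial p a x)) // => a ab.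
  rewrite -[LHS]/(basis_distr a f * monomial_function a (cinv c x)).
  by rewrite H // cinvK // mulrC.
split; apply: G => //.
- exact: scalar_re_is_linear.
- by move=> a; exact: scalar_re_basis_distr.
- exact: scalar_im_is_linear.
- by move=> a; exact: scalar_im_basis_distr.
Qed.

(** A functional of finite order only sees the Taylor polynomial. *)
Lemma taylor_functional (L : Cinfty k M -> K) N n (f : Cinfty k M) : scalar L ->
  (forall g : Cinfty k M, flatK e c N g -> L g = 0) -> (N <= n)%N ->
  L f = \sum_(a <- box (mdim M) n) basis_distr a f * L (monomial_function a).
Proof.
move=> lL LN Nn; apply/eqP; rewrite -subr_eq0; apply/eqP.
rewrite -[RHS](LN (f - \sum_(a <- box (mdim M) n) basis_distr a f *: monomial_function a)).
  by rewrite (scalar_B lL) (scalar_sums lL); congr (_ - _); apply: eq_bigr => a _; rewrite (scalar_Z lL).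
by have [H1 H2] := taylor_flatK n f; split; exact: flat_le Nn _.
Qed.

Lemma distr_scalar (T : distr_at k e) : scalar (T : Cinfty k M -> K).
Proof. by have [] := distr_props T. Qed.

Definition basis_coord a (T : distr_at k e) : K := T (monomial_function a).

(** Finite order bounds the support of the expansion of T by
    [taylor_functional]. *)
Theorem dual_basis_distr : dual_basis basis_distr basis_coord.
Proof.
split=> // [a b|T]; first by rewrite /basis_coord basis_distr_monomial eq_sym.
have [N TN] := distr_finite_order T Ac ce.
exists (box (mdim M) N); first exact: uniq_box.
apply/val_inj/funext => f.
rewrite [LHS](@taylor_functional T N N f (distr_scalar T) TN) //.
by rewrite [RHS]distr_sumE; apply: eq_bigr => a _; rewrite mulrC.
Qed.

(** Such a functional is a finite combination of divided derivatives, which are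
    distributions. *)
Theorem finite_order_distribution (L : Cinfty k M -> K) N : scalar L ->
  (forall g : Cinfty k M, flatK e c N g -> L g = 0) -> (L : Cinfty k M -> K^o) \in @point_distribution R k M e.
Proof.
move=> lL LN.
rewrite (_ : L = \sum_(a <- box (mdim M) N) L (monomial_function a) *: basis_distr a).
  exact: distr_atP.
apply/funext => f; rewrite (taylor_functional f lL LN (leqnn N)) distr_sumE.
by apply: eq_bigr => a _; rewrite mulrC.
Qed.

End PointFunctionals.

(** * Smooth maps and products of manifolds *)

Section SmoothMaps.
Variable R : realType.
Implicit Types M N P : manifold R.

(** Locally the composite factors through a chart at the intermediate point. *)
Lemma smooth_map_comp M N P (phi : M -> N) (psi : N -> P) :
  smooth_map phi -> smooth_map psi -> smooth_map (psi \o phi).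
Proof.
move=> [cphi sphi] [cpsi spsi].
have cc : continuous (psi \o phi).
  by move=> x; apply: continuous_comp; [exact: cphi|exact: cpsi].
split=> // c d Ac Ad j; apply: smooth_local => x [cx dx].
have [b Ab bx] := atlas_cover (phi (cinv c x)).
pose W := cimg c `&` (phi \o cinv c) @^-1` (cdom b `&` psi @^-1` cdom d).
have oV : open (cdom b `&` psi @^-1` cdom d).
  apply: openI; first exact: cdom_open.
  by apply: open_comp; [move=> y _; exact: cpsi|exact: cdom_open].
have oW : open W by exact: open_map_preimage.
exists W; first by split.
have sW : smooth_map_on W (cfun b \o phi \o cinv c).
  by move=> i; apply: smooth_sub (sphi c b Ac Ab i) => y [cy [by_ _]].
have oB := @open_map_preimage _ _ _ _ b _ cpsi (@cdom_open _ _ _ d).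
have WB y : W y -> (cimg b `&` (psi \o cinv b) @^-1` cdom d)
    ((cfun b \o phi \o cinv c) y).
  by move=> [_ [by_ dy]]; split; [exact: cfun_img|rewrite /= cfunK].
apply: smooth_eq (smooth_comp oW oB WB sW (spsi b d Ab Ad j)) => //.
by move=> y [_ [by_ _]] /=; rewrite cfunK.
Qed.

Lemma smooth_map_cst M N (z : N) : smooth_map (fun=> z : N) (M := M).
Proof.
split=> [|c d _ _ j]; first by move=> x; exact: cvg_cst.
exact: smooth_cst.
Qed.

Lemma smooth_map_fst M N : smooth_map (fst : prod_manifold M N -> M).
Proof.
split=> [x|_ d [c [c' [Ac Ac' ->]]] Ad j]; first exact: cvg_fst.
pose U := cimg (prod_chart c c') `&` (fst \o cinv (prod_chart c c')) @^-1` cdom d.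
have oU : open U.
  by apply: (@open_map_preimage R (prod_manifold M N) M fst (prod_chart c c')) => [x|];
    [exact: cvg_fst|exact: cdom_open].
have oV : open (cimg c `&` cinv c @^-1` cdom d).
  by apply: open_chart_preimage; exact: cdom_open.
apply: (@smooth_comp _ _ _ U _ (fun x => (cfun d \o cinv c) x 0 j) lsubmx oU oV).
- by move=> z [[cz _] dz]; split.
- move=> i; under [X in smooth_on _ X]funext => x do rewrite mxE.
  exact: smooth_coord.
- exact: atlas_compat.
Qed.

Lemma smooth_map_snd M N : smooth_map (snd : prod_manifold M N -> N).
Proof.
split=> [x|_ d [c [c' [Ac Ac' ->]]] Ad j]; first exact: cvg_snd.
pose U := cimg (prod_chart c c') `&` (snd \o cinv (prod_chart c c')) @^-1` cdom d.
have oU : open U.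
  by apply: (@open_map_preimage R (prod_manifold M N) N snd (prod_chart c c')) => [x|];
    [exact: cvg_snd|exact: cdom_open].
have oV : open (cimg c' `&` cinv c' @^-1` cdom d).
  by apply: open_chart_preimage; exact: cdom_open.
apply: (@smooth_comp _ _ _ U _ (fun x => (cfun d \o cinv c') x 0 j) rsubmx oU oV).
- by move=> z [[_ cz] dz]; split.
- move=> i; under [X in smooth_on _ X]funext => x do rewrite mxE.
  exact: smooth_coord.
- exact: atlas_compat.
Qed.

Lemma smooth_map_pair P M N (phi : P -> M) (psi : P -> N) :
  smooth_map phi -> smooth_map psi ->
  smooth_map (fun z => (phi z, psi z) : prod_manifold M N).
Proof.
move=> [cphi sphi] [cpsi spsi]; split=> [x|c _ Ac [d [d' [Ad Ad' ->]]] j].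
  exact: (cvg_pair (cphi x) (cpsi x)).
rewrite -[j]fintype.splitK; case: (fintype.split j) => i /=.
  under [X in smooth_on _ X]funext => x do rewrite row_mxEl.
  by apply: smooth_sub (sphi c d Ac Ad i) => x [cx [/= dx _]].
under [X in smooth_on _ X]funext => x do rewrite row_mxEr.
by apply: smooth_sub (spsi c d' Ac Ad' i) => x [cx [/= _ dx]].
Qed.

End SmoothMaps.

(** * Evaluation and push-forward of distributions *)

Section Distributions.
Variables (R : realType) (k : scalar_kind).
Local Notation K := (scalars R k).
Local Notation "'E'' M" := (distr_at k (base M)) (at level 10, M at level 9).
Local Notation smoothK M := (@smooth_fun R k M).

Section OneManifold.
Variable M : pmanifold R.
Implicit Types (T : E' M) (f g : M -> K).

(** A chart at the base point is fixed once and for all; it is the one in which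
    tangent vectors are read. *)
Definition base_chart : chart R (mdim M) M := sval (preferred_chart M).
Lemma base_chart_atlas : atlas base_chart.
Proof. by case: (svalP (preferred_chart M)). Qed.
Lemma base_chart_dom : cdom base_chart (base M).
Proof. by case: (svalP (preferred_chart M)). Qed.

Lemma dapplyE T f : dapply T f = T (to_Cinfty f).
Proof. by []. Qed.

Lemma dapply_Cinfty T (f : Cinfty k M) : dapply T f = T f.
Proof. by rewrite dapplyE to_CinftyK. Qed.

Lemma dapply_local T f g : f \in smoothK M -> g \in smoothK M ->
  (\forall x \near base M, f x = g x) -> dapply T f = dapply T g.
Proof.
move=> sf sg fg; rewrite !dapplyE; apply: distr_local.
by apply: filterS fg => x; rewrite !to_CinftyE.
Qed.

Lemma dapply_lin T a f g : f \in smoothK M -> g \in smoothK M ->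
  dapply T (fun x => a * f x + g x) = a * dapply T f + dapply T g.
Proof.
move=> sf sg; rewrite !dapplyE -(distr_scalar T); congr (T _); apply/val_inj/funext => x.
rewrite [LHS](congr1 (fun h => h x) (to_CinftyE (smooth_linK a sf sg))).
by rewrite -[RHS]/(a * to_Cinfty f x + to_Cinfty g x) !to_CinftyE.
Qed.

Lemma dapply_scale T a f : f \in smoothK M ->
  dapply T (fun x => a * f x) = a * dapply T f.
Proof.
move=> sf; have s0 := smooth_cstK (k := k) M 0.
have T0 : dapply T (fun=> 0) = 0.
  have := dapply_lin T (-1) s0 s0.
  by rewrite (_ : -1 * 0 + 0 = 0 :> K) ?mulr0 ?addr0 // mulN1r addNr.
rewrite -[RHS]addr0 -T0 -dapply_lin //; congr dapply.
by apply/funext => x; rewrite addr0.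
Qed.

Lemma dapply_order T (c : chart R (mdim M) M) : atlas c -> cdom c (base M) ->
  exists N, forall f, f \in smoothK M -> flatK (base M) c N f -> dapply T f = 0.
Proof.
move=> Ac ce; have [N TN] := distr_finite_order T Ac ce.
exists N => f sf ff; rewrite dapplyE; apply: TN.
by rewrite to_CinftyE.
Qed.

(** The junk value of [to_distribution] does not occur for functionals of finite
    order. *)
Lemma to_distributionE (L : Cinfty k M -> K) (c : chart R (mdim M) M) N :
  atlas c -> cdom c (base M) -> scalar L ->
  (forall f : Cinfty k M, flatK (base M) c N f -> L f = 0) ->
  to_distribution L = L :> (Cinfty k M -> K).
Proof.
move=> Ac ce lL LN; rewrite /to_distribution.
exact: (insubdK _ (finite_order_distribution Ac ce lL LN)).
Qed.

Lemma distr_ext (T U : E' M) : (forall f : Cinfty k M, T f = U f) -> T = U.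
Proof. by move=> H; apply/val_inj/funext. Qed.

Lemma dirac_deltaE (f : Cinfty k M) : dirac_delta k M f = f (base M).
Proof.
rewrite /dirac_delta (@to_distributionE _ base_chart 1) //.
- exact: base_chart_atlas.
- exact: base_chart_dom.
move=> g [[r0 _] [j0 _]].
move: r0 j0; rewrite /= (cfunK base_chart_dom) => r0 j0.
by apply: scalar_eq; rewrite ?scalar_re0 ?scalar_im0.
Qed.

Lemma dapply_dirac f : f \in smoothK M -> dapply (dirac_delta k M) f = f (base M).
Proof. by move=> sf; rewrite dapplyE dirac_deltaE to_CinftyE. Qed.

Lemma flatK_add (c : chart R (mdim M) M) N f g : atlas c -> cdom c (base M) ->
  f \in smoothK M -> g \in smoothK M -> flatK (base M) c N f -> flatK (base M) c N g ->
  flatK (base M) c N (fun x => f x + g x).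
Proof.
move=> Ac ce /smooth_funP[rf jf] /smooth_funP[rg jg] [fr fj] [gr gj].
have oc := @cimg_open _ _ _ c; have pc := cfun_img ce.
split.
  have := flat_add oc pc (rf c Ac) (rg c Ac) fr gr; congr flat.
  by apply/funext => x /=; rewrite scalar_reD.
have := flat_add oc pc (jf c Ac) (jg c Ac) fj gj; congr flat.
by apply/funext => x /=; rewrite scalar_imD.
Qed.

Lemma smooth_sumK I (r : seq I) (F : I -> M -> K) : (forall i, F i \in smoothK M) ->
  (fun x => \sum_(i <- r) F i x) \in smoothK M.
Proof.
move=> sF; elim: r => [|i r IH].
  by under [X in X \in _]funext => x do rewrite big_nil; exact: smooth_cstK.
under [X in X \in _]funext => x do rewrite big_cons -[F i x]mul1r.
exact: smooth_linK.
Qed.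

Lemma flatK_sum (c : chart R (mdim M) M) N (I : eqType) (r : seq I) (F : I -> M -> K) :
  atlas c -> cdom c (base M) -> (forall i, F i \in smoothK M) ->
  (forall i, i \in r -> flatK (base M) c N (F i)) ->
  flatK (base M) c N (fun x => \sum_(i <- r) F i x).
Proof.
move=> Ac ce sF; elim: r => [|i r IH] fF.
  under [X in flatK _ _ _ X]funext => x do rewrite big_nil.
  split.
    rewrite (_ : _ \o _ \o _ = fun=> 0); first exact: flat_cst0.
    by apply/funext => x /=; rewrite scalar_re0.
  rewrite (_ : _ \o _ \o _ = fun=> 0); first exact: flat_cst0.
  by apply/funext => x /=; rewrite scalar_im0.
under [X in flatK _ _ _ X]funext => x do rewrite big_cons.
apply: flatK_add => //; first exact: smooth_sumK.
  exact: fF (mem_head _ _).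
by apply: IH => j jr; apply: fF; rewrite inE jr orbT.
Qed.

End OneManifold.

Lemma smooth_compK (M N : manifold R) (phi : M -> N) (f : N -> K) : smooth_map phi ->
  f \in smoothK N -> (f \o phi) \in smoothK M.
Proof.
move=> sphi /smooth_funP[rf jf]; apply/smooth_funP; split.
  exact: (smooth_real_comp sphi rf).
exact: (smooth_real_comp sphi jf).
Qed.

(** The composite with phi of a function flat at the image of the base point is
    flat, so the functional has finite order. *)
Lemma dist_push_apply (M N : pmanifold R) (phi : M -> N) (T : E' M) (f : Cinfty k N) :
  pointed_map phi -> dist_push phi T f = dapply T (f \o phi).
Proof.
move=> [sphi phie]; rewrite /dist_push.
have [n Tn] := dapply_order T (base_chart_atlas M) (base_chart_dom M).
rewrite (@to_distributionE _ _ (base_chart N) n) //.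
- exact: base_chart_atlas.
- exact: base_chart_dom.
- move=> a g h; have sg := smooth_compK sphi (Cinfty_smoothK g).
  exact: (dapply_lin T a sg (smooth_compK sphi (Cinfty_smoothK h))).
move=> g [gr gj]; have sg := Cinfty_smoothK g.
apply: Tn; first exact: smooth_compK.
have [rg jg] := (smooth_funP _).1 sg.
have := base_chart_dom N; rewrite -phie => ce'.
split.
  apply: (flat_pullback sphi rg (base_chart_atlas M) (base_chart_atlas N) (base_chart_dom M) ce').
  by rewrite phie.
apply: (flat_pullback sphi jg (base_chart_atlas M) (base_chart_atlas N) (base_chart_dom M) ce').
by rewrite phie.
Qed.

Lemma dapply_push (M N : pmanifold R) (phi : M -> N) (T : E' M) (f : N -> K) :
  pointed_map phi -> f \in smoothK N -> dapply (dist_push phi T) f = dapply T (f \o phi).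
Proof.
by move=> phiP sf; rewrite dapplyE dist_push_apply // to_CinftyE.
Qed.

Lemma dist_push_linear (M N : pmanifold R) (phi : M -> N) : pointed_map phi ->
  linear (@dist_push R k M N phi).
Proof.
move=> phiP a S T; apply: distr_ext => f; rewrite dist_push_apply //.
by rewrite -[RHS]/(a * dist_push phi S f + dist_push phi T f) !dist_push_apply.
Qed.

End Distributions.

(** * The product of two distributions *)

Section Slices.
Variable R : realType.
Local Notation "''e_' i" := (delta_mx 0 i) (at level 8, i at level 2, format "''e_' i").

(** The difference quotients of a slice are among those of the function. *)
Lemma partials_slice_r m n (F : 'rV[R]_(m + n) -> R) w s z :
  partials s (fun z => F (row_mx w z)) z =
  partials (map (@rshift m n) s) F (row_mx w z).
Proof.
elim: s z => [|j s IH] z //=.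
set G := partials s _; set H := partials _ F.
have GE y : G y = H (row_mx w y) by exact: IH.
have E (t : R) : row_mx w (t *: 'e_j + z) = t *: 'e_(rshift m j) + row_mx w z.
  by rewrite delta_mx_rshift scale_row_mx scaler0 add_row_mx add0r.
have DL : (fun t : R => t^-1 *: ((G \o shift z) (t *: 'e_j) - G z)) =
    (fun t : R => t^-1 *: ((H \o shift (row_mx w z)) (t *: 'e_(rshift m j)) - H (row_mx w z))).
  by apply/funext => t /=; rewrite !GE E.
by rewrite /derive DL.
Qed.

Lemma partials_slice_l m n (F : 'rV[R]_(m + n) -> R) z s w :
  partials s (fun w => F (row_mx w z)) w =
  partials (map (@lshift m n) s) F (row_mx w z).
Proof.
elim: s w => [|j s IH] w //=.
set G := partials s _; set H := partials _ F.
have GE y : G y = H (row_mx y z) by exact: IH.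
have E (t : R) : row_mx (t *: 'e_j + w) z = t *: 'e_(lshift n j) + row_mx w z.
  by rewrite delta_mx_lshift scale_row_mx scaler0 add_row_mx add0r.
have DL : (fun t : R => t^-1 *: ((G \o shift w) (t *: 'e_j) - G w)) =
    (fun t : R => t^-1 *: ((H \o shift (row_mx w z)) (t *: 'e_(lshift n j)) - H (row_mx w z))).
  by apply/funext => t /=; rewrite !GE E.
by rewrite /derive DL.
Qed.

Lemma smooth_map_row_mx m n (U : set 'rV[R]_m) (z : 'rV[R]_n) :
  smooth_map_on U (fun w => row_mx w z).
Proof.
move=> j; rewrite -[j]fintype.splitK; case: (fintype.split j) => i /=.
  under [X in smooth_on _ X]funext => x do rewrite row_mxEl.
  exact: smooth_coord.
under [X in smooth_on _ X]funext => x do rewrite row_mxEr.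
exact: smooth_cst.
Qed.

(** In product charts this is a partial derivative of u, restricted to an affine
    subspace. *)
Lemma smooth_partial_slice (M N : manifold R) (d : chart R (mdim N) N) y s
    (u : prod_manifold M N -> R) : atlas d -> cdom d y -> smooth_real u ->
  smooth_real (fun x => partials s (fun z => u (x, cinv d z)) (cfun d y)).
Proof.
move=> Ad dy su c Ac.
set q := cfun d y; have qd : cimg d q by exact: cfun_img.
pose F := u \o cinv (prod_chart c d).
have Apd : atlas (prod_chart c d : chart R (mdim (prod_manifold M N)) (prod_manifold M N)).
  by exists c, d.
rewrite (_ : _ \o _ = (partials (map (@rshift _ _) s) F) \o (fun w => row_mx w q)); last first.
  apply/funext => w /=; rewrite -partials_slice_r; congr (partials s _ q).
  by apply/funext => z; rewrite /F /= row_mxKl row_mxKr.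
apply: (smooth_comp (@cimg_open _ _ _ c) (@cimg_open _ _ _ (prod_chart c d))).
- by move=> w cw; rewrite /= row_mxKl row_mxKr.
- exact: smooth_map_row_mx.
- by apply: smooth_partials; exact: su.
Qed.

(** The derivatives of the slice are derivatives of u at the base point, of
    order increased by the length of s. *)
Lemma flat_partial_slice (M N : manifold R) (c : chart R (mdim M) M)
    (d : chart R (mdim N) N) x y n s (u : prod_manifold M N -> R) :
  flat (n + size s) (cfun (prod_chart c d) (x, y)) (u \o cinv (prod_chart c d)) ->
  flat n (cfun c x) ((fun x => partials s (fun z => u (x, cinv d z)) (cfun d y)) \o cinv c).
Proof.
move=> /flatP fu; apply/flatP => t tn.
pose F := u \o cinv (prod_chart c d).
rewrite (_ : _ \o _ = fun w => (partials (map (@rshift _ _) s) F) (row_mx w (cfun d y))); last first.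
  apply/funext => w /=; rewrite -partials_slice_r; congr (partials s _ _).
  by apply/funext => z; rewrite /F /= row_mxKl row_mxKr.
rewrite partials_slice_l -partials_cat.
apply: fu; rewrite size_cat !size_map.
by rewrite ltn_add2r.
Qed.

End Slices.

Section ProductDistributions.
Variables (R : realType) (k : scalar_kind).
Local Notation K := (scalars R k).
Local Notation "'E'' M" := (distr_at k (base M)) (at level 10, M at level 9).
Local Notation smoothK M := (@smooth_fun R k M).
Variables (M N : pmanifold R).
Local Notation P := (prod_pmanifold M N).
Implicit Types (S : E' M) (T : E' N).
Let d := base_chart N.
Let Ad := base_chart_atlas N.
Let dN := base_chart_dom N.

Lemma smooth_slice (f : P -> K) x : f \in smoothK P -> (fun y => f (x, y)) \in smoothK N.
Proof.
move=> sf; apply: (@smooth_compK R k N P (fun y => (x, y)) f _ sf).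
by apply: smooth_map_pair; [exact: smooth_map_cst|exact: smooth_map_id].
Qed.

(** Writing T in the basis of divided derivatives reduces its action on a family
    of functions to partial derivatives with respect to the parameters. *)
Lemma dapply_expansion T : exists s : seq (multi_index (mdim N)), forall f, f \in smoothK N ->
  dapply T f = \sum_(a <- s) basis_coord Ad dN a T * (ifact a)%:R^-1 * partial_at (base N) d (word a) f.
Proof.
have [s _ E] := coord_expansion (dual_basis_distr k Ad dN) T.
exists s => f sf; rewrite dapplyE [in LHS]E distr_sumE; apply: eq_bigr => a _.
by rewrite -mulrA -[f in RHS]to_CinftyE.
Qed.

Lemma smooth_partial_at_slice (f : P -> K) s : f \in smoothK P ->
  (fun x => partial_at (base N) d s (fun y => f (x, y))) \in smoothK M.
Proof.
move=> /smooth_funP[rf jf]; apply/smooth_funP; split.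
  under [X in smooth_real X]funext => x do rewrite /= partial_at_re.
  exact: smooth_partial_slice rf.
under [X in smooth_real X]funext => x do rewrite /= partial_at_im.
exact: smooth_partial_slice jf.
Qed.

Lemma smooth_dapply_slice T (f : P -> K) : f \in smoothK P ->
  (fun x => dapply T (fun y => f (x, y))) \in smoothK M.
Proof.
move=> sf; have [s E] := dapply_expansion T.
under [X in X \in _]funext => x do rewrite E ?smooth_slice //.
apply: smooth_sumK => a; apply: smooth_mulK; first exact: smooth_cstK.
exact: smooth_partial_at_slice.
Qed.

(** T involves finitely many derivatives of the slices of f; if f is flat
    enough, all of them are flat of the order of S as functions of the first
    variable. *)
Lemma dist_prod_apply S T (f : Cinfty k P) :
  dist_prod S T f = dapply S (fun x => dapply T (fun y => f (x, y))).
Proof.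
rewrite /dist_prod.
have Ac := base_chart_atlas M; have cM := base_chart_dom M.
set c := base_chart M in Ac cM.
have [n Sn] := dapply_order S Ac cM.
have [s Ts] := dapply_expansion T.
(* Large enough for each of the finitely many derivatives that occur in T. *)
pose n' := (n + \sum_(a <- s) size (word a))%N.
pose pc := prod_chart c d.
have Apc : atlas (pc : chart R (mdim P) P) by exists c, d.
have pcP : cdom (pc : chart R (mdim P) P) (base P) by split.
rewrite (@to_distributionE R k P _ pc n') //.
  move=> a f1 f2; have s1 := Cinfty_smoothK f1; have s2 := Cinfty_smoothK f2.
  rewrite -dapply_lin ?smooth_dapply_slice //; congr dapply; apply/funext => x.
  by rewrite -dapply_lin ?smooth_slice.
move=> f1 [fr fj]; have sf := Cinfty_smoothK f1.
have [rf jf] := (smooth_funP _).1 sf.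
apply: Sn; first exact: smooth_dapply_slice.
under [X in flatK _ _ _ X]funext => x do rewrite Ts ?smooth_slice //.
have sw a : (fun x => basis_coord Ad dN a T * (ifact a)%:R^-1 *
    partial_at (base N) d (word a) (fun y => f1 (x, y))) \in smoothK M.
  by apply: smooth_mulK; [exact: smooth_cstK|exact: smooth_partial_at_slice].
apply: flatK_sum => // a sa.
apply: (@flatK_scale _ _ _ _ c n _ _ Ac cM (smooth_partial_at_slice (word a) sf)).
have le : (n + size (word a) <= n')%N by rewrite leq_add2l (big_rem a) ?leq_addr.
split.
  under [X in flat _ _ (X \o _)]funext => x do rewrite /= partial_at_re.
  exact: (@flat_partial_slice _ _ _ _ _ _ _ _ _ (@scalar_re R k \o f1) (flat_le le fr)).
under [X in flat _ _ (X \o _)]funext => x do rewrite /= partial_at_im.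
exact: (@flat_partial_slice _ _ _ _ _ _ _ _ _ (@scalar_im R k \o f1) (flat_le le fj)).
Qed.

Lemma dapply_prod S T (f : P -> K) : f \in smoothK P ->
  dapply (dist_prod S T) f = dapply S (fun x => dapply T (fun y => f (x, y))).
Proof. by move=> sf; rewrite dapplyE dist_prod_apply to_CinftyE. Qed.

Lemma dist_prod_bilinear : @bilinear_map _ (E' M) (E' N) (E' P) (@dist_prod R k M N).
Proof.
split=> [T a S S'|S a T T']; apply: distr_ext => f; have sf := Cinfty_smoothK f.
  rewrite -[RHS]/(a * dist_prod S T f + dist_prod S' T f).
  by rewrite !dist_prod_apply.
rewrite -[RHS]/(a * dist_prod S T f + dist_prod S T' f) !dist_prod_apply.
by rewrite -dapply_lin ?smooth_dapply_slice.
Qed.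

Lemma dist_F2_tens S T : dist_F2 (S \ox T) = dist_prod S T.
Proof. exact: (tensor_lift_tens _ _ dist_prod_bilinear). Qed.

Lemma dist_F2_linear : linear (@dist_F2 R k M N).
Proof. exact: (tensor_lift_linear dist_prod_bilinear). Qed.

Lemma smooth_tensorK (f : M -> K) (g : N -> K) : f \in smoothK M -> g \in smoothK N ->
  (fun p : P => f p.1 * g p.2) \in smoothK P.
Proof.
move=> sf sg; apply: smooth_mulK.
  exact: (@smooth_compK R k P M fst f (@smooth_map_fst _ M N) sf).
exact: (@smooth_compK R k P N snd g (@smooth_map_snd _ M N) sg).
Qed.

Lemma dapply_scalar (X : pmanifold R) (f : X -> K) : scalar (fun T : E' X => dapply T f).
Proof. by []. Qed.

(** On a product of functions the iterated evaluation splits. *)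
Lemma dist_F2_pairing t (f : M -> K) (g : N -> K) : f \in smoothK M -> g \in smoothK N ->
  dapply (dist_F2 t) (fun p : P => f p.1 * g p.2) =
  pairing (fun S : E' M => dapply S f) (fun T : E' N => dapply T g) t.
Proof.
move=> sf sg; apply: (@scalar_tensor_ext _ _ _ (fun t => dapply (dist_F2 t) _)) t.
- exact: (scalar_compose (dapply_scalar _) dist_F2_linear).
- by apply: pairing_linear; exact: dapply_scalar.
move=> S T; rewrite dist_F2_tens dapply_prod ?smooth_tensorK //.
rewrite pairingE; [|exact: dapply_scalar..].
rewrite mulrC -dapply_scale //; congr dapply; apply/funext => x.
by rewrite [RHS]mulrC -dapply_scale.
Qed.

End ProductDistributions.

(** * Bijectivity of the product map *)

Section ProductBasis.
Variables (R : realType) (k : scalar_kind).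
Local Notation K := (scalars R k).
Local Notation "'E'' M" := (distr_at k (base M)) (at level 10, M at level 9).
Local Notation smoothK M := (@smooth_fun R k M).

Section OneManifold.
Variable M : pmanifold R.
Let c := base_chart M.
Let Ac := base_chart_atlas M.
Let cM := base_chart_dom M.

Definition base_monomial a : Cinfty k M := monomial_function k Ac cM a.
Definition base_basis a : E' M := basis_distr k Ac cM a.
Definition base_coord a (T : E' M) : K := dapply T (base_monomial a).

Lemma base_coordE a (T : E' M) : base_coord a T = T (base_monomial a).
Proof. exact: dapply_Cinfty. Qed.

Lemma base_dual_basis : dual_basis base_basis base_coord.
Proof.
have [H1 H2 H3] := dual_basis_distr k Ac cM; split=> // [a b|T].
  by rewrite base_coordE; exact: H2.
have [s us E] := H3 T; exists s => //; rewrite [LHS]E; apply: eq_bigr => a _.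
by rewrite base_coordE.
Qed.

Lemma base_monomialE a : \forall y \near base M,
  base_monomial a y = of_real k (monomial (cfun c (base M)) a (cfun c y)).
Proof. exact: monomial_functionE. Qed.

End OneManifold.

Variables M N : pmanifold R.
Local Notation P := (prod_pmanifold M N).

Lemma base_coord_F2 a b (t : tensor (E' M) (E' N)) :
  dapply (dist_F2 t) (fun p : P => base_monomial a p.1 * base_monomial b p.2) =
  pairing (base_coord a) (base_coord b) t.
Proof. by apply: dist_F2_pairing; exact: Cinfty_smoothK. Qed.

Lemma dist_F2_inj : injective (@dist_F2 R k M N).
Proof.
move=> t u tu; apply: (pairing_inj (base_dual_basis M) (base_dual_basis N)) => a b.
by rewrite -!base_coord_F2 tu.
Qed.

Let c := base_chart M.
Let d := base_chart N.
Let pc : chart R (mdim P) P := prod_chart c d.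
Let Apc : atlas pc.
Proof. by exists c, d; split=> //; exact: base_chart_atlas. Qed.
Let pcP : cdom pc (base P).
Proof. by split; exact: base_chart_dom. Qed.

Definition index_l (g : multi_index (mdim M + mdim N)) : multi_index (mdim M) :=
  [ffun i => g (lshift _ i)].
Definition index_r (g : multi_index (mdim M + mdim N)) : multi_index (mdim N) :=
  [ffun i => g (rshift _ i)].

Lemma index_split g h : (g == h) = (index_l g == index_l h) && (index_r g == index_r h).
Proof.
apply/eqP/andP => [->//|[/eqP/ffunP L /eqP/ffunP H]]; apply/ffunP => j.
rewrite -[j]fintype.splitK; case: (fintype.split j) => i /=.
  by have := L i; rewrite !ffunE.
by have := H i; rewrite !ffunE.
Qed.

(** Near the base point the monomials of a product chart are products of
    monomials of the factors. *)
Lemma product_coord g (U : E' P) : basis_coord Apc pcP g U =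
  dapply U (fun p : P => base_monomial (index_l g) p.1 * base_monomial (index_r g) p.2).
Proof.
rewrite /basis_coord -dapply_Cinfty; apply: dapply_local.
- exact: Cinfty_smoothK.
- by apply: smooth_tensorK; exact: Cinfty_smoothK.
have n1 : \forall p \near base P, base_monomial (index_l g) p.1 = 
    of_real k (monomial (cfun c (base M)) (index_l g) (cfun c p.1)).
  exact: (@cvg_fst _ _ (nbhs (base M)) (nbhs (base N)) _ _ (base_monomialE (index_l g))).
have n2 : \forall p \near base P, base_monomial (index_r g) p.2 = 
    of_real k (monomial (cfun d (base N)) (index_r g) (cfun d p.2)).
  exact: (@cvg_snd _ _ (nbhs (base M)) (nbhs (base N)) _ _ (base_monomialE (index_r g))).
apply: filterS3 (monomial_functionE k Apc pcP g) n1 n2 => p -> -> ->.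
rewrite -of_realM; congr of_real; rewrite /monomial big_split_ord /=.
congr (_ * _); apply: eq_bigr => i _; rewrite ffunE.
  by rewrite !row_mxEl.
by rewrite !row_mxEr.
Qed.

(** A multi-index in m + n variables is a pair of multi-indices. *)
Lemma dist_F2_basis g :
  dist_F2 (base_basis (index_l g) \ox base_basis (index_r g)) =
  basis_distr k Apc pcP g.
Proof.
have DP := dual_basis_distr k Apc pcP.
apply: (coord_inj DP) => h.
rewrite (coord_dual DP) product_coord base_coord_F2.
have BM := base_dual_basis M; have BN := base_dual_basis N.
rewrite pairingE; [|exact: (coord_linear BM)|exact: (coord_linear BN)].
by rewrite (coord_dual BM) (coord_dual BN) -natrM mulnb index_split.
Qed.

Lemma dist_F2_surj U : exists t, @dist_F2 R k M N t = U.
Proof.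
have [s _ ->] := coord_expansion (dual_basis_distr k Apc pcP) U.
exists (\sum_(g <- s) basis_coord Apc pcP g U *:
  (base_basis (index_l g) \ox base_basis (index_r g))).
rewrite (linear_sums _ _ _ (@dist_F2_linear R k M N)); apply: eq_bigr => g _.
by rewrite (linear_Z _ _ (@dist_F2_linear R k M N)) dist_F2_basis.
Qed.

(** The coordinates in a product chart are values on products of functions. *)
Lemma product_separation (U V : E' P) :
  (forall (f : Cinfty k M) (g : Cinfty k N),
     dapply U (fun p : P => f p.1 * g p.2) = dapply V (fun p : P => f p.1 * g p.2)) ->
  U = V.
Proof.
move=> H; apply: (coord_inj (dual_basis_distr k Apc pcP)) => g.
by rewrite !product_coord H.
Qed.

(** The same for tensors of distributions on the product. *)
Lemma product_tensor_separation (t u : tensor (E' P) (E' P)) :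
  (forall (f f' : Cinfty k M) (g g' : Cinfty k N),
     pairing (fun U : E' P => dapply U (fun p : P => f p.1 * g p.2))
       (fun U : E' P => dapply U (fun p : P => f' p.1 * g' p.2)) t =
     pairing (fun U : E' P => dapply U (fun p : P => f p.1 * g p.2))
       (fun U : E' P => dapply U (fun p : P => f' p.1 * g' p.2)) u) ->
  t = u.
Proof.
have DP := dual_basis_distr k Apc pcP.
have E g : basis_coord Apc pcP g = fun U : E' P => dapply U (fun p : P =>
    base_monomial (index_l g) p.1 * base_monomial (index_r g) p.2).
  by apply/funext => U; exact: product_coord.
move=> H; refine (pairing_inj DP DP _) => g h.
by rewrite !E; exact: H.
Qed.

End ProductBasis.

(** * The coalgebra of distributions at a point *)

Section DistributionCoalgebra.
Variables (R : realType) (k : scalar_kind).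
Local Notation K := (scalars R k).
Local Notation "'E'' M" := (distr_at k (base M)) (at level 10, M at level 9).
Local Notation smoothK M := (@smooth_fun R k M).

Lemma pointed_diag (M : pmanifold R) : pointed_map (@diag_map R M).
Proof.
split=> //; apply: (@smooth_map_pair R M M M id id); exact: smooth_map_id.
Qed.

Variable M : pmanifold R.

(** The choice in the definition of the comultiplication is legitimate because
    F_2 is surjective; it is unambiguous by [dist_F2_inj]. *)
Lemma dist_F2_comul (T : E' M) : dist_F2 (dist_comul T) = dist_push (@diag_map R M) T.
Proof.
have [t Et] := dist_F2_surj (dist_push (@diag_map R M) T).
exact: (@xgetPex _ 0 [set t | dist_F2 t = dist_push (@diag_map R M) T] (ex_intro _ t Et)).
Qed.

(** The comultiplication is dual to the multiplication of functions. *)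
Lemma dist_comul_pairing (T : E' M) (f g : M -> K) :
  f \in smoothK M -> g \in smoothK M ->
  pairing (fun S : E' M => dapply S f) (fun S : E' M => dapply S g) (dist_comul T) =
  dapply T (fun x => f x * g x).
Proof.
move=> sf sg; rewrite -dist_F2_pairing // dist_F2_comul.
by rewrite (dapply_push _ (pointed_diag M)) // smooth_tensorK.
Qed.

Lemma dist_comul_linear : linear (@dist_comul R k M).
Proof.
move=> a S T; apply: dist_F2_inj.
rewrite dist_F2_comul (@dist_F2_linear R k M M) !dist_F2_comul.
exact: (dist_push_linear (pointed_diag M)).
Qed.

(** The product of two monomials is the monomial whose exponent is the sum, near
    the base point. *)
Theorem dist_divided_power :
  @divided_power_basis _ _ (dist_coalg k M) (@base_basis R k M) (@base_coord R k M).
Proof.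
have BM := base_dual_basis k M.
split=> //.
- exact: dist_comul_linear.
- move=> a b T; rewrite dist_comul_pairing ?Cinfty_smoothK //.
  apply: dapply_local.
  + by apply: smooth_mulK; exact: Cinfty_smoothK.
  + exact: Cinfty_smoothK.
  apply: filterS3 (base_monomialE k a) (base_monomialE k b) (base_monomialE k (a + b)).
  move=> x -> -> ->; rewrite -of_realM; congr of_real.
  by rewrite /monomial -big_split; apply: eq_bigr => i _; rewrite ffunE exprD.
- move=> T; apply: dapply_local; [exact: smooth_cstK|exact: Cinfty_smoothK|].
  apply: filterS (base_monomialE k 0) => x ->.
  rewrite /monomial big1 ?of_real1 // => i _.
  by rewrite ffunE expr0.
apply: (coord_inj BM) => a; rewrite (coord_dual BM) /base_coord dapply_dirac ?Cinfty_smoothK //.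
rewrite (nbhs_singleton (base_monomialE k a)) monomial_center of_real_nat.
by [].
Qed.

End DistributionCoalgebra.

(** * Compatibility with products *)

Section TensorCoalgebra.
Variable K : fieldType.

Section Interchange.
Variables C D : lmodType K.

(** The middle-four interchange (C (x) C) (x) (D (x) D) -> (C (x) D) (x) (C (x)
    D), through which the comultiplication of a tensor product is defined. *)
Definition interchange (s : tensor C C) (t : tensor D D) :
    tensor (tensor C D) (tensor C D) :=
  tensor_lift (fun c1 c2 =>
    tensor_lift (fun d1 d2 => (c1 \ox d1) \ox (c2 \ox d2)) t) s.

Lemma interchange_bilinear : bilinear_map interchange.
Proof.
have b1 (c1 c2 : C) : bilinear_map (fun d1 d2 : D => (c1 \ox d1) \ox (c2 \ox d2)).
  by split=> [d a x y|d a x y]; rewrite tensDr tensZr ?tensDl ?tensDr ?tensZl ?tensZr.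
apply: tensor_lift_bilinear_l => [t|c1 c2]; last exact: tensor_lift_linear.
split=> [c2|c1].
  apply: (tensor_lift_bilinear_l (b := fun d1 d2 c1 => (c1 \ox d1) \ox (c2 \ox d2)) _ _).2.
    by move=> c1; exact: b1.
  by move=> d1 d2 a x y; rewrite !tensDl !tensZl.
apply: (tensor_lift_bilinear_l (b := fun d1 d2 c2 => (c1 \ox d1) \ox (c2 \ox d2)) _ _).2.
  by move=> c2; exact: b1.
by move=> d1 d2 a x y; rewrite tensDl tensZl tensDr tensZr.
Qed.

Lemma interchange_tens (c1 c2 : C) (d1 d2 : D) :
  interchange (c1 \ox c2) (d1 \ox d2) = (c1 \ox d1) \ox (c2 \ox d2).
Proof.
have b1 (x y : C) : bilinear_map (fun d1 d2 : D => (x \ox d1) \ox (y \ox d2)).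
  by split=> [d a u v|d a u v]; rewrite tensDr tensZr ?tensDl ?tensDr ?tensZl ?tensZr.
rewrite /interchange tensor_lift_tens ?tensor_lift_tens //.
split=> [c|c].
  apply: (tensor_lift_bilinear_l (b := fun d1 d2 c1 => (c1 \ox d1) \ox (c \ox d2)) _ _).2.
    by move=> x; exact: b1.
  by move=> x y a u v; rewrite !tensDl !tensZl.
apply: (tensor_lift_bilinear_l (b := fun d1 d2 c2 => (c \ox d1) \ox (c2 \ox d2)) _ _).2.
  by move=> x; exact: b1.
by move=> x y a u v; rewrite tensDl tensZl tensDr tensZr.
Qed.

Lemma pairing_interchange (f f' : C -> K) (g g' : D -> K) s t :
  scalar f -> scalar f' -> scalar g -> scalar g' ->
  pairing (pairing f g) (pairing f' g') (interchange s t) =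
  pairing f f' s * pairing g g' t.
Proof.
move=> lf lf' lg lg'.
have lp : scalar (pairing (pairing f g) (pairing f' g')).
  by apply: pairing_linear; exact: pairing_linear.
apply: (@scalar_tensor_ext _ _ _ (fun s => pairing _ _ (interchange s t)) (fun s => pairing f f' s * pairing g g' t)) s.
- exact: (scalar_compose lp (interchange_bilinear.1 t)).
- by move=> a x y; rewrite pairing_linear // mulrDl mulrA.
move=> c1 c2.
apply: (@scalar_tensor_ext _ _ _ (fun t => pairing _ _ (interchange _ t)) (fun t => pairing f f' (c1 \ox c2) * pairing g g' t)) t.
- exact: (scalar_compose lp (interchange_bilinear.2 _)).
- by move=> a x y; rewrite pairing_linear // mulrDr !mulrA [_ * a]mulrC.
move=> d1 d2; rewrite interchange_tens !pairingE //; try exact: pairing_linear.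
by rewrite mulrACA.
Qed.

End Interchange.

End TensorCoalgebra.

Section FunctorIsMonoidal.
Variables (R : realType) (k : scalar_kind).
Local Notation K := (scalars R k).
Local Notation "'E'' M" := (distr_at k (base M)) (at level 10, M at level 9).
Local Notation smoothK M := (@smooth_fun R k M).
Implicit Types M N P : pmanifold R.

Lemma pointed_comp M N P (phi : M -> N) (psi : N -> P) :
  pointed_map phi -> pointed_map psi -> pointed_map (psi \o phi).
Proof.
move=> [sphi ephi] [spsi epsi]; split; first exact: smooth_map_comp.
by rewrite /= ephi.
Qed.

Lemma pointed_prod M M' N N' (phi : M -> M') (psi : N -> N') :
  pointed_map phi -> pointed_map psi -> pointed_map (prod_map phi psi).
Proof.
move=> [sphi ephi] [spsi epsi]; split; last by rewrite /prod_map /= ephi epsi.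
apply: smooth_map_pair.
  exact: (smooth_map_comp (@smooth_map_fst R M N) sphi).
exact: (smooth_map_comp (@smooth_map_snd R M N) spsi).
Qed.

Lemma pointed_swap M N : pointed_map (@swap_map R M N).
Proof. by split=> //; apply: smooth_map_pair; [exact: smooth_map_snd|exact: smooth_map_fst]. Qed.

Lemma pointed_assoc M N P : pointed_map (@assoc_map R M N P).
Proof.
split=> //; have s1 := @smooth_map_fst R (prod_manifold M N) P.
apply: smooth_map_pair; first exact: (smooth_map_comp s1 (@smooth_map_fst R M N)).
apply: smooth_map_pair; last exact: smooth_map_snd.
exact: (smooth_map_comp s1 (@smooth_map_snd R M N)).
Qed.

Lemma pointed_lunit M : pointed_map (@lunit_map R M).
Proof. by split=> //; exact: smooth_map_snd. Qed.

Lemma pointed_runit M : pointed_map (@runit_map R M).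
Proof. by split=> //; exact: smooth_map_fst. Qed.

Lemma dist_push_id M (T : E' M) : dist_push (@idfun M) T = T.
Proof.
apply: distr_ext => f; rewrite dist_push_apply ?dapply_Cinfty //.
by split=> //; exact: smooth_map_id.
Qed.

Lemma dist_push_comp M N P (phi : M -> N) (psi : N -> P) (T : E' M) :
  pointed_map phi -> pointed_map psi ->
  dist_push (psi \o phi) T = dist_push psi (dist_push phi T).
Proof.
move=> phiP psiP; have cP := pointed_comp phiP psiP.
apply: distr_ext => f; have sf := Cinfty_smoothK f.
rewrite !dist_push_apply // dapply_push //.
exact: (smooth_compK psiP.1).
Qed.

(** Dual to the fact that f |-> f o phi is a morphism of algebras. *)
Theorem dist_push_morphism M N (phi : M -> N) : pointed_map phi ->
  @coalg_morphism _ (dist_coalg k M) (dist_coalg k N) (dist_push phi).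
Proof.
move=> phiP; have lpush := @dist_push_linear R k M N phi phiP.
have spull (f : Cinfty k N) := smooth_compK phiP.1 (Cinfty_smoothK f).
split=> [//|T|T|].
- apply: (pairing_inj (base_dual_basis k N) (base_dual_basis k N)) => a b.
  rewrite dist_comul_pairing ?Cinfty_smoothK //.
  rewrite dapply_push //; last by apply: smooth_mulK; exact: Cinfty_smoothK.
  rewrite -[RHS](@dist_comul_pairing R k M T (base_monomial k a \o phi) (base_monomial k b \o phi)) //.
  rewrite pairing_map //; congr pairing; apply/funext => S.
    by rewrite /base_coord dapply_push ?Cinfty_smoothK.
  by rewrite /base_coord dapply_push ?Cinfty_smoothK.
- by apply: dapply_push => //; exact: smooth_cstK.
apply: distr_ext => f.
by rewrite dist_push_apply // dapply_dirac //= phiP.2 dirac_deltaE.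
Qed.

Lemma dist_F2_bijective M N : bijective (@dist_F2 R k M N).
Proof.
exists (fun U => sval (cid (dist_F2_surj U))) => [t|U].
  by apply: dist_F2_inj; rewrite (svalP (cid (dist_F2_surj _))).
exact: (svalP (cid (dist_F2_surj U))).
Qed.

(** By duality, compatibility with the comultiplications amounts to (f f') (x)
    (g g') = (f (x) g) (f' (x) g'). *)
Theorem dist_F2_iso M N :
  @coalg_iso _ (coalg_tensor (dist_coalg k M) (dist_coalg k N))
    (dist_coalg k (prod_pmanifold M N)) (@dist_F2 R k M N).
Proof.
split; last exact: dist_F2_bijective.
have lF := @dist_F2_linear R k M N.
split=> [//|t|t|].
- pose co f g (U : E' (prod_pmanifold M N)) := dapply U (fun p => (f : Cinfty k M) p.1 * (g : Cinfty k N) p.2).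
  have coE f g : (fun u => co f g (dist_F2 u)) =
      pairing (fun S : E' M => dapply S f) (fun T : E' N => dapply T g).
    by apply/funext => u; apply: dist_F2_pairing; exact: Cinfty_smoothK.
  apply: product_tensor_separation => f f' g g'.
  have lM (h : M -> K) := @dapply_scalar R k M h.
  have lN (h : N -> K) := @dapply_scalar R k N h.
  rewrite (@pairing_map _ _ _ _ _ (co f g) (co f' g')) //.
  rewrite !coE.
  rewrite dist_comul_pairing; last first.
  - by apply: smooth_tensorK; exact: Cinfty_smoothK.
  - by apply: smooth_tensorK; exact: Cinfty_smoothK.
  have sff : (fun x => f x * f' x) \in smoothK M by apply: smooth_mulK; exact: Cinfty_smoothK.
  have sgg : (fun x => g x * g' x) \in smoothK N by apply: smooth_mulK; exact: Cinfty_smoothK.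
  under [X in _ = dapply _ X]funext => p do rewrite mulrACA.
  rewrite (dist_F2_pairing t sff sgg).
  have bi : bilinear_map (fun (S : E' M) (T : E' N) => interchange (dist_comul S) (dist_comul T)).
    split=> [T|S].
      exact: (linear_compose ((interchange_bilinear _ _).1 (dist_comul T)) (@dist_comul_linear R k M)).
    exact: (linear_compose ((interchange_bilinear _ _).2 (dist_comul S)) (@dist_comul_linear R k N)).
  have lp : scalar (pairing (pairing (fun S : E' M => dapply S f) (fun T : E' N => dapply T g))
       (pairing (fun S : E' M => dapply S f') (fun T : E' N => dapply T g'))).
    by apply: pairing_linear; exact: pairing_linear.
  apply: (scalar_tensor_ext (scalar_compose lp (tensor_lift_linear bi)) (pairing_linear (lM _) (lN _))) => S T.
  rewrite (tensor_lift_tens _ _ bi) pairing_interchange // pairingE //.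
  by rewrite !dist_comul_pairing ?Cinfty_smoothK.
- have s1M := smooth_cstK (k := k) M 1; have s1N := smooth_cstK (k := k) N 1.
  rewrite -[RHS](dist_F2_pairing t s1M s1N); congr dapply.
  by apply/funext => p; rewrite mulr1.
apply: distr_ext => f; rewrite dist_F2_tens dist_prod_apply dirac_deltaE.
rewrite dapply_dirac ?smooth_dapply_slice ?Cinfty_smoothK //.
by rewrite dapply_dirac ?smooth_slice ?Cinfty_smoothK.
Qed.

(** The only multi-index in zero variables is 0. *)
Lemma point_coord_inj (T : E' (point_pmanifold R)) :
  T = dist_counit T *: dirac_delta k (point_pmanifold R).
Proof.
have DP := dist_divided_power k (point_pmanifold R).
apply: (coord_inj (base_dual_basis k (point_pmanifold R))) => a.
have -> : a = 0 by apply/ffunP => -[].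
rewrite -!(dp_counit DP) (scalar_Z (counit_linear (divided_power_C3 DP))).
by rewrite (counit_coaug (divided_power_C3 DP)) mulr1.
Qed.

Theorem dist_F0_iso :
  @coalg_iso _ (dist_coalg k (point_pmanifold R)) (coalg_unit K)
    (@dist_counit R k (point_pmanifold R)).
Proof.
have C3 := divided_power_C3 (dist_divided_power k (point_pmanifold R)).
have c1 : dist_counit (dirac_delta k (point_pmanifold R)) = 1 := counit_coaug C3.
have lc := scalar_linear (counit_linear C3).
have ld : linear (fun a : K^o => a *: dirac_delta k (point_pmanifold R)).
  by move=> a x y; rewrite scalerDl scalerA.
split.
  split=> // T.
  rewrite [T in LHS]point_coord_inj (linear_Z _ _ (comul_linear C3)).
  rewrite (linear_Z _ _ (tensor_map_linear lc lc)) (comul_coaug C3) tensor_mapE //.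
  by congr (_ *: (_ \ox _)); exact: c1.
exists (fun a => a *: dirac_delta k (point_pmanifold R)) => [T|a].
  by rewrite -point_coord_inj.
exact: (etrans (scalar_Z (counit_linear C3) a _) (etrans (congr1 ( *%R a) c1) (mulr1 a))).
Qed.

Theorem dist_F2_natural M M' N N' (phi : M -> M') (psi : N -> N') :
  pointed_map phi -> pointed_map psi -> forall t : tensor (E' M) (E' N),
  dist_push (prod_map phi psi) (dist_F2 t) =
  dist_F2 (tensor_map (dist_push phi) (dist_push psi) t).
Proof.
move=> phiP psiP t; apply: product_separation => f g.
have sf := Cinfty_smoothK f; have sg := Cinfty_smoothK g.
rewrite (dapply_push _ (pointed_prod phiP psiP)) ?smooth_tensorK //.
rewrite (dist_F2_pairing _ sf sg) pairing_map //; try exact: dist_push_linear.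
rewrite -[LHS]/(dapply (dist_F2 t) (fun p => (f \o phi) p.1 * (g \o psi) p.2)).
rewrite (dist_F2_pairing _ (smooth_compK phiP.1 sf) (smooth_compK psiP.1 sg)).
by congr pairing; apply/funext => S; rewrite dapply_push.
Qed.

(** Both sides evaluate the three factors successively on f(x, (y, z)). *)
Theorem dist_F2_assoc M N P (t : tensor (tensor (E' M) (E' N)) (E' P)) :
  dist_push (@assoc_map R M N P) (dist_F2 (tensor_map (@dist_F2 R k M N) id t)) =
  dist_F2 (tensor_map id (@dist_F2 R k N P) (tensor_assoc t)).
Proof.
have lMN := @dist_F2_linear R k M N; have lNP := @dist_F2_linear R k N P.
have aP := pointed_assoc M N P.
have l1 : linear (fun t => dist_push (@assoc_map R M N P)
    (dist_F2 (tensor_map (@dist_F2 R k M N) id t))).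
  apply: (linear_compose (dist_push_linear aP)).
  by apply: (linear_compose (@dist_F2_linear R k _ _)); exact: tensor_map_linear.
have l2 : linear (fun t : tensor (tensor (E' M) (E' N)) (E' P) =>
    dist_F2 (tensor_map id (@dist_F2 R k N P) (tensor_assoc t))).
  apply: (linear_compose (@dist_F2_linear R k _ _)).
  by apply: (linear_compose _ (@tensor_assoc_linear _ _ _ _)); exact: tensor_map_linear.
apply: (linear_tensor_ext l1 l2) => s U.
have lU (V : lmodType K) : linear (fun v : V => v \ox U) := (tens_bilinear _ _).1 U.
apply: (linear_tensor_ext (linear_compose l1 (lU _)) (linear_compose l2 (lU _))) => S T.
rewrite tensor_assocE !tensor_mapE // !dist_F2_tens.
apply: distr_ext => f; have sf := Cinfty_smoothK f.
have sfa := smooth_compK aP.1 sf.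
rewrite dist_push_apply // dapply_prod // dapply_prod ?smooth_dapply_slice //.
rewrite dist_prod_apply; congr dapply; apply/funext => x.
by rewrite dapply_prod // smooth_slice.
Qed.

(** A Fubini theorem: the order of the two evaluations does not matter. It is
    enough to see it on products of functions. *)
Theorem dist_F2_swap M N (t : tensor (E' M) (E' N)) :
  dist_push (@swap_map R M N) (dist_F2 t) = dist_F2 (tensor_swap t).
Proof.
apply: product_separation => g f.
have sf := Cinfty_smoothK f; have sg := Cinfty_smoothK g.
rewrite (dapply_push _ (pointed_swap M N)) ?smooth_tensorK //.
rewrite (dist_F2_pairing _ sg sf) pairing_swap // -(dist_F2_pairing _ sf sg).
by congr dapply; apply/funext => p; rewrite /= mulrC.
Qed.

Theorem dist_F2_lunit M (t : tensor (E' (point_pmanifold R)) (E' M)) :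
  dist_push (@lunit_map R M) (dist_F2 t) =
  tensor_lift (fun S T => dist_counit S *: T) t.
Proof.
apply: distr_ext => f; have sf := Cinfty_smoothK f.
have s1 := smooth_cstK (k := k) (point_pmanifold R) 1.
rewrite (dist_push_apply _ _ (pointed_lunit M)).
rewrite -[RHS]dapply_Cinfty (@pairing_scale_l _ _ _ _ (fun T => dapply T f)) //.
rewrite -(dist_F2_pairing t s1 sf); congr dapply.
by apply/funext => p; rewrite mul1r.
Qed.

Theorem dist_F2_runit M (t : tensor (E' M) (E' (point_pmanifold R))) :
  dist_push (@runit_map R M) (dist_F2 t) =
  tensor_lift (fun S T => dist_counit T *: S) t.
Proof.
apply: distr_ext => f; have sf := Cinfty_smoothK f.
have s1 := smooth_cstK (k := k) (point_pmanifold R) 1.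
rewrite (dist_push_apply _ _ (pointed_runit M)).
rewrite -[RHS]dapply_Cinfty (@pairing_scale_r _ _ _ (fun T => dapply T f)) //.
rewrite -(dist_F2_pairing t sf s1); congr dapply.
by apply/funext => p; rewrite mulr1.
Qed.

End FunctorIsMonoidal.

(** * Tangent maps in charts *)

Section TangentMaps.
Variable R : realType.
Implicit Types M N P : pmanifold R.
Local Notation "''e_' i" := (delta_mx 0 i) (at level 8, i at level 2, format "''e_' i").

Definition chart_point M (c : chart_at M) : 'rV[R]_(mdim M) := cfun (sval c) (base M).

Section Image.
Variables (M N : pmanifold R) (phi : M -> N) (phiP : pointed_map phi).
Variables (c : chart_at M) (d : chart_at N).
Let W := cimg (sval c) `&` (phi \o cinv (sval c)) @^-1` cdom (sval d).
Let Ac : atlas (sval c) := (svalP c).1.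
Let Ad : atlas (sval d) := (svalP d).1.
Let cM : cdom (sval c) (base M) := (svalP c).2.
Let dN : cdom (sval d) (base N) := (svalP d).2.

Lemma chart_representative_open : open W.
Proof. exact: (@open_map_preimage R M N phi (sval c) _ phiP.1.1 (@cdom_open _ _ _ _)). Qed.

Lemma chart_point_representative : W (chart_point c).
Proof.
split; first exact: cfun_img cM.
by rewrite /= cfunK // phiP.2.
Qed.

Lemma chart_representative_point :
  (cfun (sval d) \o phi \o cinv (sval c)) (chart_point c) = chart_point d.
Proof. by rewrite /= cfunK // phiP.2. Qed.

Lemma smooth_chart_representative : smooth_map_on W (cfun (sval d) \o phi \o cinv (sval c)).
Proof. exact: phiP.1.2 Ac Ad. Qed.

Lemma differentiable_representative j :
  differentiable (fun x => (cfun (sval d) \o phi \o cinv (sval c)) x 0 j) (chart_point c).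
Proof.
apply: (smooth_differentiable chart_representative_open) chart_point_representative.
exact: smooth_chart_representative.
Qed.

(** The components of the differential are directional derivatives, which are
    easier to localise than the differential. *)
Lemma tangent_imageE u j : tangent_image phi c u d 0 j =
  'D_u (fun x => (cfun (sval d) \o phi \o cinv (sval c)) x 0 j) (chart_point c).
Proof.
rewrite deriveE; last exact: differentiable_representative.
apply: diff_row; apply: row_differentiable => i.
exact: differentiable_representative.
Qed.

Lemma tangent_image_linear : linear (fun u => tangent_image phi c u d).
Proof. by move=> a u v; rewrite /tangent_image linearP. Qed.

(** The chain rule for a real function composed with the expression of phi in
    charts. *)
Lemma derive_tangent_image (V : set 'rV[R]_(mdim N)) h u : open V -> V (chart_point d) ->
  smooth_on V h ->
  'D_u (h \o (cfun (sval d) \o phi \o cinv (sval c))) (chart_point c) =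
  'D_(tangent_image phi c u d) h (chart_point d).
Proof.
move=> oV Vd sh; have dh := smooth_differentiable oV sh Vd.
have dh' := dh; rewrite -chart_representative_point in dh'.
rewrite (derive_comp_row u dh' differentiable_representative).2.
rewrite chart_representative_point deriveE // derive_coord //.
by apply: eq_bigr => j _; rewrite mulrC tangent_imageE.
Qed.

End Image.

(** The chain rule. With an identity as one of the two maps, it describes the
    changes of charts. *)
Lemma tangent_image_comp M N P (phi : M -> N) (psi : N -> P) c d e u :
  pointed_map phi -> pointed_map psi ->
  tangent_image (psi \o phi) c u e = tangent_image psi d (tangent_image phi c u d) e.
Proof.
move=> phiP psiP; apply/rowP => j.
have cP := pointed_comp phiP psiP.
rewrite !tangent_imageE //.
pose W := cimg (sval d) `&` (psi \o cinv (sval d)) @^-1` cdom (sval e).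
have oW : open W by exact: chart_representative_open.
rewrite -(@derive_tangent_image _ _ _ phiP c d W) //; last first.
- exact: smooth_chart_representative.
- exact: chart_point_representative.
apply: near_eq_derive.
have oV := @chart_representative_open _ _ _ phiP c d.
apply: filterS (open_nbhs_nbhs (conj oV (chart_point_representative phiP c d))).
by move=> x [_ dx] /=; rewrite cfunK.
Qed.

Lemma pointed_id M : pointed_map (@idfun M).
Proof. by split=> //; exact: smooth_map_id. Qed.

Lemma tangent_components M (v : tangent_space M) c d :
  v d = tangent_image (@idfun M) c (v c) d.
Proof. by have /asboolP := tangentP v; apply. Qed.

Lemma tangent_of_components M (v : chart_at M -> 'rV[R]_(mdim M)) :
  (forall c d, v d = tangent_image (@idfun M) c (v c) d) ->
  v \in @tangent_family R M.
Proof. by move=> H; apply/asboolP. Qed.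

Lemma tangent_image_family M N (phi : M -> N) c u : pointed_map phi ->
  tangent_image phi c u \in @tangent_family R N.
Proof.
move=> phiP; apply: tangent_of_components => d d'.
exact: (@tangent_image_comp _ _ _ phi idfun c d d' u phiP (@pointed_id N)).
Qed.

Theorem tangent_mapE M N (phi : M -> N) (v : tangent_space M) c d : pointed_map phi ->
  tangent_map phi v d = tangent_image phi c (v c) d.
Proof.
move=> phiP; rewrite /tangent_map.
rewrite [LHS](congr1 (fun w => w d) (insubdK _ (tangent_image_family _ _ phiP))).
rewrite (tangent_components v (preferred_chart M) c).
exact: (@tangent_image_comp _ _ _ idfun phi _ c d _ (@pointed_id M) phiP).
Qed.

(** The tangent vector whose components in the preferred chart form the i-th
    canonical basis vector. *)
Definition tangent_basis M (i : 'I_(mdim M)) : tangent_space M :=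
  MkTangent (tangent_image_family (preferred_chart M) 'e_i (@pointed_id M)).

Lemma tangent_ext M (v w : tangent_space M) :
  v (preferred_chart M) = w (preferred_chart M) -> v = w.
Proof.
move=> vw; apply/val_inj/funext => d.
by rewrite [LHS](tangent_components v (preferred_chart M)) vw -tangent_components.
Qed.

Lemma tangent_image_id M (c : chart_at M) u : tangent_image (@idfun M) c u c = u.
Proof.
apply/rowP => j; rewrite [LHS]tangent_imageE; last exact: pointed_id.
have oV := @chart_representative_open _ _ _ (@pointed_id M) c c.
have nV := open_nbhs_nbhs (conj oV (chart_point_representative (@pointed_id M) c c)).
rewrite (@near_eq_derive R 'rV[R]_(mdim M) R _ (fun x => x 0 j)); last first.
  by apply: filterS nV => x [cx _] /=; rewrite cinvK.
exact: (@derive_val _ _ _ _ _ _ _ (is_derive_coord _ _ _)).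
Qed.

Lemma tangent_basisE M i : tangent_basis i (preferred_chart M) = 'e_i.
Proof. exact: tangent_image_id. Qed.

Lemma tangent_expansion M (v : tangent_space M) :
  v = \sum_i v (preferred_chart M) 0 i *: tangent_basis i.
Proof.
apply: tangent_ext; rewrite [LHS]row_sum_delta.
have H I (r : seq I) (F : I -> tangent_space M) :
    (\sum_(i <- r) F i : tangent_space M) (preferred_chart M) = \sum_(i <- r) F i (preferred_chart M).
  elim: r => [|i r IH]; first by rewrite !big_nil.
  by rewrite !big_cons -IH.
rewrite H; apply: eq_bigr => i _.
by rewrite -[RHS]/(_ *: tangent_basis i (preferred_chart M)) tangent_basisE.
Qed.

Lemma tangent_map_linear M N (phi : M -> N) : pointed_map phi -> linear (tangent_map phi).
Proof.
move=> phiP a v w; apply: tangent_ext.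
rewrite -[RHS]/(a *: tangent_map phi v _ + tangent_map phi w _).
rewrite !(tangent_mapE _ (preferred_chart M)) //.
exact: tangent_image_linear.
Qed.

End TangentMaps.

(** * Tangent vectors as primitive elements *)

Section TangentPrimitives.
Variables (R : realType) (k : scalar_kind).
Local Notation K := (scalars R k).
Local Notation "'E'' M" := (distr_at k (base M)) (at level 10, M at level 9).
Local Notation smoothK M := (@smooth_fun R k M).
Implicit Types M N : pmanifold R.
Local Notation "''e_' i" := (delta_mx 0 i) (at level 8, i at level 2, format "''e_' i").

Lemma word_unit m (i : 'I_m) : word (iunit i) = [:: i].
Proof.
have s1 : size (word (iunit i)) = 1%N by rewrite -ideg_mult word_mult ideg_unit.
case E : (word _) s1 => [|j [|]] // _; congr [:: _].
apply: iunit_inj; rewrite -(word_mult (iunit i)) E.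
by apply/ffunP => l; rewrite !ffunE /= addn0 eq_sym.
Qed.

Lemma ifact_unit m (i : 'I_m) : ifact (iunit i) = 1%N.
Proof. by rewrite /ifact big1 // => j _; rewrite ffunE; case: eqP. Qed.

Lemma monomial_unit m (p : 'rV[R]_m) i x : monomial p (iunit i) x = x 0 i - p 0 i.
Proof.
rewrite /monomial (bigD1 i) //= ffunE eqxx expr1 big1 ?mulr1 // => j ji.
by rewrite ffunE (negPf ji) expr0.
Qed.

Lemma taylor_coef_unit m (p : 'rV[R]_m) i h : taylor_coef p (iunit i) h = 'D_('e_i) h p.
Proof. by rewrite /taylor_coef word_unit ifact_unit invr1 mul1r. Qed.

(** The i-th component, in the preferred chart, after extension of scalars. *)
Definition tangent_coord M (i : 'I_(mdim M)) (t : scalar_ext k (tangent_space M)) : K :=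
  tensor_lift (X := real_scalars R k)
    (fun (z : real_scalars R k) (v : tangent_space M) =>
       ((z : K) * of_real k (v (preferred_chart M) 0 i) : K)) t.

Lemma tangent_coord_bilinear M (i : 'I_(mdim M)) :
  @bilinear_map R (real_scalars R k) (tangent_space M) (real_scalars R k)
    (fun z v => ((z : K) * of_real k (v (preferred_chart M) 0 i) : K)).
Proof.
split=> [v a z z'|z a v v'].
  by rewrite -[LHS]/((of_real k a * (z : K) + z' : K) * _) mulrDl -mulrA.
rewrite -[LHS]/((z : K) * of_real k ((a *: v (preferred_chart M) + v' (preferred_chart M)) 0 i)).
rewrite !mxE of_realD of_realM mulrDr mulrCA.
by [].
Qed.

Lemma tangent_coord_tens M (i : 'I_(mdim M)) (z : real_scalars R k) (v : tangent_space M) :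
  tangent_coord i (z \ox v) = (z : K) * of_real k (v (preferred_chart M) 0 i).
Proof. exact: (tensor_lift_tens _ _ (tangent_coord_bilinear i)). Qed.

Lemma tangent_coordD M (i : 'I_(mdim M)) : {morph tangent_coord i : s t / s + t}.
Proof. exact: (linear_D (tensor_lift_linear (tangent_coord_bilinear i))). Qed.

Lemma scalar_ext_scale_bilinear (V : lmodType R) (a : K) :
  @bilinear_map R (real_scalars R k) V (scalar_ext k V)
    (fun z v => ((a * (z : K) : K) : real_scalars R k) \ox v).
Proof.
split=> [v b z z'|z b v v']; last by rewrite tensDr tensZr.
rewrite -[X in X \ox _]/((a * (of_real k b * (z : K) + z' : K) : K) : real_scalars R k).
rewrite mulrDr mulrCA.
rewrite -[X in X \ox _]/(b *: ((a * (z : K) : K) : real_scalars R k) + ((a * (z' : K) : K) : real_scalars R k)).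
by rewrite tensDl tensZl.
Qed.

Lemma tangent_coordZ M (i : 'I_(mdim M)) a t :
  tangent_coord i (scalar_ext_scale a t) = a * tangent_coord i t.
Proof.
have bs := scalar_ext_scale_bilinear (tangent_space M) a.
apply: (@additive_tensor_ext _ _ _ _ (fun t => tangent_coord i (scalar_ext_scale a t))
  (fun t => a * tangent_coord i t)) t.
- by move=> s t; rewrite /scalar_ext_scale (linear_D (tensor_lift_linear bs)) tangent_coordD.
- by move=> s t; rewrite tangent_coordD mulrDr.
move=> z v; rewrite /scalar_ext_scale (tensor_lift_tens _ _ bs) !tangent_coord_tens.
by rewrite mulrA.
Qed.

(** The derivation along a tangent vector, computed in the preferred chart. *)
Definition tangent_distr M (t : scalar_ext k (tangent_space M)) : E' M :=
  \sum_i tangent_coord i t *: base_basis k (iunit i).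

Lemma tangent_distr_linear M : scalar_ext_linear (@tangent_distr M).
Proof.
split=> [s t|a t]; rewrite /tangent_distr.
  by rewrite -big_split; apply: eq_bigr => i _; rewrite tangent_coordD scalerDl.
by rewrite scaler_sumr; apply: eq_bigr => i _; rewrite tangent_coordZ -scalerA.
Qed.

Lemma tangent_distr_coord M a (t : scalar_ext k (tangent_space M)) :
  base_coord a (tangent_distr t) = \sum_i tangent_coord i t * (a == iunit i)%:R.
Proof.
have BM := base_dual_basis k M.
rewrite /tangent_distr (scalar_sums (coord_linear BM a)); apply: eq_bigr => i _.
by rewrite (scalar_Z (coord_linear BM a)) (coord_dual BM).
Qed.

Lemma tangent_distr_coord_unit M i (t : scalar_ext k (tangent_space M)) :
  base_coord (iunit i) (tangent_distr t) = tangent_coord i t.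
Proof.
rewrite tangent_distr_coord (bigD1 i) //= eqxx mulr1 big1 ?addr0 // => j ji.
by rewrite (inj_eq (@iunit_inj _)) eq_sym (negPf ji) mulr0.
Qed.

Lemma tangent_distr_primitive M (t : scalar_ext k (tangent_space M)) :
  @primitive_elements _ (dist_coalg k M) (tangent_distr t).
Proof.
apply/(divided_power_primitive (dist_divided_power k M)) => a a1.
rewrite tangent_distr_coord big1 // => i _.
case: eqP => [E|]; last by rewrite mulr0.
by rewrite E ideg_unit in a1.
Qed.

Lemma primitive_ext M (S T : E' M) :
  @primitive_elements _ (dist_coalg k M) S -> @primitive_elements _ (dist_coalg k M) T ->
  (forall i, base_coord (iunit i) S = base_coord (iunit i) T) -> S = T.
Proof.
have DP := divided_power_primitive (dist_divided_power k M).
move=> /DP HS /DP HT H; apply: (coord_inj (base_dual_basis k M)) => a.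
have [a1|a1] := eqVneq (ideg a) 1%N; last by rewrite HS // HT.
by have [i ->] := ideg_eq1 a1; exact: H.
Qed.

Lemma scalar_ext_expansion M (t : scalar_ext k (tangent_space M)) :
  t = \sum_i (tangent_coord i t : real_scalars R k) \ox tangent_basis i.
Proof.
apply: (@additive_tensor_ext _ _ _ _ id (fun t =>
  \sum_i (tangent_coord i t : real_scalars R k) \ox tangent_basis i)) t => //.
  move=> s t; rewrite -big_split; apply: eq_bigr => i _.
  by rewrite tangent_coordD tensDl.
move=> z v; rewrite [v in LHS]tangent_expansion tens_sumr; apply: eq_bigr => i _.
rewrite tensZr -tensZl tangent_coord_tens; congr (_ \ox _).
by rewrite mulrC.
Qed.

Lemma tangent_distr_inj M : injective (@tangent_distr M).
Proof.
move=> s t st; rewrite (scalar_ext_expansion s) (scalar_ext_expansion t).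
by apply: eq_bigr => i _; rewrite -!tangent_distr_coord_unit st.
Qed.

Lemma tangent_distr_range M :
  range (@tangent_distr M) = @primitive_elements _ (dist_coalg k M).
Proof.
apply/seteqP; split=> [_ [t _ <-]|T TP]; first exact: tangent_distr_primitive.
exists (\sum_i (base_coord (iunit i) T : real_scalars R k) \ox tangent_basis i) => //.
apply: primitive_ext => // [|j]; first exact: tangent_distr_primitive.
rewrite tangent_distr_coord_unit.
have H I (r : seq I) F : @tangent_coord M j (\sum_(i <- r) F i) = \sum_(i <- r) tangent_coord j (F i).
  exact: (linear_sums _ _ _ (tensor_lift_linear (tangent_coord_bilinear j))).
rewrite H (bigD1 j) //= tangent_coord_tens tangent_basisE mxE !eqxx of_real1 mulr1.
rewrite big1 ?addr0 // => i ij; rewrite tangent_coord_tens tangent_basisE mxE.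
by rewrite eq_sym (negPf ij) andbF of_real0 mulr0.
Qed.

Lemma push_primitive M N (phi : M -> N) (T : E' M) : pointed_map phi ->
  @primitive_elements _ (dist_coalg k M) T ->
  @primitive_elements _ (dist_coalg k N) (dist_push phi T).
Proof.
move=> phiP TP; have [lp cp _ c1] := dist_push_morphism k phiP.
apply: etrans (esym (cp T)) _; rewrite TP (linear_D (tensor_map_linear lp lp)).
by rewrite !tensor_mapE // c1.
Qed.

(** The derivative in direction i of the j-th coordinate of phi is an entry of
    the Jacobian matrix. *)
Lemma push_basis_unit M N (phi : M -> N) i j : pointed_map phi ->
  base_coord (iunit j) (dist_push phi (base_basis k (iunit i))) =
  of_real k (tangent_image phi (preferred_chart M) 'e_i (preferred_chart N) 0 j).
Proof.
move=> phiP; rewrite /base_coord dapply_push ?Cinfty_smoothK //.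
have sm := smooth_compK phiP.1 (Cinfty_smoothK (base_monomial k (iunit j))).
set c := preferred_chart M; set d := preferred_chart N.
pose h x := cfun (sval d) (phi (cinv (sval c) x)) 0 j - chart_point d 0 j.
rewrite dapplyE (@basis_distr_local _ _ _ _ _ _ _ _ _ h); last first.
  have nM : \forall y \near base M, base_monomial k (iunit j) (phi y) =
      of_real k (monomial (chart_point d) (iunit j) (cfun (sval d) (phi y))).
    have nN : \forall y \near phi (base M), base_monomial k (iunit j) y =
        of_real k (monomial (chart_point d) (iunit j) (cfun (sval d) y)).
      by rewrite phiP.2; exact: base_monomialE.
    exact: (phiP.1.1 _ _ nN).
  have cM := (svalP c).2.
  apply: filterS2 (open_nbhs_nbhs (conj (@cdom_open _ _ _ (sval c)) cM)) nM => y cy E.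
  rewrite to_CinftyE //= E monomial_unit /h cfunK //.
rewrite taylor_coef_unit tangent_imageE //; congr of_real.
have dF := diff_derivable (differentiable_representative phiP c d j).
rewrite -[LHS]/('D_'e_i ((fun x => (cfun (sval d) \o phi \o cinv (sval c)) x 0 j) -
  cst (chart_point d 0 j)) (chart_point c)).
by rewrite deriveB // derive_cst subr0.
Qed.

(** Both sides are primitive, so it is enough to compare the coordinates of
    degree one; on both sides they are given by the Jacobian matrix. *)
Lemma tangent_distr_natural M N (phi : M -> N) (t : scalar_ext k (tangent_space M)) :
  pointed_map phi ->
  dist_push phi (tangent_distr t) = tangent_distr (scalar_ext_map (tangent_map phi) t).
Proof.
move=> phiP.
apply: primitive_ext => [||j].
- exact/push_primitive/tangent_distr_primitive.
- exact: tangent_distr_primitive.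
rewrite tangent_distr_coord_unit.
have BN := base_dual_basis k N.
rewrite /tangent_distr (linear_sums _ _ _ (dist_push_linear phiP)).
rewrite (scalar_sums (coord_linear BN _)).
under eq_bigr => i _ do rewrite (linear_Z _ _ (dist_push_linear phiP))
  (scalar_Z (coord_linear BN _)) push_basis_unit //.
have lm := tensor_map_linear (@linear_id _ (real_scalars R k)) (tangent_map_linear phiP).
move: t; apply: (@additive_tensor_ext R (real_scalars R k) (tangent_space M) K) => [s t|s t|z v].
- by rewrite -big_split; apply: eq_bigr => i _; rewrite tangent_coordD mulrDl.
- by rewrite /scalar_ext_map (linear_D lm) tangent_coordD.
rewrite /scalar_ext_map tensor_mapE //; last exact: tangent_map_linear.
rewrite tangent_coord_tens (tangent_mapE _ (preferred_chart M)) //.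
rewrite [v (preferred_chart M) in RHS]row_sum_delta.
rewrite (linear_sums _ _ _ (tangent_image_linear _ _ _)) summxE.
rewrite (big_morph _ (@of_realD R k) (@of_real0 R k)) mulr_sumr.
apply: eq_bigr => i _; rewrite tangent_coord_tens (linear_Z _ _ (tangent_image_linear _ _ _)).
by rewrite mxE of_realM mulrA.
Qed.

End TangentPrimitives.

Theorem theorem3p1 (R : realType) (k : scalar_kind) :
  (* The distributions delta_e, phi_* T and F_2 (S (x) T) are well defined and
     given by the expected formulas. *)
  [/\ (forall (M : pmanifold R) (f : Cinfty k M),
         dirac_delta k M f = f (base M)),
      (forall (M N : pmanifold R) (phi : M -> N), pointed_map phi ->
         forall (T : distr_at k (base M)) (f : Cinfty k N),
           (f \o phi : M -> scalars R k) \in @smooth_fun R k M /\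
           dist_push phi T f = dapply T (f \o phi)) &
      (forall (M N : pmanifold R) (S : distr_at k (base M))
              (T : distr_at k (base N)) (f : Cinfty k (prod_pmanifold M N)),
         [/\ (forall x : M, (fun y : N => f (x, y)) \in @smooth_fun R k N),
             (fun x : M => dapply T (fun y : N => f (x, y)))
               \in @smooth_fun R k M &
             dist_F2 (S \ox T) f =
               dapply S (fun x => dapply T (fun y => f (x, y)))])] /\
  (* 1 *)
  (forall M : pmanifold R,
     is_C5 (dist_coalg k M) /\
     exists Phi : sym_coalg (scalars R k) (mdim M) -> dist_coalg k M,
       coalg_iso Phi) /\
  (* 2 : functoriality *)
  [/\ (forall (M N : pmanifold R) (phi : M -> N), pointed_map phi ->
         @coalg_morphism _ (dist_coalg k M) (dist_coalg k N) (dist_push phi)),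
      (forall (M : pmanifold R) (T : distr_at k (base M)),
         dist_push (@idfun M) T = T) &
      (forall (M N P : pmanifold R) (phi : M -> N) (psi : N -> P),
         pointed_map phi -> pointed_map psi ->
         forall T : distr_at k (base M),
           dist_push (psi \o phi) T = dist_push psi (dist_push phi T))] /\
  (* 2 : F_2 and F_0 are isomorphisms of coalgebras, natural and coherent *)
  [/\ (forall M N : pmanifold R,
         @coalg_iso _ (coalg_tensor (dist_coalg k M) (dist_coalg k N))
           (dist_coalg k (prod_pmanifold M N)) (@dist_F2 R k M N)),
      @coalg_iso _ (dist_coalg k (point_pmanifold R)) (coalg_unit (scalars R k))
        (@dist_counit R k (point_pmanifold R)) &
      (forall (M M' N N' : pmanifold R) (phi : M -> M') (psi : N -> N'),
         pointed_map phi -> pointed_map psi ->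
         forall t : tensor (distr_at k (base M)) (distr_at k (base N)),
           dist_push (prod_map phi psi) (dist_F2 t) =
           dist_F2 (tensor_map (dist_push phi) (dist_push psi) t))] /\
  [/\ (forall (M N P : pmanifold R)
         (t : tensor (tensor (distr_at k (base M)) (distr_at k (base N)))
                (distr_at k (base P))),
         dist_push (@assoc_map R M N P) (dist_F2 (tensor_map (@dist_F2 R k M N) id t)) =
         dist_F2 (tensor_map id (@dist_F2 R k N P) (tensor_assoc t))),
      (forall (M N : pmanifold R)
         (t : tensor (distr_at k (base M)) (distr_at k (base N))),
         dist_push (@swap_map R M N) (dist_F2 t) = dist_F2 (tensor_swap t)),
      (forall (M : pmanifold R)
         (t : tensor (distr_at k (base (point_pmanifold R)))
                (distr_at k (base M))),
         dist_push (@lunit_map R M) (dist_F2 t) =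
         tensor_lift (fun S T => dist_counit S *: T) t) &
      (forall (M : pmanifold R)
         (t : tensor (distr_at k (base M))
                (distr_at k (base (point_pmanifold R)))),
         dist_push (@runit_map R M) (dist_F2 t) =
         tensor_lift (fun S T => dist_counit T *: S) t)] /\
  (* 3 *)
  (forall (M N : pmanifold R) (phi : M -> N), pointed_map phi ->
     forall (v : tangent_space M) (c : chart_at M) (d : chart_at N),
       tangent_map phi v d = tangent_image phi c (v c) d) /\
  exists theta : forall M : pmanifold R,
      scalar_ext k (tangent_space M) -> distr_at k (base M),
    (forall M : pmanifold R,
       [/\ scalar_ext_linear (theta M), injective (theta M) &
           range (theta M) = @primitive_elements _ (dist_coalg k M)]) /\
    (forall (M N : pmanifold R) (phi : M -> N), pointed_map phi ->
       forall t : scalar_ext k (tangent_space M),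
         dist_push phi (theta M t) =
         theta N (scalar_ext_map (tangent_map phi) t)).
Proof.
split.
  split=> [M f|M N phi phiP T f|M N S T f]; first exact: dirac_deltaE.
    by split; [exact: smooth_compK phiP.1 (Cinfty_smoothK f)|exact: dist_push_apply].
  have sf := Cinfty_smoothK f.
  split=> [x||]; [exact: smooth_slice|exact: smooth_dapply_slice|].
  by rewrite dist_F2_tens dist_prod_apply.
split.
  move=> M; have DP := dist_divided_power k M.
  split; first exact: divided_power_C5 DP.
  by eexists; exact: (SymmetricCoalgebraIso.sym_coalg_iso DP).
split.
  split=> [M N phi|M T|M N P phi psi phiP psiP T].
  - exact: dist_push_morphism.
  - exact: dist_push_id.
  - exact: dist_push_comp.
split.
  by split=> [M N||M M' N N' phi psi phiP psiP t];
    [exact: dist_F2_iso|exact: dist_F0_iso|exact: dist_F2_natural].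
split.
  split=> [M N P t|M N t|M t|M t].
  - exact: dist_F2_assoc.
  - exact: dist_F2_swap.
  - exact: dist_F2_lunit.
  - exact: dist_F2_runit.
split=> [M N phi phiP v c d|]; first exact: tangent_mapE.
exists (@tangent_distr R k); split=> [M|M N phi phiP t].
  split; [exact: tangent_distr_linear|exact: tangent_distr_inj|exact: tangent_distr_range].
exact: tangent_distr_natural.
Qed.
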